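(* Let $\mathcal{H}$ be a Hilbert space, let $p,q\in\mathcal{P}_{\mathcal{C}(\mathcal{H})}$ be projections in the Calkin algebra, and put $b=p+q$. If $b-1$ has trivial annihilator in $\mathcal{C}(\mathcal{H})$, then there exists a unique minimal geodesic of $\mathcal{P}_{\mathcal{C}(\mathcal{H})}$ between $p$ and $q$.
   Context: $\mathcal{B}(\mathcal{H})$ is the algebra of bounded linear operators on the complex Hilbert space $\mathcal{H}$, $\mathcal{K}(\mathcal{H})$ is the ideal of compact operators, and $\mathcal{C}(\mathcal{H})=\mathcal{B}(\mathcal{H})/\mathcal{K}(\mathcal{H})$ is the Calkin algebra with its quotient C$^*$-norm. For a unital C$^*$-algebra $\mathcal{A}$, $\mathcal{P}_{\mathcal{A}}=\{p\in\mathcal{A}: p=p^*=p^2\}$ is the set of (selfadjoint) projections; it is a smooth submanifold of the real Banach space of selfadjoint elements of $\mathcal{A}$. Write $p^\perp=1-p$. A selfadjoint element $c\in\mathcal{C}(\mathcal{H})$ has trivial annihilator if, for $x\in\mathcal{C}(\mathcal{H})$, $cx=0$ implies $x=0$ (equivalently, since $c^*=c$, $xc=0$ implies $x=0$). A geodesic of $\mathcal{P}_{\mathcal{A}}$ starting at $p\in\mathcal{P}_{\mathcal{A}}$ is a curve of the form $\delta(t)=e^{tz}pe^{-tz}$, where $z\in\mathcal{A}$ satisfies $z^*=-z$ and $pzp=p^\perp z p^\perp=0$. It joins $p$ and $q$ (is a geodesic between $p$ and $q$) if $\delta(0)=p$ and $\delta(1)=q$ (with $t\in[0,1]$). The length of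 a piecewise smooth curve $\gamma:[t_0,t_1]\to\mathcal{P}_{\mathcal{A}}$ is $\int_{t_0}^{t_1}\|\dot\gamma(t)\|\,dt$, where $\|\cdot\|$ is the norm of $\mathcal{A}$. A geodesic $\delta$, $t\in[0,1]$, joining $p$ and $q$ is minimal if its length is less than or equal to the length of every piecewise smooth curve in $\mathcal{P}_{\mathcal{A}}$ joining $p$ and $q$. *)

(* Defs.v *)
From HB Require Import structures.
From mathcomp Require Import all_boot all_order all_algebra.
From mathcomp Require Import generic_quotient ring_quotient sesquilinear complex.
From mathcomp Require Import all_classical all_reals all_analysis.
From mathcomp Require Import lra.

Set Implicit Arguments.
Unset Strict Implicit.
Unset Printing Implicit Defensive.

Import Order.TTheory GRing.Theory Num.Theory Num.Def.
Import numFieldNormedType.Exports.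

Local Open Scope classical_set_scope.
Local Open Scope ring_scope.
Local Open Scope complex_scope.

HB.mixin Record isHilbert (R : realType) H of CompleteNormedModule R[i] H := {
  hdot : {dot H for (@conjC R[i])};
  hdot_norm : forall x : H, `|x| ^+ 2 = hdot x x
}.

#[short(type="hilbertType")]
HB.structure Definition Hilbert (R : realType) :=
  {H of isHilbert R H & CompleteNormedModule R[i] H}.

(* The norm of a normedModType R[i] takes its values in R[i]; this is the same
   norm seen as a real number. *)
Definition rnorm (R : realType) (V : normedModType R[i]) (x : V) : R :=
  complex.Re `|x|.

Section RealNorm.
Variables (R : realType) (V : normedModType R[i]).
Implicit Types (x y : V) (a : R[i]) (r : R).

Lemma rnormE x : `|x| = (rnorm x)%:C.
Proof.
rewrite /rnorm; have := normr_ge0 x; case: `|x| => u v.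
by rewrite lecE /= => /andP[/eqP-> _].
Qed.

Lemma rnorm_ge0 x : 0 <= rnorm x.
Proof. by have := normr_ge0 x; rewrite rnormE lecR. Qed.

Lemma rnorm0 : rnorm (0 : V) = 0.
Proof. by rewrite /rnorm normr0. Qed.

Lemma rnorm_eq0 x : rnorm x = 0 -> x = 0.
Proof. by move=> x0; apply/normr0_eq0; rewrite rnormE x0. Qed.

Lemma rnormD x y : rnorm (x + y) <= rnorm x + rnorm y.
Proof. by have := ler_normD x y; rewrite !rnormE -raddfD/= lecR. Qed.

Lemma rnormN x : rnorm (- x) = rnorm x.
Proof. by rewrite /rnorm normrN. Qed.

Lemma rnormZ a x : rnorm (a *: x) = complex.Re `|a| * rnorm x.
Proof.
rewrite /rnorm normrZ rnormE /=; case: `|a| => u v /=.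
by rewrite mulr0 subr0.
Qed.

Lemma rnormZr r x : rnorm (r%:C *: x) = `|r| * rnorm x.
Proof. by rewrite rnormZ normc_def /= expr0n addr0 sqrtr_sqr. Qed.

End RealNorm.

Section BoundedOperators.
Variables (R : realType) (H : hilbertType R).

Definition bounded_op : {pred H -> H} :=
  [pred T : H -> H |
    `[< linear T /\ exists M : R[i], forall x, `|T x| <= M * `|x| >]].

Lemma bounded_opP (T : H -> H) : reflect
  (linear T /\ exists2 M : R, 0 <= M & forall x, rnorm (T x) <= M * rnorm x)
  (T \in bounded_op).
Proof.
apply: (iffP (asboolP _)) => -[linT [M]].
  move=> TM; split=> //; exists (`|complex.Re M|) => // x.
  have := TM x; rewrite !rnormE => {TM}; case: M => u v.
  rewrite lecE /= => /andP[_]; rewrite !mulr0 subr0 => /le_trans; apply.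
  by rewrite ler_wpM2r ?rnorm_ge0 ?ler_norm.
move=> M0 TM; split=> //; exists M%:C => x.
by rewrite !rnormE -rmorphM /= lecR.
Qed.

Lemma bounded_op_submod_closed : submod_closed bounded_op.
Proof.
split.
  apply/bounded_opP; split; first by move=> a x y; rewrite scaler0 addr0.
  by exists 0 => // x; rewrite rnorm0 mul0r.
move=> a S T /bounded_opP[linS [M M0 SM]] /bounded_opP[linT [N N0 TN]].
apply/bounded_opP; split=> [b x y|].
  rewrite !fctE /= linS linT !scalerDr addrACA; congr (_ + _ + _).
  by rewrite !scalerA mulrC.
have a0 : 0 <= complex.Re `|a| by exact: (rnorm_ge0 (a : R[i]^o)).
exists (complex.Re `|a| * M + N); first by rewrite addr_ge0 ?mulr_ge0.
move=> x; rewrite !fctE /= (le_trans (rnormD _ _))// mulrDl lerD//.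
by rewrite rnormZ -mulrA ler_wpM2l.
Qed.

HB.instance Definition _ := GRing.isSubmodClosed.Build R[i] (H -> H) bounded_op
  bounded_op_submod_closed.

Record bop := Bop {bop_fun :> H -> H; _ : bop_fun \in bounded_op}.

HB.instance Definition _ := [isSub for bop_fun].
HB.instance Definition _ := [Choice of bop by <:].
HB.instance Definition _ := [SubChoice_isSubLmodule of bop by <:].

Implicit Types (S T : bop) (x y : H).

Lemma bopP T : linear T /\
  exists2 M : R, 0 <= M & forall x, rnorm (T x) <= M * rnorm x.
Proof. by case: T => T /= /bounded_opP. Qed.

Lemma bop_linear T : linear T. Proof. by case: (bopP T). Qed.

HB.instance Definition _ T := GRing.isLinear.Build R[i] H H *:%R T (bop_linear T).

Lemma bopE (T S : bop) : T =1 S -> T = S.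
Proof. by move=> TS; apply/val_inj/funext. Qed.

Lemma bop1_subproof : (id : H -> H) \in @bounded_op.
Proof. by apply/bounded_opP; split=> //; exists 1 => // x; rewrite mul1r. Qed.

Lemma bopM_subproof S T : (S \o T : H -> H) \in @bounded_op.
Proof.
have [_ [M M0 SM]] := bopP S; have [_ [N N0 TN]] := bopP T.
apply/bounded_opP; split; first by move=> a x y /=; rewrite !linearP.
exists (M * N); first exact: mulr_ge0.
by move=> x /=; rewrite (le_trans (SM _))// -mulrA ler_wpM2l.
Qed.

Definition bop1 := Bop bop1_subproof.
Definition bopM S T := Bop (bopM_subproof S T).

Lemma bopMA : associative bopM. Proof. by move=> S T U; apply/bopE. Qed.
Lemma bop1M : left_id bop1 bopM. Proof. by move=> T; apply/bopE. Qed.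
Lemma bopM1 : right_id bop1 bopM. Proof. by move=> T; apply/bopE. Qed.
Lemma bopMDl : left_distributive bopM +%R.
Proof. by move=> S T U; apply/bopE. Qed.
Lemma bopMDr : right_distributive bopM +%R.
Proof. by move=> S T U; apply/bopE => x; exact: linearD. Qed.

HB.instance Definition _ :=
  GRing.Zmodule_isPzRing.Build bop bopMA bop1M bopM1 bopMDl bopMDr.

Lemma bopZAl (a : R[i]) S T : a *: (S * T) = (a *: S) * T.
Proof. exact/bopE. Qed.
Lemma bopZAr (a : R[i]) S T : a *: (S * T) = S * (a *: T).
Proof. by apply/bopE => x; rewrite [RHS]linearZ. Qed.

Definition opnorm T : R := sup [set rnorm (T x) | x in [set x | rnorm x <= 1]].

Lemma opnorm_has_sup T :
  has_sup [set rnorm (T x) | x in [set x | rnorm x <= 1]].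
Proof.
split; first by exists (rnorm (T 0)); exists 0 => //=; rewrite rnorm0.
have [_ [M M0 TM]] := bopP T; exists M => _ [x /= x1 <-].
by rewrite (le_trans (TM _))// ler_piMr.
Qed.

Lemma opnorm_ge0 T : 0 <= opnorm T.
Proof.
apply: (le_trans (rnorm_ge0 (T 0))); apply: (sup_upper_bound (opnorm_has_sup T)).
by exists 0 => //=; rewrite rnorm0.
Qed.

Lemma opnormP T x : rnorm (T x) <= opnorm T * rnorm x.
Proof.
have [->|x0] := eqVneq x 0; first by rewrite linear0 rnorm0 mulr0.
have nx0 : 0 < rnorm x.
  rewrite lt_def rnorm_ge0 andbT; apply: contra x0 => /eqP.
  by move=> /rnorm_eq0 ->.
rewrite -ler_pdivrMr// mulrC; apply: (sup_upper_bound (opnorm_has_sup T)).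
have nV : `|(rnorm x)^-1| = (rnorm x)^-1 by rewrite gtr0_norm ?invr_gt0.
exists ((rnorm x)^-1%:C *: x); last by rewrite linearZ rnormZr nV.
by rewrite /= rnormZr nV mulVf ?gt_eqF.
Qed.

Lemma opnorm_le T (M : R) :
  0 <= M -> (forall x, rnorm (T x) <= M * rnorm x) -> opnorm T <= M.
Proof.
move=> M0 TM; apply: ge_sup; first by case: (opnorm_has_sup T).
by move=> _ [x /= x1 <-]; rewrite (le_trans (TM x))// ler_piMr.
Qed.

Lemma opnormD S T : opnorm (S + T) <= opnorm S + opnorm T.
Proof.
apply: opnorm_le => [|x]; first by rewrite addr_ge0 ?opnorm_ge0.
by rewrite (le_trans (rnormD _ _))// mulrDl lerD// opnormP.
Qed.

Lemma opnorm0 : opnorm 0 = 0.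
Proof.
apply/eqP; rewrite eq_le opnorm_ge0 andbT; apply: opnorm_le => // x.
by rewrite mul0r rnorm0.
Qed.

Lemma opnormZ_le (a : R[i]) T : opnorm (a *: T) <= complex.Re `|a| * opnorm T.
Proof.
have a0 : 0 <= complex.Re `|a| by exact: (rnorm_ge0 (a : R[i]^o)).
apply: opnorm_le => [|x]; first by rewrite mulr_ge0 ?opnorm_ge0.
by rewrite [_ x]/(a *: T x) rnormZ -mulrA ler_wpM2l// opnormP.
Qed.

Definition compact_op : {pred bop} :=
  [pred T : bop | `[< precompact (T @` [set x | rnorm x <= 1]) >]].

Lemma compact_opP T :
  reflect (precompact (T @` [set x | rnorm x <= 1])) (T \in compact_op).
Proof. exact: asboolP. Qed.

Lemma bop_continuous T : continuous T.
Proof.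
apply: bounded_linear_continuous; apply/linear_boundedP.
have [_ [M M0 TM]] := bopP T.
exists M%:C; split; first by apply: ger0_real; rewrite lecR.
move=> r Mr x; apply: (@le_trans _ _ (M%:C * `|x|)).
  by rewrite !rnormE -rmorphM /= lecR.
by rewrite ler_wpM2r// ltW.
Qed.

Lemma compact_op_sub T (K : set H) :
  compact K -> (forall x, rnorm x <= 1 -> K (T x)) -> T \in compact_op.
Proof.
move=> cK TK; apply/compact_opP.
apply: precompact_subset (compact_precompact (@norm_hausdorff _ _) cK).
by move=> _ [x /= x1 <-]; exact: TK.
Qed.

Lemma compact_op_submod_closed : submod_closed compact_op.
Proof.
split; first by apply: (@compact_op_sub _ [set 0]) => //; exact: compact_set1.
move=> a S T /compact_opP cS /compact_opP cT.
rewrite precompactE in cS; rewrite precompactE in cT.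
pose f (z : H * H) := a *: z.1 + z.2.
apply: (@compact_op_sub _ (f @` (closure (S @` [set x | rnorm x <= 1]) `*`
                                 closure (T @` [set x | rnorm x <= 1])))).
  apply: continuous_compact; last exact: compact_setX.
  apply: continuous_subspaceT => z; apply: cvgD.
    by apply: cvgZr; exact: cvg_fst.
  exact: cvg_snd.
move=> x x1; exists (S x, T x) => //; split => /=;
  by apply: subset_closure; exists x.
Qed.

HB.instance Definition _ := GRing.isSubmodClosed.Build R[i] bop compact_op
  compact_op_submod_closed.

Lemma compact_opMl S T : T \in compact_op -> S * T \in compact_op.
Proof.
move=> /compact_opP; rewrite precompactE => cT.
apply: (@compact_op_sub _ (S @` closure (T @` [set x | rnorm x <= 1]))).
  by apply: continuous_compact => //; apply/continuous_subspaceT/bop_continuous.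
by move=> x x1; exists (T x) => //; apply: subset_closure; exists x.
Qed.

Lemma compact_opMr S T : S \in compact_op -> S * T \in compact_op.
Proof.
move=> /compact_opP; rewrite precompactE => cS.
have [_ [M M0 TM]] := bopP T.
pose N := M + 1; have N0 : 0 < N by rewrite ltr_wpDl.
apply: (@compact_op_sub _
  ( *:%R N%:C @` closure (S @` [set x | rnorm x <= 1]))).
  apply: continuous_compact => //; apply/continuous_subspaceT.
  exact: scaler_continuous.
move=> x x1; exists (S (N^-1%:C *: T x)); last first.
  by rewrite linearZ /= scalerA -rmorphM /= mulfV ?scale1r// gt_eqF.
apply: subset_closure; exists (N^-1%:C *: T x) => //=.
rewrite rnormZr gtr0_norm ?invr_gt0// mulrC ler_pdivrMr// mul1r.
rewrite (le_trans (TM x))// (@le_trans _ _ M) ?lerDl// ler_piMr//.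
Qed.

Lemma compact_op_closed T :
  (forall e : R, 0 < e -> exists2 S, S \in compact_op & opnorm (T - S) <= e) ->
  T \in compact_op.
Proof.
move=> TS; apply/compact_opP; rewrite precompactE compact_ultra /= => G GU GT.
set B := [set x | rnorm x <= 1] in GT *.
suff Gcvg : cvg G.
  exists (lim G); split=> //; apply: (@closed_cvg _ _ G _ id _ _ GT) => //.
  exact: closed_closure.
apply: cauchy_cvg; apply: cauchy_exP => e e0.
have [r r0 re] : exists2 r : R, 0 < r & e = (r *+ 4)%:C.
  exists (complex.Re e / 4); move: e0; case: e => u v; rewrite ltcE /=.
    by move=> /andP[_ u0]; rewrite divr_gt0.
  move=> /andP[/eqP-> _]; suff -> : (u / 4) *+ 4 = u by [].
  by rewrite -mulr_natr divfK ?pnatr_eq0.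
have [S cS TSr] := TS r r0.
move: cS => /compact_opP; rewrite precompactE -/B => cS.
have /choice[xi xiP] : forall y, exists x, closure (T @` B) y ->
    B x /\ rnorm (y - T x) < r.
  move=> y.
  have [Ty|nTy] := pselect (closure (T @` B) y); last by exists 0.
  have rC0 : 0 < r%:C by rewrite ltcR.
  have [_ [[x Bx <-]]] := Ty _ (nbhsx_ballx y _ rC0).
  by rewrite -ball_normE /= rnormE ltcR => yr; exists x.
have FU : ProperFilter (S \o xi @ G) by exact: fmap_proper_filter.
have [|l [_ Gl]] := cS (S \o xi @ G).
  rewrite /fmap /=; apply: filterS GT => y /xiP[Bx _].
  by apply: subset_closure; exists (xi y).
exists l; set A := ball l e.
have [//|GA] := in_ultra_setVsetC A GU; exfalso.
have rC0 : 0 < r%:C by rewrite ltcR.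
have /Gl/(_ (nbhsx_ballx l _ rC0)) [z []] :
    (S \o xi @ G) ((S \o xi) @` (~` A `&` closure (T @` B))).
  rewrite /fmap /=; apply: filterS (filterI GA GT) => y yA /=.
  by exists y.
move=> [y [/= nAy Ty] <-]; rewrite -ball_normE /= rnormE ltcR => lS.
apply: nAy; rewrite /A -ball_normE /= rnormE re ltcR.
have [Bx yx] := xiP y Ty.
have -> : l - y = (l - S (xi y)) - (T - S) (xi y) - (y - T (xi y)).
  rewrite [(T - S) _]/(T (xi y) - S (xi y)).
  by rewrite !opprB !addrA !subrK.
rewrite (le_lt_trans (rnormD _ _))// rnormN.
rewrite (le_lt_trans (lerD (rnormD _ _) (lexx _)))// rnormN.
have h : rnorm ((T - S) (xi y)) <= r.
  rewrite (le_trans (opnormP _ _))// (@le_trans _ _ (opnorm (T - S))) //.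
  by rewrite ler_piMr ?opnorm_ge0.
lra.
Qed.
End BoundedOperators.

Definition calkin (R : realType) (H : hilbertType R) :=
  Quotient.quot (@compact_op R H).

Section Calkin.
Variables (R : realType) (H : hilbertType R).
Local Notation K := (@compact_op R H).
Local Notation calkin := (calkin H).

HB.instance Definition _ := ZmodQuotient.on calkin.
HB.instance Definition _ := Choice.on calkin.

Definition calkin_pi (T : bop H) : calkin := \pi_calkin%qT T.

Lemma calkin_piP (S T : bop H) : (calkin_pi S = calkin_pi T) <-> S - T \in K.
Proof. by rewrite Quotient.idealrBE; split => /eqP. Qed.

Lemma calkin_piD S T : calkin_pi (S + T) = calkin_pi S + calkin_pi T.
Proof. exact: raddfD. Qed.

Lemma calkin_reprK (c : calkin) : calkin_pi (repr c) = c.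
Proof. exact: reprK. Qed.

Lemma calkinP (c : calkin) : exists T, c = calkin_pi T.
Proof. by exists (repr c); rewrite calkin_reprK. Qed.

Definition calkin_one : calkin := calkin_pi 1.
Definition calkin_mul (c d : calkin) : calkin := calkin_pi (repr c * repr d).
Definition calkin_scale (a : R[i]) (c : calkin) : calkin :=
  calkin_pi (a *: repr c).

Lemma calkin_piM_subproof S T :
  calkin_pi (S * T) = calkin_mul (calkin_pi S) (calkin_pi T).
Proof.
rewrite /calkin_mul; apply/calkin_piP.
have /calkin_piP := calkin_reprK (calkin_pi S).
have /calkin_piP := calkin_reprK (calkin_pi T).
move: (repr (calkin_pi S)) (repr (calkin_pi T)) => S' T' kT kS.
have -> : S * T - S' * T' = - ((S' - S) * T + S' * (T' - T)).
  by rewrite mulrBl mulrBr [X in _ = - X]addrC addrA subrK opprB.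
by rewrite rpredN; apply: rpredD; [exact: compact_opMr|exact: compact_opMl].
Qed.

Lemma calkin_piZ_subproof a T :
  calkin_pi (a *: T) = calkin_scale a (calkin_pi T).
Proof.
rewrite /calkin_scale; apply/calkin_piP; rewrite -scalerBr; apply: rpredZ; rewrite -opprB rpredN.
exact/calkin_piP/calkin_reprK.
Qed.

Let piE := (calkin_piD, calkin_piM_subproof, calkin_piZ_subproof).

Lemma calkin_mulA : associative calkin_mul.
Proof.
move=> c d e; have [S ->] := calkinP c; have [T ->] := calkinP d.
by have [U ->] := calkinP e; rewrite -!piE mulrA.
Qed.
Lemma calkin_mul1 : left_id calkin_one calkin_mul.
Proof. by move=> c; have [S ->] := calkinP c; rewrite -!piE mul1r. Qed.
Lemma calkin_1mul : right_id calkin_one calkin_mul.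
Proof. by move=> c; have [S ->] := calkinP c; rewrite -!piE mulr1. Qed.
Lemma calkin_mulDl : left_distributive calkin_mul +%R.
Proof.
move=> c d e; have [S ->] := calkinP c; have [T ->] := calkinP d.
by have [U ->] := calkinP e; rewrite -!piE mulrDl.
Qed.
Lemma calkin_mulDr : right_distributive calkin_mul +%R.
Proof.
move=> c d e; have [S ->] := calkinP c; have [T ->] := calkinP d.
by have [U ->] := calkinP e; rewrite -!piE mulrDr.
Qed.

HB.instance Definition _ := GRing.Zmodule_isPzRing.Build calkin
  calkin_mulA calkin_mul1 calkin_1mul calkin_mulDl calkin_mulDr.

Lemma calkin_scaleA a b (c : calkin) :
  calkin_scale a (calkin_scale b c) = calkin_scale (a * b) c.
Proof. by have [S ->] := calkinP c; rewrite -!piE scalerA. Qed.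
Lemma calkin_scale1 : left_id 1 calkin_scale.
Proof. by move=> c; have [S ->] := calkinP c; rewrite -!piE scale1r. Qed.
Lemma calkin_scaleDr : right_distributive calkin_scale +%R.
Proof.
move=> a c d; have [S ->] := calkinP c; have [T ->] := calkinP d.
by rewrite -!piE scalerDr.
Qed.
Lemma calkin_scaleDl (c : calkin) : {morph calkin_scale^~ c : a b / a + b}.
Proof. by move=> a b; have [S ->] := calkinP c; rewrite -!piE scalerDl. Qed.

HB.instance Definition _ := GRing.Zmodule_isLmodule.Build R[i] calkin
  calkin_scaleA calkin_scale1 calkin_scaleDr calkin_scaleDl.

Lemma calkin_pi0 : calkin_pi 0 = 0. Proof. exact: raddf0. Qed.
Lemma calkin_pi1 : calkin_pi 1 = 1. Proof. by []. Qed.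
Lemma calkin_piN T : calkin_pi (- T) = - calkin_pi T.
Proof. exact: raddfN. Qed.
Lemma calkin_piM S T : calkin_pi (S * T) = calkin_pi S * calkin_pi T.
Proof. exact: calkin_piM_subproof. Qed.
Lemma calkin_piZ a T : calkin_pi (a *: T) = a *: calkin_pi T.
Proof. exact: calkin_piZ_subproof. Qed.

Lemma calkin_ZAl (a : R[i]) (c d : calkin) : a *: (c * d) = (a *: c) * d.
Proof.
have [S ->] := calkinP c; have [T ->] := calkinP d.
by rewrite -calkin_piM -!calkin_piZ bopZAl calkin_piM.
Qed.
Lemma calkin_ZAr (a : R[i]) (c d : calkin) : a *: (c * d) = c * (a *: d).
Proof.
have [S ->] := calkinP c; have [T ->] := calkinP d.
by rewrite -calkin_piM -!calkin_piZ bopZAr calkin_piM.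
Qed.

Definition quotient_norm (c : calkin) : R :=
  inf [set opnorm T | T in [set T | calkin_pi T = c]].

Lemma quotient_norm_has_inf (c : calkin) :
  has_inf [set opnorm T | T in [set T | calkin_pi T = c]].
Proof.
split; last by exists 0 => _ [T _ <-]; exact: opnorm_ge0.
by exists (opnorm (repr c)); exists (repr c); rewrite //= calkin_reprK.
Qed.

Lemma quotient_norm_le T : quotient_norm (calkin_pi T) <= opnorm T.
Proof.
by apply: (ge_inf (quotient_norm_has_inf _).2); exists T.
Qed.

Lemma quotient_norm_adherent (c : calkin) (e : R) : 0 < e ->
  exists2 T, calkin_pi T = c & opnorm T < quotient_norm c + e.
Proof.
move=> e0; have [_ [T /= Tc <-]] := inf_adherent e0 (quotient_norm_has_inf c).
by exists T.
Qed.

Lemma quotient_norm_ge0 (c : calkin) : 0 <= quotient_norm c.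
Proof.
apply: lb_le_inf; first by case: (quotient_norm_has_inf c).
by move=> _ [T _ <-]; exact: opnorm_ge0.
Qed.

Lemma quotient_normD (c d : calkin) :
  quotient_norm (c + d) <= quotient_norm c + quotient_norm d.
Proof.
apply/ler_addgt0Pr => e e0; have e20 : 0 < e / 2 by rewrite divr_gt0.
have [S Sc Se] := quotient_norm_adherent c e20.
have [T Td Te] := quotient_norm_adherent d e20.
rewrite -{1}Sc -{1}Td -calkin_piD (le_trans (quotient_norm_le _))//.
rewrite (le_trans (opnormD _ _))// (splitr e) addrACA.
by rewrite lerD// ltW.
Qed.

Lemma quotient_normZ_le (a : R[i]) (c : calkin) :
  quotient_norm (a *: c) <= complex.Re `|a| * quotient_norm c.
Proof.
have a0 : 0 <= complex.Re `|a| by exact: (rnorm_ge0 (a : R[i]^o)).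
apply/ler_addgt0Pr => e e0; pose m := complex.Re `|a| + 1.
have m0 : 0 < m by rewrite ltr_wpDl.
have em0 : 0 < e / m by rewrite divr_gt0.
have [T Tc Te] := quotient_norm_adherent c em0.
rewrite -{1}Tc -calkin_piZ (le_trans (quotient_norm_le _))//.
rewrite (le_trans (opnormZ_le _ _))//.
rewrite (@le_trans _ _ (complex.Re `|a| * (quotient_norm c + e / m)))//.
  by rewrite ler_wpM2l// ltW.
rewrite mulrDr lerD2l mulrCA ger_pMr// ler_pdivrMr// mul1r.
by rewrite lerDl.
Qed.

Lemma quotient_norm0 : quotient_norm 0 = 0.
Proof.
apply/eqP; rewrite eq_le quotient_norm_ge0 andbT -calkin_pi0.
by rewrite (le_trans (quotient_norm_le _))// opnorm0.
Qed.

Definition calkin_norm (c : calkin) : R[i] := (quotient_norm c)%:C.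

Lemma calkin_normD (c d : calkin) :
  calkin_norm (c + d) <= calkin_norm c + calkin_norm d.
Proof. by rewrite -rmorphD /= lecR quotient_normD. Qed.

Lemma calkin_normZ (a : R[i]) (c : calkin) :
  calkin_norm (a *: c) = `|a| * calkin_norm c.
Proof.
rewrite (rnormE (a : R[i]^o)) -rmorphM; congr (_%:C).
apply/eqP; rewrite eq_le quotient_normZ_le andTb.
have [->|a0] := eqVneq a 0.
  by rewrite scale0r quotient_norm0 rnorm0 mul0r.
rewrite -{1}[c](scalerK a0).
have na0 : 0 < complex.Re `|a|.
  rewrite lt_def (rnorm_ge0 (a : R[i]^o)) andbT; apply: contra a0 => /eqP.
  by move=> /(@rnorm_eq0 _ (R[i]^o)) ->.
rewrite mulrC -ler_pdivlMr//.
apply: le_trans (quotient_normZ_le _ _) _.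
rewrite normfV (rnormE (a : R[i]^o)) -fmorphV /= mulrC.
by rewrite /rnorm.
Qed.

Lemma calkin_norm_eq0 (c : calkin) : calkin_norm c = 0 -> c = 0.
Proof.
move=> [] c0; have [T cT] := calkinP c.
rewrite cT -calkin_pi0; apply/calkin_piP; rewrite subr0.
apply: compact_op_closed => e e0.
have [S Sc] := quotient_norm_adherent c e0; rewrite c0 add0r => /ltW Se.
exists (T - S); last by rewrite opprB addrCA subrr addr0.
by apply/calkin_piP; rewrite -cT Sc.
Qed.

HB.instance Definition _ := @Lmodule_isNormed.Build R[i] calkin calkin_norm
  calkin_normD calkin_normZ calkin_norm_eq0.

Lemma calkin_normE (c : calkin) : `|c| = (quotient_norm c)%:C.
Proof. by []. Qed.

(* The adjoint exists and is unique by the Riesz representation theorem. *)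
Definition adjoint (T : bop H) : bop H :=
  xget (0 : bop H) [set S : bop H | forall x y, hdot (T x) y = hdot x (S y)].

(* Independent of the representative, the adjoint of a compact operator being
   compact. *)
Definition star (c : calkin) : calkin := calkin_pi (adjoint (repr c)).

Definition projections : set calkin := [set p | star p = p /\ p * p = p].

Definition trivial_annihilator (c : calkin) := forall x, c * x = 0 -> x = 0.

Definition calkin_exp (z : calkin) : calkin :=
  lim (series (fun n => n`!%:R^-1 *: z ^+ n) @ \oo).

Definition geodesic_from (p : calkin) (delta : R -> calkin) :=
  exists z : calkin,
    [/\ star z = - z, p * z * p = 0, (1 - p) * z * (1 - p) = 0 &
      forall t : R, delta t =
        calkin_exp (t%:C *: z) * p * calkin_exp (- (t%:C *: z))].

Definition geodesic_joining (p q : calkin) (delta : R -> calkin) :=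
  [/\ geodesic_from p delta, delta 0 = p & delta 1 = q].

(* Difference quotients of a curve, with real parameter, in the complex normed
   space calkin H. *)
Definition diff_quotient (gamma : R -> calkin) (t s : R) : calkin :=
  (s - t)^-1%:C *: (gamma s - gamma t).

Definition velocity (gamma : R -> calkin) (t : R) : calkin :=
  lim (diff_quotient gamma t @ t^').

(* gamma is C^oo on [a, b], with one-sided derivatives at a and b; g n is the
   n-th derivative. *)
Definition smooth_on (a b : R) (gamma : R -> calkin) :=
  exists g : nat -> R -> calkin,
    (forall t, t \in `[a, b] -> g 0%N t = gamma t) /\
    (forall n t, t \in `[a, b] ->
      diff_quotient (g n) t @ within [set` `[a, b]] t^' --> g n.+1 t).

Definition piecewise_smooth (a b : R) (gamma : R -> calkin) :=
  exists (n : nat) (s : nat -> R), [/\ s 0%N = a, s n = b &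
    forall i, (i < n)%N -> s i < s i.+1 /\ smooth_on (s i) (s i.+1) gamma].

(* The velocity is defined away from the finitely many breakpoints, which are
   negligible for the integral. *)
Definition curve_length (a b : R) (gamma : R -> calkin) : \bar R :=
  (\int[lebesgue_measure]_(t in `[a, b]) (rnorm (velocity gamma t))%:E)%E.

Definition minimal_geodesic (p q : calkin) (delta : R -> calkin) :=
  geodesic_joining p q delta /\
  forall (a b : R) (gamma : R -> calkin), a < b ->
    piecewise_smooth a b gamma ->
    (forall t, t \in `[a, b] -> gamma t \in projections) ->
    gamma a = p -> gamma b = q ->
    (curve_length 0 1 delta <= curve_length a b gamma)%E.
End Calkin.

Arguments projections {R} H.

(* Main.v *)
(* Put d = p - q and c = p + q - 1, so that c^2 + d^2 = 1 and cd = -dc.  For a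
   selfadjoint element c of the Calkin algebra that is not bounded below there is
   an orthonormal sequence on which a lift of c tends rapidly to 0; the projection
   onto its span is then annihilated by c modulo compact operators.  Hence the
   hypothesis on c forces |d| < 1.

   Existence: y = c d (1 - d^2)^(-1/2) satisfies y^* = - y and y^2 = - d^2, and
   z = arcsinh y, given by its power series, satisfies e^z p = q e^z.  As the
   series of arcsin has nonnegative coefficients, |z| <= arcsin |d| < pi / 2.

   Minimality: a state of the Calkin algebra attaining the norm of p - q turns a
   curve gamma of projections into the curve 2 gamma - 1 on the unit sphere of the
   GNS space, whose endpoints enclose the angle 2 arcsin |d|; hence the length of
   gamma is at least arcsin |d| >= |z|.

   Uniqueness: if w generates another minimal geodesic, then |w| <= |z| and
   e^(2w) = (2q - 1)(2p - 1) = e^(2z).  Being a limit of polynomials in e^(2w) and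
   e^(-2w), z commutes with w, so that e^(2w - 2z) = 1 with |2w - 2z| < 2 pi. *)

Require Import Defs.
From mathcomp Require Import all_boot all_order all_algebra.
From mathcomp Require Import generic_quotient ring_quotient sesquilinear complex.
From mathcomp Require Import all_classical all_reals all_analysis.
From mathcomp Require Import measurable_realfun.
From mathcomp Require Import ring lra.

Set Implicit Arguments.
Unset Strict Implicit.
Unset Printing Implicit Defensive.

Import Order.TTheory GRing.Theory Num.Theory Num.Def.
Import numFieldNormedType.Exports.

Local Open Scope classical_set_scope.
Local Open Scope ring_scope.
Local Open Scope complex_scope.

(** * Real-valued norms and inner products *)

(** Norm questions are answered by scalarization: for each class [c] of positive norm, [gns_exists]
    gives a form [B] with B c c = |c|^2. It yields the C*-identity, shows that a curve with zero
    derivative is constant, and turns lengths into angles. The form is an ultralimit of vector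
    states along an orthonormal sequence on which a lift of [c] nearly attains its quotient norm.
    Being built from actual vectors, it also carries the hypothesis: B c c = 0 says that a lift of
    [c] tends to 0 along them.

    The computations use the symmetries e = 2p - 1 and f = 2q - 1. Codiagonal elements are those
    that anticommute with e, and 2c = e + f, 2d = e - f. This explains the formula for y. As f c = c
    e, the symmetry s = c (c^2)^(-1/2) exchanges e and f, and so does the unitary s e, which takes e
    to f. From e = c + d one gets s e = (c^2)^(1/2) + s d, whose skew part is s d = y; this unitary
    is e^z. No functional calculus is involved: (1 - d^2)^(-1/2) is an even power series at i d, and
    |d| < 1 makes it converge. *)

Section RealNormTopology.
Variables (R : realType) (V : normedModType R[i]).

Lemma rnormB (x y : V) : rnorm (x - y) = rnorm (y - x).
Proof. by rewrite -rnormN opprB. Qed.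

Lemma rnorm_triangle (x y z : V) : rnorm (x - z) <= rnorm (x - y) + rnorm (y - z).
Proof. by rewrite (le_trans _ (rnormD _ _))// addrA subrK. Qed.

Lemma rnorm_sum I (r : seq I) (P : pred I) (F : I -> V) :
  rnorm (\sum_(i <- r | P i) F i) <= \sum_(i <- r | P i) rnorm (F i).
Proof.
elim/big_ind2: _ => [|x a y b xa yb|//]; first by rewrite rnorm0.
exact: le_trans (rnormD _ _) (lerD xa yb).
Qed.

(** A positive element of [R[i]] is a positive real, so real tolerances suffice to test
    convergence. *)
Lemma cvg_rnormP T (F : set_system T) {FF : Filter F} (f : T -> V) (l : V) :
  f @ F --> l <-> forall e : R, 0 < e -> \forall x \near F, rnorm (f x - l) <= e.
Proof.
split.
  move=> /cvgrPdist_le fl e e0; have := fl e%:C; rewrite ltcR => /(_ e0).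
  by apply: filterS => x; rewrite rnormE lecR rnormB.
move=> fl; apply/cvgrPdist_le => -[u v]; rewrite ltcE /= => /andP[/eqP -> u0].
by apply: filterS (fl u u0) => x; rewrite rnormE lecR rnormB.
Qed.

Lemma rnorm_cvg T (F : set_system T) {FF : Filter F} (f : T -> V) (l : V) :
  f @ F --> l -> rnorm (f x) @[x --> F] --> rnorm l.
Proof.
move=> /cvg_rnormP fl; apply/cvgrPdist_le => e /fl; apply: filterS => x fx.
have h1 := rnormD (f x - l) l; have h2 := rnormD (l - f x) (f x).
rewrite !subrK (rnormB l) in h1 h2.
by rewrite ler_norml; apply/andP; split; lra.
Qed.

Lemma cvg_rnorm_le T (F : set_system T) {FF : ProperFilter F} (f : T -> V) (l : V) (M : R) :
  f @ F --> l -> (\forall x \near F, rnorm (f x) <= M) -> rnorm l <= M.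
Proof.
move=> fl fM; have fr : rnorm (f x) @[x --> F] --> rnorm l by exact: rnorm_cvg.
rewrite -(cvg_lim (@norm_hausdorff _ R^o) fr); apply: limr_le => //.
exact: cvgP fr.
Qed.

End RealNormTopology.

Section CompleteSequences.
Variables (R : realType) (V : completeNormedModType R[i]).

Lemma cauchy_rnorm_cvg (x : nat -> V) :
  (forall e : R, 0 < e -> exists N, forall n, (N <= n)%N -> rnorm (x n - x N) <= e) ->
  exists l : V, x @ \oo --> l.
Proof.
move=> xC; exists (lim (x @ \oo)); apply: cauchy_cvg; apply: cauchy_exP => -[u v].
rewrite ltcE /= => /andP[/eqP-> u0].
have [|N xN] := xC (u / 2); first by rewrite divr_gt0.
exists (x N); exists N => // n /= /xN h.
rewrite -ball_normE /= rnormE ltcR rnormB; apply: le_lt_trans h _; lra.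
Qed.

End CompleteSequences.

Section HilbertSpace.
Variables (R : realType) (H : hilbertType R).
Implicit Types (x y z : H) (a : R[i]) (t : R).

(** The real inner product underlying [hdot]. By [rdot_hdot] it determines [hdot], so estimates can
    stay in the ordered field [R]. *)
Definition rdot x y : R := complex.Re (hdot x y).

Lemma hdotDl x y z : hdot (x + y) z = hdot x z + hdot y z.
Proof. exact: linearDl. Qed.
Lemma hdotDr x y z : hdot x (y + z) = hdot x y + hdot x z.
Proof. exact: linearDr. Qed.
Lemma hdotZl a x y : hdot (a *: x) y = a * hdot x y.
Proof. exact: linearZl_LR. Qed.
Lemma hdotZr a x y : hdot x (a *: y) = a^* * hdot x y.
Proof. exact: linearZr_LR. Qed.
Lemma hdotC x y : hdot x y = (hdot y x)^*.
Proof. by rewrite hermC expr0 mul1r. Qed.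
Lemma hdotNl x y : hdot (- x) y = - hdot x y.
Proof. exact: linearNl. Qed.
Lemma hdotNr x y : hdot x (- y) = - hdot x y.
Proof. exact: linearNr. Qed.

Lemma hdot_eq x y : (forall z, hdot z x = hdot z y) -> x = y.
Proof.
move=> xy; apply/eqP; rewrite -subr_eq0 -(dnorm_eq0 hdot).
by rewrite hdotDr hdotNr xy subrr.
Qed.

Lemma rdotC x y : rdot x y = rdot y x.
Proof. by rewrite /rdot hdotC; case: (hdot y x). Qed.
Lemma rdotDl x y z : rdot (x + y) z = rdot x z + rdot y z.
Proof. by rewrite /rdot hdotDl raddfD. Qed.
Lemma rdotNl x y : rdot (- x) y = - rdot x y.
Proof. by rewrite /rdot hdotNl raddfN. Qed.
Lemma rdotZl t x y : rdot (t%:C *: x) y = t * rdot x y.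
Proof. by rewrite /rdot hdotZl; case: (hdot x y) => u v /=; rewrite mul0r subr0. Qed.
Lemma rdotDr x y z : rdot x (y + z) = rdot x y + rdot x z.
Proof. by rewrite !(rdotC x) rdotDl. Qed.
Lemma rdotNr x y : rdot x (- y) = - rdot x y.
Proof. by rewrite !(rdotC x) rdotNl. Qed.
Lemma rdotZr t x y : rdot x (t%:C *: y) = t * rdot x y.
Proof. by rewrite !(rdotC x) rdotZl. Qed.
Lemma rdotxx x : rdot x x = rnorm x ^+ 2.
Proof. by rewrite /rdot -hdot_norm rnormE -rmorphXn. Qed.
Lemma rdot_hdot x y : hdot x y = rdot x y +i* - rdot ((0 +i* 1) *: x) y.
Proof.
rewrite /rdot hdotZl; case: (hdot x y) => u v /=.
by rewrite mul0r mul1r sub0r opprK.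
Qed.

(** Expand the square norm of |y| x - |x| y, which is nonnegative. *)
Lemma rdot_le x y : rdot x y <= rnorm x * rnorm y.
Proof.
have [->|x0] := eqVneq x 0; first by rewrite rnorm0 mul0r /rdot linear0l.
have [->|y0] := eqVneq y 0; first by rewrite rnorm0 mulr0 /rdot linear0r.
have pos z : z != 0 -> 0 < rnorm z.
  by move=> z0; rewrite lt_def rnorm_ge0 andbT; apply: contra z0 => /eqP/rnorm_eq0->.
have := sqr_ge0 (rnorm ((rnorm y)%:C *: x - (rnorm x)%:C *: y)).
have := pos _ x0; have := pos _ y0.
have -> : rnorm ((rnorm y)%:C *: x - (rnorm x)%:C *: y) ^+ 2 =
    rnorm x * rnorm y * (2 * (rnorm x * rnorm y - rdot x y)).
  rewrite -rdotxx !(rdotDl, rdotDr, rdotNl, rdotNr, rdotZl, rdotZr) !rdotxx (rdotC y x).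
  ring.
move=> b0 a0.
by rewrite pmulr_rge0 ?mulr_gt0// pmulr_rge0// subr_ge0.
Qed.

Lemma rdot_norm_le x y : `|rdot x y| <= rnorm x * rnorm y.
Proof. by rewrite ler_norml lerNl -rdotNl -{1}(rnormN x) !rdot_le. Qed.

Lemma parallelogram x y :
  rnorm (x - y) ^+ 2 = 2 * rnorm x ^+ 2 + 2 * rnorm y ^+ 2 - rnorm (x + y) ^+ 2.
Proof.
rewrite -!rdotxx !(rdotDl, rdotDr, rdotNl, rdotNr); ring.
Qed.

End HilbertSpace.

(** * Adjoints and compact operators *)

Lemma null_sequence (R : realType) : exists2 ep : nat -> R, forall n, 0 < ep n &
  forall e, 0 < e -> exists N : nat, forall n, (N <= n)%N -> ep n <= e.
Proof.
exists (fun n => n.+1%:R^-1) => [n|e e0]; first by rewrite invr_gt0.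
have [N _ NP] := near_infty_natSinv_lt (PosNum e0).
by exists N => n /NP /ltW.
Qed.

Lemma fmap_ultra (I J : Type) (f : I -> J) (U : set_system I) :
  UltraFilter U -> UltraFilter (f @ U).
Proof.
move=> UU; split; first exact: fmap_proper_filter.
move=> G GF UG; apply/seteqP; split=> A; last exact: UG.
have [//|UA] := in_ultra_setVsetC (f @^-1` A) UU.
move=> GA; have GnA : G (~` A) by apply: UG.
by case: (@filter_not_empty _ G _); rewrite -(setICr A); apply: filterI.
Qed.

Lemma real_ultra_cvg (R : realType) (I : Type) (U : set_system I) (f : I -> R) (M : R) :
  UltraFilter U -> (forall i, `|f i| <= M) -> exists l : R, f @ U --> l.
Proof.
move=> UU fM; have := @segment_compact R (- M) M.
rewrite compact_ultra => /(_ _ (fmap_ultra f UU)) [|l [_ fl]]; last by exists l.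
by apply: (@filterE _ U) => i /=; rewrite in_itv /= -ler_norml.
Qed.

Section Riesz.
Variables (R : realType) (H : hilbertType R).

(* The representing vector is the limit of a minimizing sequence of
   |x|^2 - 2 f x, which is Cauchy by the parallelogram law. *)
Lemma riesz (f : H -> R) (M : R) : 0 <= M ->
  (forall x y, f (x + y) = f x + f y) ->
  (forall (t : R) x, f (t%:C *: x) = t * f x) ->
  (forall x, `|f x| <= M * rnorm x) ->
  exists y, forall x, f x = rdot x y.
Proof.
move=> M0 fD fZ fM.
have [ep ep0 epP] := null_sequence R.
pose J x := rnorm x ^+ 2 - 2 * f x.
have JM x : - M ^+ 2 <= J x.
  have := fM x; rewrite ler_norml => /andP[_ h].
  have := sqr_ge0 (rnorm x - M); rewrite /J; nra.
have Jinf : has_inf (range J).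
  by split; [exists (J 0); exists 0 | exists (- M ^+ 2) => _ [x _ <-]].
set m := inf (range J).
have Jm x : m <= J x by apply: ge_inf; [case: Jinf | exists x].
have /choice[x xP] n : exists x, J x < m + ep n.
  by have [_ [x _ <-] h] := inf_adherent (ep0 n) Jinf; exists x.
have xC n k : rnorm (x n - x k) ^+ 2 <= 2 * ep n + 2 * ep k.
  rewrite parallelogram.
  have hJ := Jm (2^-1%:C *: (x n + x k)).
  have hn : J (x n) <= m + ep n := ltW (xP n).
  have hk : J (x k) <= m + ep k := ltW (xP k).
  move: hJ hn hk.
  rewrite /J rnormZr fZ fD. rewrite  [`|2^-1|]ger0_norm// exprMn; lra.
have [|y xy] := @cauchy_rnorm_cvg R H x.
  move=> e e0; have [N NP] := epP (e ^+ 2 / 4) ltac:(nra).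
  exists N => n Nn; rewrite -(@ler_pXn2r _ 2)// ?nnegrE ?rnorm_ge0//; last exact: ltW.
  apply: le_trans (xC _ _) _; have := NP _ Nn; have := NP _ (leqnn N); lra.
exists y => z.
(* First variation: [m] bounds [J (x n + t z)] from below for every [t]; the optimal [t] bounds the
   defect of the representation by the minimization error [ep n]. *)
have step n : (rdot z (x n) - f z) ^+ 2 <= rnorm z ^+ 2 * ep n.
  have key t : 0 <= 2 * t * (rdot z (x n) - f z) + t ^+ 2 * rnorm z ^+ 2 + ep n.
    have := Jm (x n + t%:C *: z); have := xP n.
    rewrite /J -!rdotxx !(rdotDl, rdotDr, rdotZl, rdotZr) fD fZ (rdotC z) !rdotxx.
    nra.
  have [z0|z0] := eqVneq (rnorm z) 0.
    have -> : z = 0 by exact: rnorm_eq0.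
    have f0 : f 0 = 0 by have := fD 0 0; rewrite addr0; lra.
    by rewrite rnorm0 f0 /rdot linear0l subr0 !expr0n mul0r.
  have z2 : 0 < rnorm z ^+ 2 by rewrite exprn_gt0// lt_def z0 rnorm_ge0.
  have := key (- (rdot z (x n) - f z) / rnorm z ^+ 2).
  set r := rdot z (x n) - f z; set a := rnorm z ^+ 2 in z2 *.
  have -> : 2 * (- r / a) * r + (- r / a) ^+ 2 * a + ep n =
     ep n - r ^+ 2 / a by field; rewrite gt_eqF.
  by rewrite subr_ge0 ler_pdivrMr// mulrC.
apply/eqP; rewrite -subr_eq0 -normr_eq0 eq_le normr_ge0 andbT.
apply/ler_addgt0Pr => e e0; rewrite add0r.
have [K K0 zK] : exists2 K, 0 < K & rnorm z <= K.
  by exists (rnorm z + 1); [rewrite ltr_wpDl ?rnorm_ge0|rewrite lerDl].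
have [N NP] := epP ((e / (2 * K)) ^+ 2) ltac:(by rewrite exprn_gt0// divr_gt0// mulr_gt0).
have eK : 0 < e / (2 * K) by rewrite divr_gt0// mulr_gt0.
have [N' _ N'P] := (iffLR (cvg_rnormP _ _) xy) _ eK.
set n := maxn N N'.
have h1 : `|rdot z (x n) - f z| <= e / 2.
  rewrite -(@ler_pXn2r _ 2) ?nnegrE//; last by lra.
  rewrite real_normK ?num_real// (le_trans (step n))//.
  have -> : (e / 2) ^+ 2 = K ^+ 2 * (e / (2 * K)) ^+ 2 by field; rewrite gt_eqF.
  apply: ler_pM => //.
  - exact: sqr_ge0.
  - exact: ltW.
  - by rewrite ler_pXn2r// nnegrE ?rnorm_ge0// ltW.
  - by apply: NP; rewrite leq_maxl.
have h2 : `|rdot z (x n) - rdot z y| <= e / 2.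
  rewrite -rdotNr -rdotDr (le_trans (rdot_norm_le _ _))//.
  have -> : e / 2 = K * (e / (2 * K)) by field; rewrite gt_eqF.
  by rewrite ler_pM ?rnorm_ge0//; apply: N'P; rewrite /= leq_maxr.
rewrite (_ : f z - _ = (rdot z (x n) - rdot z y) - (rdot z (x n) - f z)); last by ring.
by rewrite (le_trans (ler_normB _ _))//; lra.
Qed.

End Riesz.

Section Adjoint.
Variables (R : realType) (H : hilbertType R).
Implicit Types (S T : bop H).

(** Riesz is applied to the real functional [rdot (T x) y]. Since Im <x, y> = - Re <ix, y> and [T]
    commutes with i, the identity extends to [hdot]. The bound on [S] comes from |S y|^2 = Re <T S
    y, y>. *)
Lemma adjoint_exists T : exists S : bop H, forall x y, hdot (T x) y = hdot x (S y).
Proof.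
have [_ [M M0 TM]] := bopP T.
have /choice[S SP] y : exists z, forall x, rdot (T x) y = rdot x z.
  apply: (@riesz _ _ _ (M * rnorm y)); first by rewrite mulr_ge0 ?rnorm_ge0.
  - by move=> x x'; rewrite linearD rdotDl.
  - by move=> t x; rewrite linearZ rdotZl.
  - move=> x; rewrite (le_trans (rdot_norm_le _ _))// mulrAC ler_wpM2r ?rnorm_ge0//.
have SE x y : hdot (T x) y = hdot x (S y).
  by rewrite !rdot_hdot -linearZ !SP.
have Slin : linear S.
  move=> a y z; apply: hdot_eq => x.
  by rewrite -SE !(hdotDr, hdotZr) !SE.
have SM y : rnorm (S y) <= M * rnorm y.
  have [->|Sy0] := eqVneq (rnorm (S y)) 0; first by rewrite mulr_ge0 ?rnorm_ge0.
  have Sy : 0 < rnorm (S y) by rewrite lt_def Sy0 rnorm_ge0.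
  rewrite -(ler_pM2l Sy) -expr2 -rdotxx -SP (le_trans (rdot_le _ _))//.
  by rewrite mulrA ler_wpM2r ?rnorm_ge0// mulrC.
have Sb : S \in @bounded_op R H by apply/bounded_opP; split => //; exists M.
by exists (Bop Sb).
Qed.

Lemma adjointP T x y : hdot (T x) y = hdot x (adjoint T y).
Proof.
rewrite /adjoint; case: xgetP => [S _ ->//|].
by have [S SP] := adjoint_exists T => /(_ S)/(_ SP).
Qed.

Lemma rdot_adjoint T x y : rdot (T x) y = rdot x (adjoint T y).
Proof. by rewrite /rdot adjointP. Qed.

Lemma adjoint_unique T S :
  (forall x y, hdot (T x) y = hdot x (S y)) -> adjoint T = S.
Proof.
by move=> TS; apply: bopE => y; apply: hdot_eq => x; rewrite -adjointP TS.
Qed.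

Lemma adjointD S T : adjoint (S + T) = adjoint S + adjoint T.
Proof.
apply: adjoint_unique => x y.
change (hdot (S x + T x) y = hdot x (adjoint S y + adjoint T y)).
by rewrite hdotDl hdotDr !adjointP.
Qed.

Lemma adjointZ (a : R[i]) T : adjoint (a *: T) = a^* *: adjoint T.
Proof.
apply: adjoint_unique => x y.
change (hdot (a *: T x) y = hdot x (a^* *: adjoint T y)).
by rewrite hdotZl hdotZr adjointP conjCK.
Qed.

Lemma adjointM S T : adjoint (S * T) = adjoint T * adjoint S.
Proof.
apply: adjoint_unique => x y.
change (hdot (S (T x)) y = hdot x (adjoint T (adjoint S y))).
by rewrite !adjointP.
Qed.

Lemma adjointK T : adjoint (adjoint T) = T.
Proof. by apply: adjoint_unique => x y; rewrite hdotC -adjointP -hdotC. Qed.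

Lemma adjoint1 : adjoint (1 : bop H) = 1.
Proof. exact: adjoint_unique. Qed.

End Adjoint.

Section CompactOperators.
Variables (R : realType) (H : hilbertType R).
Implicit Types (S T : bop H).
Local Notation K := (@compact_op R H).
Local Notation B := [set x : H | rnorm x <= 1].

Lemma compact_ultra_cvg T (I : Type) (U : set_system I) (x : I -> H) (M : R) :
  UltraFilter U -> T \in K -> (forall i, rnorm (x i) <= M) ->
  exists l : H, T (x i) @[i --> U] --> l.
Proof.
move=> UU /compact_opP; rewrite precompactE compact_ultra /= => cT xM.
pose N := `|M| + 1; have N0 : 0 < N by rewrite ltr_wpDl.
have FU : UltraFilter (T (N^-1%:C *: x i) @[i --> U]) by exact: fmap_ultra.
have [|l [_ Ul]] := cT _ FU.
  apply: (@filterE _ U) => i /=; apply: subset_closure; exists (N^-1%:C *: x i) => //=.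
  rewrite rnormZr gtr0_norm ?invr_gt0// mulrC ler_pdivrMr// mul1r.
  by rewrite (le_trans (xM i))// (le_trans (ler_norm _))// lerDl.
exists (N%:C *: l).
have -> : (fun i => T (x i)) = (fun i => N%:C *: T (N^-1%:C *: x i)).
  by apply/funext => i; rewrite linearZ /= scalerA -rmorphM /= mulfV ?scale1r// gt_eqF.
exact: cvgZr.
Qed.

(** An ultrafilter on the closure of the image need not come from one on the ball. For each radius
    [r], points are pulled back to preimages of [r]-approximations; the limit along the pulled-back
    ultrafilter is a centre of a small ball, which gives the Cauchy property. *)
Lemma compact_opI T :
  (forall U : set_system H, UltraFilter U -> U B -> exists l : H, T @ U --> l) ->
  T \in K.
Proof.
move=> TU; apply/compact_opP; rewrite precompactE compact_ultra /= => G GU GT.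
suff [l Gl] : exists l : H, G --> l.
  exists l; split=> //; apply: (@closed_cvg _ _ G _ id _ _ GT) => //.
  exact: closed_closure.
exists (lim G); apply: cauchy_cvg; apply: cauchy_exP => -[u v].
rewrite ltcE /= => /andP[/eqP-> u0].
pose r := u / 3; have r0 : 0 < r by rewrite divr_gt0.
have /choice[xi xiP] : forall y, exists x, closure (T @` B) y ->
    B x /\ rnorm (y - T x) < r.
  move=> y; have [Ty|nTy] := pselect (closure (T @` B) y); last by exists 0.
  have rC0 : 0 < r%:C by rewrite ltcR.
  have [_ [[x Bx <-]]] := Ty _ (nbhsx_ballx y _ rC0).
  by rewrite -ball_normE /= rnormE ltcR => yr; exists x.
have FU : UltraFilter (xi @ G) by exact: fmap_ultra.
have [|l Gl] := TU _ FU; first by apply: (@filterS _ G _ _ _ _ GT) => y /xiP[].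
exists l; have GA : \forall y \near G, rnorm (T (xi y) - l) <= r.
  exact: (iffLR (cvg_rnormP (F := xi @ G) T l) Gl r r0).
apply: filterS (filterI GA GT) => y [/= yl /xiP[_ yx]].
rewrite -ball_normE /= rnormE ltcR rnormB.
by have := rnorm_triangle y (T (xi y)) l; rewrite /r in yl yx *; lra.
Qed.

(* Along an ultrafilter, |T^* y - T^* z|^2 = <T T^* (y - z), y - z>, and T T^* is
   compact. *)
Lemma adjoint_compact T : T \in K -> adjoint T \in K.
Proof.
move=> cT; apply: compact_opI => U UU UB.
pose S := T * adjoint T; have cS : S \in K by exact: compact_opMr.
(* Truncation to the unit ball: [compact_ultra_cvg] wants a bound at every index, whereas [U] only
   concentrates on the ball. *)
pose x i : H := if rnorm i <= 1 then i else 0.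
have xB i : rnorm (x i) <= 1 by rewrite /x; case: ifP => //; rewrite rnorm0.
have [l Sl] := compact_ultra_cvg UU cS xB.
exists (lim (adjoint T @ U)); apply: cauchy_cvg; apply: cauchy_exP => -[u v].
rewrite ltcE /= => /andP[/eqP-> u0].
have e0 : 0 < (u / 2) ^+ 2 / 4 by rewrite divr_gt0// exprn_gt0// divr_gt0.
have Ue : \forall y \near U, rnorm (S (x y) - l) <= (u / 2) ^+ 2 / 4.
  exact: (iffLR (cvg_rnormP _ _) Sl _ e0).
have [y [/= yB yl]] := @filter_ex _ U _ _ (filterI UB Ue).
exists (adjoint T y); apply: filterS (filterI UB Ue) => z [/= zB zl].
rewrite -ball_normE /= rnormE ltcR.
move: yl zl; rewrite /x yB zB => yl zl.
apply: (@le_lt_trans _ _ (u / 2)); last by lra.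
rewrite -(@ler_pXn2r _ 2) ?nnegrE ?rnorm_ge0//; last by lra.
rewrite -raddfB -rdotxx -rdot_adjoint rdotC.
have h1 : rnorm (y - z) <= 2 by rewrite (le_trans (rnormD _ _))// rnormN; lra.
have h2 : rnorm (S (y - z)) <= (u / 2) ^+ 2 / 2.
  rewrite raddfB (le_trans (rnorm_triangle _ l _))// (rnormB l); lra.
have := rdot_le (y - z) (S (y - z)).
have := rnorm_ge0 (y - z); have := rnorm_ge0 (S (y - z)).
change (T (adjoint T (y - z))) with (S (y - z)); nra.
Qed.

End CompactOperators.

(** * Orthonormal sequences *)

Section RealScalars.
Variables (R : realType) (V : normedModType R[i]).

Lemma cvg_realZ T (F : set_system T) {FF : Filter F} (f : T -> R) (t : R) (y : V) :
  f @ F --> t -> (f x)%:C *: y @[x --> F] --> t%:C *: y.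
Proof.
move=> /cvgrPdist_le ft; apply/cvg_rnormP => e e0.
have y1 : 0 < rnorm y + 1 by rewrite ltr_wpDl// rnorm_ge0.
have := ft (e / (rnorm y + 1)); rewrite divr_gt0// => /(_ isT).
apply: filterS => x fx; rewrite -scalerBl -rmorphB rnormZr distrC.
rewrite (le_trans (ler_wpM2r (rnorm_ge0 _) fx))// mulrAC ler_pdivrMr//.
by rewrite ler_pM2l// lerDl.
Qed.

End RealScalars.

Section RankOne.
Variables (R : realType) (H : hilbertType R).
Local Notation K := (@compact_op R H).

Lemma rnormZi (V : normedModType R[i]) (z : V) : rnorm ((0 +i* 1) *: z) = rnorm z.
Proof. by rewrite rnormZ normc_def /= expr0n expr1n add0r sqrtr1 mul1r. Qed.

(** Cauchy-Schwarz is applied to the real and imaginary parts separately, whence the factor 2. *)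
Lemma normc_hdot_le (v x : H) : complex.Re `|hdot v x| <= 2 * rnorm v * rnorm x.
Proof.
rewrite -/(rnorm (hdot v x : R[i]^o)) rdot_hdot.
have -> (a b : R) : (a +i* b : R[i]^o) =
    a%:C *: (1 : R[i]^o) + b%:C *: ((0 +i* 1) *: (1 : R[i]^o)).
  by rewrite /GRing.scale /=; simpc.
have r1 : rnorm (1 : R[i]^o) = 1 by rewrite /rnorm normr1.
rewrite (le_trans (rnormD _ _))// !rnormZr rnormZi r1 normrN !mulr1.
have := rdot_norm_le v x; have := rdot_norm_le ((0 +i* 1) *: v) x; rewrite !rnormZi; lra.
Qed.

Lemma rank1_subproof (x y : H) : (fun v => hdot v x *: y) \in @bounded_op R H.
Proof.
apply/bounded_opP; split.
  by move=> a u v /=; rewrite hdotDl hdotZl scalerDl scalerA.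
exists (2 * rnorm x * rnorm y); first by rewrite !mulr_ge0 ?rnorm_ge0.
move=> v; rewrite rnormZ mulrAC ler_wpM2r ?rnorm_ge0// mulrAC.
exact: normc_hdot_le.
Qed.

Definition rank1 (x y : H) : bop H := Bop (rank1_subproof x y).

(** The unit ball is sent into a continuous image of a compact square, parametrized by the real and
    imaginary parts of the coefficient of [y]. *)
Lemma rank1_compact x y : rank1 x y \in K.
Proof.
pose f (z : R * R) : H := z.1%:C *: y + z.2%:C *: ((0 +i* 1) *: y).
pose M := rnorm x.
apply: (@compact_op_sub _ _ _ (f @` (`[- M, M] `*` `[- M, M]))).
  apply: continuous_compact; last by apply: compact_setX; exact: segment_compact.
  apply: continuous_subspaceT => z; apply: cvgD; apply: cvg_realZ.
    exact: cvg_fst.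
  exact: cvg_snd.
move=> v v1; rewrite [rank1 x y v]/(hdot v x *: y) rdot_hdot.
exists (rdot v x, - rdot ((0 +i* 1) *: v) x).
  have := rdot_norm_le v x; have := rdot_norm_le ((0 +i* 1) *: v) x; rewrite rnormZi.
  rewrite !ler_norml => /andP[h1 h2] /andP[h3 h4]; have x0 := rnorm_ge0 x.
  by rewrite /M; split; rewrite /= in_itv /=; apply/andP; split; nra.
by rewrite /f /= scalerA -scalerDl; congr (_ *: _); simpc.
Qed.

Lemma bop_sumE I (r : seq I) (P : pred I) (F : I -> bop H) (v : H) :
  (\sum_(i <- r | P i) F i) v = \sum_(i <- r | P i) F i v.
Proof. by elim/big_rec2: _ => // i u S _ <-. Qed.

End RankOne.

Section Orthonormal.
Variables (R : realType) (H : hilbertType R).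
Local Notation K := (@compact_op R H).

(** Only the first [n] terms of the sequence are constrained, which allows an orthonormal sequence
    to be built one term at a time. *)
Definition orthonormal_upto (x : nat -> H) (n : nat) :=
  forall i j, (i < n)%N -> (j < n)%N -> hdot (x i) (x j) = (i == j)%:R.

Definition span_proj (x : nat -> H) (m n : nat) : bop H :=
  \sum_(m <= i < n) rank1 (x i) (x i).

Lemma span_projE x m n v : span_proj x m n v = \sum_(m <= i < n) hdot v (x i) *: x i.
Proof. exact: bop_sumE. Qed.

Lemma span_proj_compact x m n : span_proj x m n \in K.
Proof. by apply: rpred_sum => i _; exact: rank1_compact. Qed.

Lemma hdot_suml I (r : seq I) (P : pred I) (F : I -> H) (v : H) :
  hdot (\sum_(i <- r | P i) F i) v = \sum_(i <- r | P i) hdot (F i) v.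
Proof. exact: linear_sumlz. Qed.

Lemma rdot_suml I (r : seq I) (P : pred I) (F : I -> H) (v : H) :
  rdot (\sum_(i <- r | P i) F i) v = \sum_(i <- r | P i) rdot (F i) v.
Proof. by rewrite /rdot hdot_suml raddf_sum. Qed.

Lemma hdot_span_proj x m n v j : orthonormal_upto x n -> (m <= j < n)%N ->
  hdot (span_proj x m n v) (x j) = hdot v (x j).
Proof.
move=> xo /andP[mj jn]; rewrite span_projE hdot_suml.
rewrite (bigD1_seq j) ?mem_index_iota ?mj ?jn ?iota_uniq//=.
rewrite hdotZl xo// eqxx mulr1 big_seq_cond big1 ?addr0// => i.
rewrite mem_index_iota => /andP[/andP[mi ni] /negbTE ij].
by rewrite hdotZl xo// ij mulr0.
Qed.

Lemma span_proj_norm x m n v : orthonormal_upto x n ->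
  rnorm (span_proj x m n v) ^+ 2 = rdot (span_proj x m n v) v.
Proof.
move=> xo; have PE w : rdot (span_proj x m n v) w =
    \sum_(m <= j < n) complex.Re (hdot v (x j) * hdot (x j) w).
  by rewrite span_projE rdot_suml; apply: eq_bigr => j _; rewrite /rdot hdotZl.
rewrite -rdotxx !PE big_seq_cond [RHS]big_seq_cond; apply: eq_bigr => j.
rewrite mem_index_iota andbT => jmn; congr (complex.Re (_ * _)).
by rewrite hdotC (hdot_span_proj _ xo jmn) -hdotC.
Qed.

Lemma span_proj_contract x m n v : orthonormal_upto x n ->
  rnorm (span_proj x m n v) <= rnorm v.
Proof.
move=> xo; have := rdot_le (span_proj x m n v) v; rewrite -span_proj_norm//.
have := rnorm_ge0 (span_proj x m n v); have := rnorm_ge0 v; nra.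
Qed.

Lemma span_proj_compl x n v : orthonormal_upto x n ->
  rnorm (v - span_proj x 0 n v) <= rnorm v.
Proof.
move=> xo; have := span_proj_norm 0 v xo.
rewrite -(@ler_pXn2r _ 2) ?nnegrE ?rnorm_ge0//.
rewrite -!rdotxx !(rdotDl, rdotDr, rdotNl, rdotNr) (rdotC v) => ->.
have := rdotxx (span_proj x 0 n v); rewrite -span_proj_norm// => _.
have := sqr_ge0 (rnorm (span_proj x 0 n v)); lra.
Qed.

(** The squared modulus of [hdot v (x i)], written with real inner products. *)
Definition bessel_term (x : nat -> H) (v : H) (i : nat) : R :=
  rdot v (x i) ^+ 2 + rdot ((0 +i* 1) *: v) (x i) ^+ 2.

Lemma rdot_span_proj x m n v :
  rdot (span_proj x m n v) v = \sum_(m <= i < n) bessel_term x v i.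
Proof.
rewrite span_projE rdot_suml; apply: eq_bigr => i _.
rewrite /rdot hdotZl (hdotC (x i)) /bessel_term rdot_hdot /rdot.
by rewrite /=; set a := complex.Re _; set b := complex.Re _; ring.
Qed.

Lemma bessel_term_ge0 x v i : 0 <= bessel_term x v i.
Proof. by rewrite addr_ge0 ?sqr_ge0. Qed.

Lemma bessel x n v : orthonormal_upto x n ->
  \sum_(0 <= i < n) bessel_term x v i <= rnorm v ^+ 2.
Proof.
move=> xo; rewrite -rdot_span_proj -span_proj_norm//.
by rewrite ler_pXn2r ?nnegrE ?rnorm_ge0// span_proj_contract.
Qed.

End Orthonormal.

Lemma bounded_sums_tail (R : realType) (u : nat -> R) (M : R) :
  (forall i, 0 <= u i) -> (forall n, \sum_(0 <= i < n) u i <= M) ->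
  forall e, 0 < e -> exists N, forall m n, (N <= m)%N -> (m <= n)%N ->
    \sum_(m <= i < n) u i <= e.
Proof.
move=> u0 uM e e0.
have sc : cvgn (series u).
  apply: nondecreasing_is_cvgn; last by exists M => _ [n _ <-]; rewrite /series /=.
  apply/nondecreasing_seqP => n; rewrite /series /= big_nat_recr//= lerDl//.
have e2 : 0 < e / 2 by rewrite divr_gt0.
have [N _ NP] := iffLR (cvgrPdist_le _ _) sc _ e2.
exists N => m n Nm mn; have := NP _ Nm; have := NP _ (leq_trans Nm mn).
rewrite /= !ler_norml /series /= (big_cat_nat (leq0n m) mn)//=.
by move=> /andP[h1 h2] /andP[h3 h4]; lra.
Qed.

Lemma half_geometric_le (R : realType) n : \sum_(0 <= k < n) 2^-1 ^+ k <= 2 :> R.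
Proof.
have -> : \sum_(0 <= k < n) 2^-1 ^+ k = 2 - 2 * 2^-1 ^+ n :> R.
  elim: n => [|n IH]; first by rewrite big_nil expr0; ring.
  by rewrite big_nat_recr//= IH exprS; field.
by rewrite lerBlDr lerDl mulr_ge0// exprn_ge0.
Qed.

Section WeaklyNull.
Variables (R : realType) (H : hilbertType R).
Local Notation K := (@compact_op R H).

Definition orthonormal_seq (x : nat -> H) := forall n, orthonormal_upto x n.

Lemma orthonormal_seq_norm x : orthonormal_seq x -> forall n, rnorm (x n) = 1.
Proof.
move=> xo n; apply/eqP; rewrite -(@pexpr_eq1 _ _ 2)// ?rnorm_ge0// -rdotxx /rdot.
by rewrite (xo n.+1)// eqxx.
Qed.

Lemma orthonormal_weak_null x v : orthonormal_seq x -> rdot v (x n) @[n --> \oo] --> (0 : R).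
Proof.
move=> xo; apply/cvgrPdist_le => e e0.
have e2 : 0 < e ^+ 2 by rewrite exprn_gt0.
have [N NP] := bounded_sums_tail (bessel_term_ge0 x v) (fun n => bessel v (xo n)) e2.
exists N => // n /= Nn; rewrite sub0r normrN.
have := NP n n.+1 Nn (leqnSn n); rewrite big_nat1 /bessel_term => h.
rewrite -(@ler_pXn2r _ 2) ?nnegrE//; last exact: ltW.
rewrite real_normK ?num_real//; apply: le_trans h.
by rewrite lerDl sqr_ge0.
Qed.

(** Compactness provides a norm limit [l] of [T (x n)] along [U]. By Bessel's inequality Re <x n,
    T^* l> tends to 0, so that |l|^2 = 0. *)
Lemma compact_weak_null x (U : set_system nat) (T : bop H) :
  orthonormal_seq x -> UltraFilter U -> \oo `<=` U -> T \in K ->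
  T (x n) @[n --> U] --> (0 : H).
Proof.
move=> xo UU Uoo cT.
have xM n : rnorm (x n) <= 1 by rewrite orthonormal_seq_norm.
have [l Tl] := compact_ultra_cvg UU cT xM.
suff -> : 0 = l by [].
apply/esym/rnorm_eq0/eqP; rewrite -sqrf_eq0 -rdotxx; apply/eqP.
have h1 : rdot (T (x n)) l @[n --> U] --> rdot l l.
  apply/cvgrPdist_le => e e0.
  have l1 : 0 < rnorm l + 1 by rewrite ltr_wpDl// rnorm_ge0.
  have el : 0 < e / (rnorm l + 1) by rewrite divr_gt0.
  have : \forall n \near U, rnorm (T (x n) - l) <= e / (rnorm l + 1).
    exact: (iffLR (cvg_rnormP _ _) Tl _ el).
  apply: filterS => n h; rewrite -rdotNl -rdotDl (le_trans (rdot_norm_le _ _))//.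
  rewrite rnormB (le_trans (ler_wpM2r (rnorm_ge0 _) h))// mulrAC ler_pdivrMr//.
  by rewrite ler_pM2l// lerDl.
have h2 : rdot (T (x n)) l @[n --> U] --> (0 : R).
  under eq_fun do rewrite rdot_adjoint rdotC.
  exact: (cvg_trans (cvg_app _ Uoo) (orthonormal_weak_null _ xo)).
by rewrite -(cvg_lim (@norm_hausdorff _ R^o) h1) (cvg_lim (@norm_hausdorff _ R^o) h2).
Qed.

(** With [P] the projection onto the vectors found so far, T - T P is another lift of the same
    class, so its operator norm still exceeds [mu]; hence some vector of the orthogonal complement
    is stretched by more than [mu]. *)
Lemma essential_step (T : bop H) (x : nat -> H) n (mu : R) :
  0 <= mu -> mu < quotient_norm (calkin_pi T) -> orthonormal_upto x n ->
  exists y, [/\ rnorm y = 1, forall i, (i < n)%N -> hdot y (x i) = 0 & mu < rnorm (T y)].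
Proof.
move=> mu0 muT xo; pose P := span_proj x 0 n.
have [v hv] : exists v, mu * rnorm v < rnorm (T (v - P v)).
  apply: contrapT => /forallNP h; move: muT; apply/negP; rewrite -leNgt.
  have -> : calkin_pi T = calkin_pi (T - T * P).
    apply/calkin_piP; rewrite opprB addrC subrK; apply: compact_opMl.
    exact: span_proj_compact.
  apply: le_trans (quotient_norm_le _) _; apply: opnorm_le => // v.
  have := h v; rewrite raddfB /= => /negP; rewrite -leNgt; exact.
set w := v - P v in hv.
have wv : rnorm w <= rnorm v by exact: span_proj_compl.
have w0 : 0 < rnorm w.
  rewrite lt_def rnorm_ge0 andbT; apply: contraTN hv => /eqP/rnorm_eq0 ->.
  by rewrite linear0 rnorm0 -leNgt mulr_ge0 ?rnorm_ge0.
exists ((rnorm w)^-1%:C *: w); split.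
- by rewrite rnormZr gtr0_norm ?invr_gt0// mulVf// gt_eqF.
- move=> i ni; rewrite hdotZl /w hdotDl hdotNl (hdot_span_proj _ xo)// subrr.
  by rewrite mulr0.
- rewrite linearZ rnormZr gtr0_norm ?invr_gt0// mulrC ltr_pdivlMr//.
  by apply: le_lt_trans hv; rewrite ler_wpM2l.
Qed.

Lemma essential_sequence (T : bop H) (mu : nat -> R) :
  (forall n, 0 <= mu n) -> (forall n, mu n < quotient_norm (calkin_pi T)) ->
  exists2 x, orthonormal_seq x & forall n, mu n < rnorm (T (x n)).
Proof.
move=> mu0 muT.
have /choice[g gP] : forall xn : (nat -> H) * nat, exists y,
    orthonormal_upto xn.1 xn.2 ->
    [/\ rnorm y = 1, forall i, (i < xn.2)%N -> hdot y (xn.1 i) = 0 & mu xn.2 < rnorm (T y)].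
  move=> [x n] /=; have [xo|xo] := pselect (orthonormal_upto x n); last by exists 0.
  by have [y yP] := essential_step (mu0 n) (muT n) xo; exists y.
(* Each vector depends on all the earlier ones, so the recursion carries the list of them; [nth 0]
   pads it to a sequence, of which [orthonormal_upto] reads only the first [n] terms. *)
pose fix L n : seq H :=
  if n is k.+1 then rcons (L k) (g (nth 0 (L k), k)) else [::].
have sL n : size (L n) = n by elim: n => //= n IH; rewrite size_rcons IH.
pose x n := g (nth 0 (L n), n).
have LE n i : (i < n)%N -> nth 0 (L n) i = x i.
  elim: n => //= n IH; rewrite ltnS leq_eqVlt => /orP[/eqP->|ni].
    by rewrite nth_rcons sL ltnn eqxx.
  by rewrite nth_rcons sL ni IH.
have xg n : orthonormal_upto x n ->
    [/\ rnorm (x n) = 1, forall i, (i < n)%N -> hdot (x n) (x i) = 0 & mu n < rnorm (T (x n))].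
  move=> xo; have [|h1 h2 h3] := gP (nth 0 (L n), n).
    by move=> i j ni nj /=; rewrite !LE// xo.
  by split => // i ni; rewrite -(h2 i ni) /= LE.
have xo : orthonormal_seq x.
  elim=> [//|n IH] i j; have [h1 h2 _] := xg n IH.
  rewrite !ltnS leq_eqVlt => /orP[/eqP->|ni]; rewrite leq_eqVlt => /orP[/eqP->|nj].
  - by rewrite eqxx -hdot_norm rnormE h1 expr1n.
  - by rewrite h2// gtn_eqF.
  - by rewrite hdotC h2// ltn_eqF//; exact: (rmorph0 conjC).
  - exact: IH.
by exists x => // n; have [_ _] := xg n (xo n).
Qed.

End WeaklyNull.

Section StrongLimits.
Variables (R : realType) (H : hilbertType R).

Lemma strong_limit (T : nat -> bop H) (M : R) : 0 <= M ->
  (forall n x, rnorm (T n x) <= M * rnorm x) ->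
  (forall x, exists l : H, T n x @[n --> \oo] --> l) ->
  exists S : bop H, forall x, T n x @[n --> \oo] --> S x.
Proof.
move=> M0 TM /choice[S SP].
have Slin : linear S.
  move=> a x y; apply: (cvg_unique (@norm_hausdorff _ H) (SP (a *: x + y))).
  change (T n (a *: x + y) @[n --> \oo] --> a *: S x + S y).
  under eq_fun do rewrite linearP.
  by apply: cvgD; [apply: cvgZr|]; exact: SP.
have Sb : S \in @bounded_op R H.
  apply/bounded_opP; split => //; exists M => // x.
  by apply: (cvg_rnorm_le (SP x)); apply: nearW => n; exact: TM.
by exists (Bop Sb).
Qed.

End StrongLimits.

(** * The Calkin algebra as a C*-algebra *)

Section CalkinAlgebra.
Variables (R : realType) (H : hilbertType R).
Local Notation K := (@compact_op R H).
Local Notation C := (calkin H).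
Implicit Types (S T : bop H) (c d : C).

Lemma rnorm_calkin c : rnorm c = quotient_norm c.
Proof. by []. Qed.

Lemma calkin_rnormM c d : rnorm (c * d) <= rnorm c * rnorm d.
Proof.
apply/ler_addgt0Pr => e e0; rewrite !rnorm_calkin.
set a := quotient_norm c; set b := quotient_norm d.
have a0 : 0 <= a := quotient_norm_ge0 c; have b0 : 0 <= b := quotient_norm_ge0 d.
(* As f <= 1, (a + f) (b + f) <= a b + f (a + b + 1) <= a b + e. *)
pose f := Order.min 1 (e / (a + b + 1)).
have s0 : 0 < a + b + 1 by lra.
have f0 : 0 < f by rewrite lt_min ltr01 divr_gt0.
have [f1 fe] : f <= 1 /\ f * (a + b + 1) <= e.
  by split; rewrite -?ler_pdivlMr// ge_min lexx ?orbT.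
have [S Sc Sa] := quotient_norm_adherent c f0.
have [T Td Tb] := quotient_norm_adherent d f0.
rewrite -Sc -Td -calkin_piM.
have h : opnorm (S * T) <= opnorm S * opnorm T.
  apply: opnorm_le => [|x]; first by rewrite mulr_ge0 ?opnorm_ge0.
  apply: (le_trans (opnormP S (T x))).
  by rewrite -mulrA ler_wpM2l ?opnorm_ge0// opnormP.
apply: le_trans (quotient_norm_le _) (le_trans h _).
have := opnorm_ge0 S; have := opnorm_ge0 T; rewrite -/a -/b in Sa Tb *; nra.
Qed.

(** Only an inequality, because the Calkin algebra is zero when [H] is finite-dimensional. *)
Lemma calkin_rnorm1 : rnorm (1 : C) <= 1.
Proof.
apply: le_trans (quotient_norm_le 1) _; apply: opnorm_le => // x.
by rewrite mul1r.
Qed.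

Lemma calkin_rnormX c n : rnorm (c ^+ n) <= rnorm c ^+ n.
Proof.
elim: n => [|n IH]; first by rewrite !expr0 calkin_rnorm1.
by rewrite !exprS (le_trans (calkin_rnormM _ _))// ler_wpM2l ?rnorm_ge0.
Qed.

(* Lifts to operators with summable norms have a strongly convergent sum. *)
Lemma calkin_summable (c : nat -> C) (M : R) :
  (forall n, \sum_(0 <= k < n) rnorm (c k) <= M) ->
  exists l : C, series c @ \oo --> l.
Proof.
move=> cM; pose g k : R := 2^-1 ^+ k.
have g0 k : 0 < g k by rewrite exprn_gt0.
have gM n : \sum_(0 <= k < n) g k <= 2 := half_geometric_le R n.
have /choice[T TP] k : exists T, calkin_pi T = c k /\ opnorm T < rnorm (c k) + g k.
  by have [T Tc Tk] := quotient_norm_adherent (c k) (g0 k); exists T.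
have TM n : \sum_(0 <= k < n) opnorm (T k) <= M + 2.
  apply: le_trans (lerD (cM n) (gM n)); rewrite -big_split/=.
  by apply: ler_sum => k _; apply: ltW; case: (TP k).
have M2 : 0 <= M + 2 by have := TM 0%N; rewrite big_nil.
have tail := bounded_sums_tail (fun k => opnorm_ge0 (T k)) TM.
pose S n : bop H := \sum_(0 <= k < n) T k.
have part m n x : (m <= n)%N ->
    rnorm (S n x - S m x) <= (\sum_(m <= k < n) opnorm (T k)) * rnorm x.
  move=> mn; rewrite !bop_sumE (big_cat_nat (leq0n m) mn)//= addrAC subrr add0r.
  rewrite (le_trans (rnorm_sum _ _ _))// mulr_suml.
  by apply: ler_sum => k _; exact: opnormP.
have Sb n x : rnorm (S n x) <= (M + 2) * rnorm x.
  have := part 0%N n x (leq0n n); rewrite /S big_nil [X in _ - X]/(0 : H) subr0.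
  by move=> /le_trans; apply; rewrite ler_wpM2r ?rnorm_ge0.
have [x|L LP] := strong_limit M2 Sb.
  apply: cauchy_rnorm_cvg => e e0.
  have x1 : 0 < rnorm x + 1 by rewrite ltr_wpDl// rnorm_ge0.
  have ex : 0 < e / (rnorm x + 1) by rewrite divr_gt0.
  have [N NP] := tail _ ex; exists N => n Nn.
  rewrite (le_trans (part _ _ _ Nn))//.
  rewrite (le_trans (ler_wpM2r (rnorm_ge0 _) (NP _ _ (leqnn N) Nn)))//.
  by rewrite mulrAC ler_pdivrMr// ler_pM2l// lerDl.
exists (calkin_pi L); apply/cvg_rnormP => e e0.
have [N NP] := tail _ e0; exists N => // n /= Nn.
have -> : series c n = calkin_pi (S n).
  rewrite /series /= /S; elim: (n) => [|m IH]; first by rewrite !big_nil calkin_pi0.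
  by rewrite !big_nat_recr//= calkin_piD IH; case: (TP m) => ->.
rewrite -calkin_piN -calkin_piD (le_trans (quotient_norm_le _))//.
apply: opnorm_le => [|x]; first exact: ltW.
rewrite [(S n - L) x]/(S n x - L x) rnormB.
(* The tail bound holds for all finite partial sums and passes to their strong limit; this upgrades
   strong convergence to norm convergence. *)
have h : (fun m => S m x - S n x) @ \oo --> L x - S n x.
  by apply: cvgB; [exact: LP|exact: cvg_cst].
apply: (cvg_rnorm_le h); exists n => // m /= nm.
by rewrite (le_trans (part _ _ _ nm))// ler_wpM2r ?rnorm_ge0// NP.
Qed.

Lemma star_pi T : star (calkin_pi T) = calkin_pi (adjoint T).
Proof.
apply/calkin_piP; have /calkin_piP/adjoint_compact := calkin_reprK (calkin_pi T).
by rewrite -scaleN1r adjointD adjointZ rmorphN1 scaleN1r.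
Qed.

Lemma starD c d : star (c + d) = star c + star d.
Proof.
have [S ->] := calkinP c; have [T ->] := calkinP d.
by rewrite -calkin_piD !star_pi adjointD calkin_piD.
Qed.

Lemma starZ (a : R[i]) c : star (a *: c) = a^* *: star c.
Proof. by have [T ->] := calkinP c; rewrite -calkin_piZ !star_pi adjointZ calkin_piZ. Qed.

Lemma starM c d : star (c * d) = star d * star c.
Proof.
have [S ->] := calkinP c; have [T ->] := calkinP d.
by rewrite -calkin_piM !star_pi adjointM calkin_piM.
Qed.

Lemma starK c : star (star c) = c.
Proof. by have [T ->] := calkinP c; rewrite !star_pi adjointK. Qed.

Lemma star1 : star (1 : C) = 1.
Proof. by rewrite -calkin_pi1 star_pi adjoint1. Qed.

Lemma starN c : star (- c) = - star c.
Proof. by rewrite -scaleN1r starZ rmorphN1 scaleN1r. Qed.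

Lemma starB c d : star (c - d) = star c - star d.
Proof. by rewrite starD starN. Qed.

Lemma star0 : star (0 : C) = 0.
Proof. by rewrite -(subrr 1) starB star1 subrr. Qed.

Lemma starX c n : star (c ^+ n) = star c ^+ n.
Proof. by elim: n => [|n IH]; rewrite ?expr0 ?star1// exprS starM IH exprSr. Qed.

Lemma starZr (t : R) c : star (t%:C *: c) = t%:C *: star c.
Proof. by rewrite starZ; congr (_ *: _); exact: conjc_real. Qed.

End CalkinAlgebra.

(** * States of the Calkin algebra and the C*-identity *)

Section VectorStates.
Variables (R : realType) (H : hilbertType R).
Local Notation K := (@compact_op R H).
Local Notation C := (calkin H).

(* The real semi-inner product of the GNS construction on the Calkin algebra:
   the real part of phi (b^* a) for a state phi. *)
Record gns_form (B : C -> C -> R) : Prop := GnsForm {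
  gnsD : forall a b c, B (a + b) c = B a c + B b c;
  gnsZ : forall t a b, B (t%:C *: a) b = t * B a b;
  gnsC : forall a b, B a b = B b a;
  gns_ge0 : forall a, 0 <= B a a;
  gns1 : B 1 1 = 1;
  gns_star : forall x a b, B (x * a) b = B a (star x * b);
  gns_le : forall a, B a a <= rnorm a ^+ 2
}.

Section AlongUltrafilter.
Variables (x : nat -> H) (U : set_system nat).
Hypotheses (xo : orthonormal_seq x) (UU : UltraFilter U) (Uoo : \oo `<=` U).

(** The ultralimit of the vector states at [x n]. It is well defined on the Calkin algebra because a
    compact operator sends [x n] to 0 along [U]. *)
Definition ultra_form (a b : C) : R :=
  lim (rdot (repr a (x n)) (repr b (x n)) @[n --> U]).

Let rdot_bound (S T : bop H) n : `|rdot (S (x n)) (T (x n))| <= opnorm S * opnorm T.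
Proof.
rewrite (le_trans (rdot_norm_le _ _))// ler_pM ?rnorm_ge0//.
  by rewrite (le_trans (opnormP _ _))// orthonormal_seq_norm// mulr1.
by rewrite (le_trans (opnormP _ _))// orthonormal_seq_norm// mulr1.
Qed.

Lemma rdot_cvg0 (S T : bop H) : S \in K ->
  rdot (S (x n)) (T (x n)) @[n --> U] --> (0 : R).
Proof.
move=> cS; have S0 := compact_weak_null xo UU Uoo cS.
apply/cvgrPdist_le => e e0.
have t1 : 0 < opnorm T + 1 by rewrite ltr_wpDl// opnorm_ge0.
have et : 0 < e / (opnorm T + 1) by rewrite divr_gt0.
have : \forall n \near U, rnorm (S (x n) - 0) <= e / (opnorm T + 1).
  exact: (iffLR (cvg_rnormP _ _) S0 _ et).
apply: filterS => n; rewrite subr0 sub0r normrN => h.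
rewrite (le_trans (rdot_norm_le _ _))//.
have h2 : rnorm (T (x n)) <= opnorm T + 1.
  by rewrite (le_trans (opnormP _ _))// orthonormal_seq_norm// mulr1 lerDl.
apply: le_trans (ler_pM (rnorm_ge0 _) (rnorm_ge0 _) h h2) _.
by rewrite divfK// gt_eqF.
Qed.

Lemma ultra_form_cvg (S T : bop H) :
  rdot (S (x n)) (T (x n)) @[n --> U] --> ultra_form (calkin_pi S) (calkin_pi T).
Proof.
set S' := repr (calkin_pi S); set T' := repr (calkin_pi T).
have kS : S - S' \in K by apply/calkin_piP; rewrite calkin_reprK.
have kT : T - T' \in K by apply/calkin_piP; rewrite calkin_reprK.
have [l hl] := real_ultra_cvg UU (rdot_bound S' T').
have -> : ultra_form (calkin_pi S) (calkin_pi T) = l + 0 + 0.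
  by rewrite !addr0; exact: (cvg_lim (@norm_hausdorff _ R^o) hl).
have -> : (fun n => rdot (S (x n)) (T (x n))) =
    (fun n => rdot (S' (x n)) (T' (x n)) + rdot ((S - S') (x n)) (T (x n)) +
              rdot ((T - T') (x n)) (S' (x n))).
  apply/funext => n.
  rewrite [(S - S') _]/(S (x n) - S' (x n)) [(T - T') _]/(T (x n) - T' (x n)).
  rewrite !rdotDl !rdotNl (rdotC (T (x n))) (rdotC (T' (x n))); ring.
by apply: cvgD; [apply: cvgD => //|]; exact: rdot_cvg0.
Qed.

Let limE (f : nat -> R) (l l' : R) : f @ U --> l -> f @ U --> l' -> l = l'.
Proof. exact: (cvg_unique (@norm_hausdorff _ R^o)). Qed.

Lemma ultra_form_gns : gns_form ultra_form.
Proof.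
split.
- move=> a b c; have [S ->] := calkinP a; have [T ->] := calkinP b; have [W ->] := calkinP c.
  rewrite -calkin_piD; apply: limE (@ultra_form_cvg _ _) _.
  rewrite [X in X @ _](_ : _ = fun n => rdot (S (x n)) (W (x n)) + rdot (T (x n)) (W (x n))).
    by apply: cvgD; exact: ultra_form_cvg.
  by apply/funext => n; rewrite -rdotDl.
- move=> t a b; have [S ->] := calkinP a; have [T ->] := calkinP b.
  rewrite -calkin_piZ; apply: limE (@ultra_form_cvg _ _) _.
  rewrite [X in X @ _](_ : _ = fun n => t * rdot (S (x n)) (T (x n))).
    by apply: cvgM; [exact: cvg_cst|exact: ultra_form_cvg].
  by apply/funext => n; rewrite -rdotZl.
- by move=> a b; rewrite /ultra_form; under eq_fun do rewrite rdotC.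
- move=> a; have [S ->] := calkinP a.
  rewrite -(cvg_lim (@norm_hausdorff _ R^o) (@ultra_form_cvg S S)).
  apply: limr_ge; first exact: cvgP (@ultra_form_cvg S S).
  by apply: filterE => n; rewrite rdotxx sqr_ge0.
- rewrite -calkin_pi1; apply: limE (@ultra_form_cvg _ _) _.
  rewrite [X in X @ _](_ : _ = fun=> 1); first exact: cvg_cst.
  apply/funext => n; change (rdot (x n) (x n) = 1).
  by rewrite rdotxx orthonormal_seq_norm// expr1n.
- move=> c a b; have [S ->] := calkinP a; have [T ->] := calkinP b; have [W ->] := calkinP c.
  rewrite star_pi -!calkin_piM; apply: limE (@ultra_form_cvg _ _) _.
  rewrite [X in X @ _](_ : _ = fun n => rdot (S (x n)) ((adjoint W * T) (x n))).
    exact: ultra_form_cvg.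
  apply/funext => n; change (rdot (W (S (x n))) (T (x n)) = rdot (S (x n)) (adjoint W (T (x n)))).
  exact: rdot_adjoint.
- move=> a; apply/ler_addgt0Pr => e e0.
  have [f f0 fe] : exists2 f, 0 < f & (rnorm a + f) ^+ 2 <= rnorm a ^+ 2 + e.
    have a0 := rnorm_ge0 a; pose g := 2 * rnorm a + 1.
    have g0 : 0 < g by rewrite /g; lra.
    (* As f <= 1, (|a| + f)^2 - |a|^2 = f (2 |a| + f) <= f g <= e. *)
    exists (Order.min 1 (e / g)); first by rewrite lt_min ltr01 divr_gt0.
    set f := Order.min _ _.
    have f0 : 0 < f by rewrite lt_min ltr01 divr_gt0.
    have f1 : f <= 1 by rewrite ge_min lexx.
    have fg : f * g <= e by rewrite -ler_pdivlMr// ge_min lexx orbT.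
    rewrite /g in fg; nra.
  apply: le_trans fe; have [S Sa Sf] := quotient_norm_adherent a f0.
  rewrite -{1 2}Sa -(cvg_lim (@norm_hausdorff _ R^o) (@ultra_form_cvg S S)).
  apply: limr_le; first exact: cvgP (@ultra_form_cvg S S).
  apply: filterE => n; rewrite (le_trans (ler_norm _))// (le_trans (rdot_bound _ _ _))//.
  by rewrite -expr2 ler_pXn2r ?nnegrE ?opnorm_ge0 ?addr_ge0 ?rnorm_ge0// ltW.
Qed.

End AlongUltrafilter.

Lemma free_ultrafilter : exists U : set_system nat, UltraFilter U /\ \oo `<=` U.
Proof. exact: ultraFilterLemma. Qed.

Lemma norming_sequence (c : C) : 0 < rnorm c ->
  exists x U, [/\ orthonormal_seq (x : nat -> H), UltraFilter (U : set_system nat), \oo `<=` U &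
    ultra_form x U c c = rnorm c ^+ 2].
Proof.
move=> c0; have [T cT] := calkinP c.
(* Strictly below the norm, as [essential_sequence] requires, and increasing to it; positivity of
   the norm is used for the strictness. *)
pose mu n := rnorm c * (1 - n.+1%:R^-1).
have n1 n : 0 < n.+1%:R^-1 :> R /\ n.+1%:R^-1 <= 1 :> R.
  by rewrite invr_gt0 ltr0n invf_le1 ?ltr0n// ler1n.
have [||x xo xT] := @essential_sequence R H T mu.
- by move=> n; have [h1 h2] := n1 n; rewrite /mu mulr_ge0 ?rnorm_ge0// subr_ge0.
- move=> n; have [h1 h2] := n1 n; rewrite -cT -rnorm_calkin /mu.
  by rewrite -[ltRHS]mulr1 ltr_pM2l// ltrBlDr ltrDl.
have [U [UU Uoo]] := free_ultrafilter.
exists x, U; split=> //; apply/eqP; rewrite eq_le gns_le/=; last exact: ultra_form_gns.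
have muc : mu n @[n --> U] --> rnorm c.
  apply: cvg_trans (cvg_app _ Uoo) _; rewrite -[X in _ --> X]mulr1 -[X in _ * X]subr0.
  apply: cvgM; first exact: cvg_cst.
  by apply: cvgB; [exact: cvg_cst|exact: cvg_harmonic].
have muc2 : mu n * mu n @[n --> U] --> rnorm c ^+ 2 by rewrite expr2; exact: cvgM.
have Tc := @ultra_form_cvg _ _ xo UU Uoo T T.
rewrite -(cvg_lim (@norm_hausdorff _ R^o) muc2) cT -(cvg_lim (@norm_hausdorff _ R^o) Tc).
apply: ler_lim; [exact: cvgP muc2|exact: cvgP Tc|].
apply: filterE => n; rewrite rdotxx -expr2 ler_pXn2r ?nnegrE ?rnorm_ge0//.
  exact: ltW.
by have [h1 h2] := n1 n; rewrite /mu mulr_ge0 ?rnorm_ge0// subr_ge0.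
Qed.

(** A state phi with phi (c^* c) = |c|^2. It depends on [c]: every later norm estimate starts by
    choosing the form adapted to the element at hand. *)
Lemma gns_exists (c : C) : 0 < rnorm c ->
  exists2 B, gns_form B & B c c = rnorm c ^+ 2.
Proof.
move=> c0; have [x [U [xo UU Uoo cc]]] := norming_sequence c0.
by exists (ultra_form x U) => //; exact: ultra_form_gns.
Qed.

Section GnsTheory.
Variables (B : C -> C -> R) (BP : gns_form B).
Implicit Types a b c : C.

Lemma gnsN a b : B (- a) b = - B a b.
Proof. by rewrite -[- a]scaleN1r -(rmorphN1 (real_complex R)) gnsZ// mulN1r. Qed.
Lemma gnsB a b c : B (a - b) c = B a c - B b c.
Proof. by rewrite gnsD// gnsN. Qed.
Lemma gnsDr a b c : B a (b + c) = B a b + B a c.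
Proof. by rewrite !(gnsC BP a) gnsD. Qed.
Lemma gnsBr a b c : B a (b - c) = B a b - B a c.
Proof. by rewrite !(gnsC BP a) gnsB. Qed.
Lemma gnsZr t a b : B a (t%:C *: b) = t * B a b.
Proof. by rewrite !(gnsC BP a) gnsZ. Qed.
Lemma gns0 b : B 0 b = 0.
Proof. by rewrite -(subrr b) gnsB subrr. Qed.

Lemma gns_CS a b : B a b ^+ 2 <= B a a * B b b.
Proof.
have key t : 0 <= B a a + 2 * t * B a b + t ^+ 2 * B b b.
  have := gns_ge0 BP (a + t%:C *: b).
  by rewrite gnsD// !gnsDr gnsZ// gnsZr gnsZ// gnsZr (gnsC BP b a); lra.
have a0 := gns_ge0 BP a; have b0 := gns_ge0 BP b.
have [bz|bz] := eqVneq (B b b) 0.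
  have [->|abz] := eqVneq (B a b) 0; first by rewrite expr0n mulr_ge0.
  (* At this [t] the right-hand side of [key] equals -1. *)
  have := key (- (B a a + 1) / (2 * B a b)); rewrite bz mulr0 addr0.
  have -> : 2 * (- (B a a + 1) / (2 * B a b)) * B a b = - (B a a + 1) by field.
  lra.
have bp : 0 < B b b by rewrite lt_def bz.
have := key (- B a b / B b b).
have -> : B a a + 2 * (- B a b / B b b) * B a b + (- B a b / B b b) ^+ 2 * B b b =
  B a a - B a b ^+ 2 / B b b by field.
by rewrite subr_ge0 ler_pdivrMr.
Qed.

Lemma gns_norm_le a b : `|B a b| <= rnorm a * rnorm b.
Proof.
rewrite -(@ler_pXn2r _ 2) ?nnegrE ?mulr_ge0 ?rnorm_ge0// real_normK ?num_real//.
rewrite (le_trans (gns_CS _ _))// exprMn.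
by rewrite ler_pM ?gns_ge0// gns_le.
Qed.

End GnsTheory.

(** For [B] norming [c], |c|^2 = B c c = B 1 (c^* c) <= |1| |c^* c|. *)
Lemma rnorm_star_mul (c : C) : rnorm c ^+ 2 <= rnorm (star c * c).
Proof.
have [->|c0] := eqVneq c 0; first by rewrite rnorm0 expr0n rnorm_ge0.
have cp : 0 < rnorm c.
  by rewrite lt_def rnorm_ge0 andbT; apply: contra c0 => /eqP/rnorm_eq0->.
have [B BP <-] := gns_exists cp.
rewrite -[c in B c _]mulr1 (gns_star BP) (le_trans (ler_norm _))//.
rewrite (le_trans (gns_norm_le BP _ _))//.
by rewrite ler_piMl ?rnorm_ge0 ?calkin_rnorm1.
Qed.

Lemma rnorm_star (c : C) : rnorm (star c) = rnorm c.
Proof.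
have h (d : C) : rnorm d <= rnorm (star d).
  have [->|d0] := eqVneq d 0; first by rewrite rnorm0 rnorm_ge0.
  have dp : 0 < rnorm d.
    by rewrite lt_def rnorm_ge0 andbT; apply: contra d0 => /eqP/rnorm_eq0->.
  rewrite -(ler_pM2r dp) -expr2 (le_trans (rnorm_star_mul _))//.
  exact: calkin_rnormM.
by apply/eqP; rewrite eq_le h andbT -{2}(starK c) h.
Qed.

Lemma rnorm_starM (c : C) : rnorm (star c * c) = rnorm c ^+ 2.
Proof.
apply/eqP; rewrite eq_le rnorm_star_mul andbT.
by rewrite (le_trans (calkin_rnormM _ _))// rnorm_star.
Qed.

End VectorStates.

(** * Trivial annihilators *)

Section TrivialAnnihilator.
Variables (R : realType) (H : hilbertType R).
Local Notation K := (@compact_op R H).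
Local Notation C := (calkin H).

Lemma span_proj_cat (x : nat -> H) m n : (m <= n)%N ->
  span_proj x 0 n = span_proj x 0 m + span_proj x m n.
Proof. by move=> mn; rewrite /span_proj (big_cat_nat (leq0n m) mn). Qed.

Lemma orthonormal_proj (e : nat -> H) : orthonormal_seq e ->
  exists E : bop H, forall v, span_proj e 0 n v @[n --> \oo] --> E v.
Proof.
move=> eo; apply: (@strong_limit _ _ _ 1) => [//|n v|v].
  by rewrite mul1r span_proj_contract.
apply: cauchy_rnorm_cvg => r r0.
have r2 : 0 < r ^+ 2 by rewrite exprn_gt0.
have [N NP] := bounded_sums_tail (bessel_term_ge0 e v) (fun n => bessel v (eo n)) r2.
exists N => n Nn; rewrite (span_proj_cat _ Nn).
rewrite [(_ + span_proj e N n) v]/(span_proj e 0 N v + span_proj e N n v) addrAC subrr add0r.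
rewrite -(@ler_pXn2r _ 2) ?nnegrE ?rnorm_ge0 ?(ltW r0)//.
by rewrite span_proj_norm// rdot_span_proj NP.
Qed.

(* If T e_i tends to 0 fast enough then T E is a norm limit of the compact
   operators T E_n, while E fixes the e_i and so is not compact. *)
Lemma annihilated_proj (T : bop H) (e : nat -> H) : orthonormal_seq e ->
  (forall k, rnorm (T (e k)) <= 2^-1 ^+ k) ->
  exists E : bop H, T * E \in K /\ E \notin K.
Proof.
move=> eo Te; have [E EP] := orthonormal_proj eo; exists E; split.
  pose g k : R := 2^-1 ^+ k.
  have g0 k : 0 <= g k by rewrite exprn_ge0.
  have gM n : \sum_(0 <= k < n) g k <= 2 := half_geometric_le R n.
  apply: compact_op_closed => r r0.
  (* Halving [r] pays for the factor 2 of [normc_hdot_le]. *)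
  have r2 : 0 < r / 2 by rewrite divr_gt0.
  have [N NP] := bounded_sums_tail g0 gM r2.
  exists (T * span_proj e 0 N); first by apply: compact_opMl; exact: span_proj_compact.
  rewrite -mulrBr; apply: opnorm_le => [|v]; first exact: ltW.
  change (rnorm (T (E v - span_proj e 0 N v)) <= r * rnorm v).
  have h : T (span_proj e 0 n v - span_proj e 0 N v) @[n --> \oo] -->
           T (E v - span_proj e 0 N v).
    apply: continuous_cvg; first exact: bop_continuous.
    by apply: cvgB; [exact: EP|exact: cvg_cst].
  apply: (cvg_rnorm_le h); exists N => // n /= Nn; rewrite (span_proj_cat _ Nn).
  rewrite [(_ + span_proj e N n) v]/(span_proj e 0 N v + span_proj e N n v) addrAC subrr add0r.
  rewrite span_projE linear_sum /= (le_trans (rnorm_sum _ _ _))//.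
  apply: (@le_trans _ _ (\sum_(N <= k < n) g k * (2 * rnorm v))); last first.
    rewrite -mulr_suml mulrA ler_wpM2r ?rnorm_ge0//.
    by have := NP _ _ (leqnn N) Nn; lra.
  apply: ler_sum => k _; rewrite linearZ rnormZ mulrC.
  rewrite ler_pM ?rnorm_ge0 ?(rnorm_ge0 (_ : R[i]^o))//; first exact: Te.
  by rewrite (le_trans (normc_hdot_le _ _))// orthonormal_seq_norm// mulr1.
have Ee k : E (e k) = e k.
  apply: (cvg_unique (@norm_hausdorff _ H) (EP (e k))).
  apply/cvg_rnormP => r r0; exists k.+1 => // n /= kn.
  suff -> : span_proj e 0 n (e k) = e k by rewrite subrr rnorm0 ltW.
  rewrite span_projE (bigD1_seq k) ?mem_index_iota ?kn ?iota_uniq//=.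
  rewrite (eo n)// eqxx scale1r big_seq_cond big1 ?addr0// => i.
  rewrite mem_index_iota => /andP[/andP[_ ni] /negbTE ik].
  by rewrite (eo n)// eq_sym ik scale0r.
apply/negP => cE.
have [U [UU Uoo]] := free_ultrafilter.
have h : rnorm (E (e n)) @[n --> U] --> rnorm (0 : H).
  by apply: rnorm_cvg; exact: compact_weak_null.
have h1 : rnorm (E (e n)) @[n --> U] --> (1 : R).
  under eq_fun do rewrite Ee orthonormal_seq_norm//.
  exact: cvg_cst.
have /eqP : rnorm (0 : H) = 1 by exact: (cvg_unique (@norm_hausdorff _ R^o) h h1).
by rewrite rnorm0 eq_sym oner_eq0.
Qed.

(** If |d| >= 1, the form norming [d] has B c c = 1 - B d d = 1 - |d|^2 <= 0. A lift of [c] thus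
    tends to 0 along the norming sequence, and a fast subsequence feeds [annihilated_proj], whose
    projection is a nonzero class killed by [c]. *)
Lemma trivial_annihilator_lt1 (c d : C) : star c = c -> star d = d ->
  c * c + d * d = 1 -> trivial_annihilator c -> rnorm d < 1.
Proof.
move=> cs ds cd1 cA; rewrite ltNge; apply/negP => d1.
have [x [U [xo UU Uoo dd]]] := norming_sequence (lt_le_trans ltr01 d1).
have BP := ultra_form_gns xo UU Uoo; set B := ultra_form x U in dd BP.
have cc : B c c = 0.
  have h : B c c = 1 - rnorm d ^+ 2.
    have mul2 a : star a = a -> B a a = B 1 (a * a).
      by move=> sa; rewrite -{1}[a]mulr1 (gns_star BP) sa.
    by rewrite -dd !mul2// -(gns1 BP) -cd1 (gnsDr BP) addrK.
  have := gns_ge0 BP c; rewrite h.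
  have : 1 <= rnorm d ^+ 2 by rewrite exprn_ege1.
  lra.
have [T cT] := calkinP c.
have T0 : rdot (T (x n)) (T (x n)) @[n --> U] --> (0 : R).
  by rewrite -cc cT; exact: ultra_form_cvg.
have /choice[g gP] : forall Nk : nat * nat, exists n,
    (Nk.1 <= n)%N /\ rnorm (T (x n)) <= 2^-1 ^+ Nk.2.
  move=> [N k] /=.
  have k0 : 0 < (2^-1 : R) ^+ k by rewrite exprn_gt0.
  have k2 : 0 < ((2^-1 : R) ^+ k) ^+ 2 by rewrite exprn_gt0.
  have UN : U [set n | (N <= n)%N] by apply: Uoo; exists N.
  have Uk : \forall n \near U, `|0 - rdot (T (x n)) (T (x n))| <= ((2^-1 : R) ^+ k) ^+ 2.
    exact: (iffLR (cvgrPdist_le _ _) T0 _ k2).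
  have [n [/= Nn h]] := @filter_ex _ U _ _ (filterI UN Uk).
  exists n; split => //; rewrite -(@ler_pXn2r _ 2) ?nnegrE ?rnorm_ge0 ?(ltW k0)//.
  by apply: le_trans h; rewrite sub0r normrN rdotxx ler_norm.
(* The next index is sought beyond the current one, so [phi] is strictly increasing and the
   subsequence stays orthonormal, while its k-th image has norm at most 2^-k. *)
pose fix phi k := if k is k'.+1 then g ((phi k').+1, k) else g (0%N, 0%N).
have phi_incr : {homo phi : i j / (i < j)%N}.
  apply: homo_ltn; first exact: ltn_trans.
  by move=> i; have [] := gP ((phi i).+1, i.+1).
have phi_inj : injective phi.
  move=> i j; apply: contra_eq; rewrite neq_ltn => /orP[] /phi_incr ij.
    by rewrite ltn_eqF.
  by rewrite gtn_eqF.
have eo : orthonormal_seq (x \o phi).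
  move=> n i j _ _ /=.
  by rewrite (xo (maxn (phi i) (phi j)).+1) ?ltnS ?leq_maxl ?leq_maxr// (inj_eq phi_inj).
have [|E [TE /negP nE]] := @annihilated_proj T _ eo.
  by case=> [|k] /=; [have [] := gP (0%N, 0%N)|have [] := gP ((phi k).+1, k.+1)].
apply: nE; rewrite -(subr0 E); apply/calkin_piP; rewrite calkin_pi0.
apply: cA; rewrite cT -calkin_piM -calkin_pi0; apply/calkin_piP.
by rewrite subr0.
Qed.

End TrivialAnnihilator.

(** * Derivatives of curves and power series *)

Section RealDerivative.
Variable R : realType.

Lemma is_derive_quotient (h : R -> R) (t l : R) :
  (s - t)^-1 * (h s - h t) @[s --> t^'] --> l -> is_derive t 1 h l.
Proof.
move=> /cvgrPdist_le hl.
suff H : (fun u => u^-1 *: ((h \o shift t) (u *: 1) - h t)) @ 0^' --> l.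
  by apply: DeriveDef; [exact: cvgP H|exact: (cvg_lim (@norm_hausdorff _ R^o) H)].
apply/cvgrPdist_le => e /hl; rewrite !near_withinE => /nbhs_ballP[d /= d0 dP].
apply/nbhs_ballP; exists d => //= u ud u0.
have := dP (u + t); rewrite /ball /= opprD addrCA subrr addr0 normrN.
move: ud; rewrite /ball /= sub0r normrN => /[swap]/[apply].
rewrite addrK -subr_eq0 addrK /shift /= /GRing.scale /= mulr1; exact.
Qed.

End RealDerivative.

Section CalkinDerivative.
Variables (R : realType) (H : hilbertType R).
Local Notation C := (calkin H).
Implicit Types (f g : R -> C) (t s : R).

Lemma cvg_calkinM (T : Type) (F : set_system T) {FF : Filter F} (f g : T -> C) (a b : C) :
  f @ F --> a -> g @ F --> b -> f x * g x @[x --> F] --> a * b.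
Proof.
move=> /cvg_rnormP fa /cvg_rnormP gb; apply/cvg_rnormP => e e0.
have a0 := rnorm_ge0 a; have b0 := rnorm_ge0 b.
have s0 : 0 < rnorm a + rnorm b + 1 by lra.
(* As d <= 1, the three error terms add up to at most d (|a| + |b| + 1) <= e. *)
pose d := Order.min 1 (e / (rnorm a + rnorm b + 1)).
have d0 : 0 < d by rewrite lt_min ltr01 divr_gt0.
have d1 : d <= 1 by rewrite ge_min lexx.
have de : d * (rnorm a + rnorm b + 1) <= e by rewrite -ler_pdivlMr// ge_min lexx orbT.
apply: filterS2 (fa d d0) (gb d d0) => x fx gx.
have -> : f x * g x - a * b = (f x - a) * (g x - b) + (f x - a) * b + a * (g x - b).
  by rewrite mulrBr subrK mulrBl mulrBr addrA subrK.
have h1 := calkin_rnormM (f x - a) (g x - b).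
have h2 := calkin_rnormM (f x - a) b; have h3 := calkin_rnormM a (g x - b).
have h4 := rnormD ((f x - a) * (g x - b) + (f x - a) * b) (a * (g x - b)).
have h5 := rnormD ((f x - a) * (g x - b)) ((f x - a) * b).
have := rnorm_ge0 (f x - a); have := rnorm_ge0 (g x - b); nra.
Qed.

Lemma cvg_star (T : Type) (F : set_system T) {FF : Filter F} (f : T -> C) (a : C) :
  f @ F --> a -> star (f x) @[x --> F] --> star a.
Proof.
move=> /cvg_rnormP fa; apply/cvg_rnormP => e /fa; apply: filterS => x.
by rewrite -starB rnorm_star.
Qed.

Definition hasderiv f t (g : C) := diff_quotient f t @ t^' --> g.

Lemma near_dnbhs_neq t : \forall s \near t^', s != t.
Proof. by rewrite near_withinE; apply: nearW. Qed.

Lemma cvg_id_dnbhs t : (fun s : R => s) @ t^' --> t.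
Proof. exact: cvg_within. Qed.

(** [F] may be [t^'] or its restriction to an interval, so one-sided derivatives at the ends of a
    smooth piece are covered too. *)
Lemma diff_quotient_cont (F : set_system R) {FF : Filter F} f t (g : C) :
  t^' `<=` F -> diff_quotient f t @ F --> g -> f @ F --> f t.
Proof.
move=> Ft fg.
have Fid : (fun s : R => s) @ F --> t.
  by move=> A At; apply: Ft; exact: (cvg_id_dnbhs At).
have st : (s - t)%:C *: (1 : C) @[s --> F] --> (0 : R)%:C *: (1 : C).
  by apply: cvg_realZ; rewrite -(subrr t); apply: cvgB => //; exact: cvg_cst.
have h : ((s - t)%:C *: (1 : C)) * diff_quotient f t s + f t @[s --> F] --> f t.
  rewrite -[X in _ --> X]add0r -[X in _ --> X + _](mul0r g) -(scale0r (1 : C)).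
  by apply: cvgD; [exact: cvg_calkinM|exact: cvg_cst].
apply: cvg_trans h; apply: near_eq_cvg.
apply: filterS (Ft _ (near_dnbhs_neq t)) => s /= st0.
rewrite -calkin_ZAl mul1r /diff_quotient scalerA -rmorphM/= mulfV ?subr_eq0//.
by rewrite scale1r subrK.
Qed.

Lemma hasderiv_cont f t (g : C) : hasderiv f t g -> f @ t --> f t.
Proof.
move=> fg; have fc : f @ t^' --> f t by exact: diff_quotient_cont fg.
move=> A At.
have h : nbhs t [set s | s != t -> A (f s)] := fc A At.
apply: filterS h => s /= h; have [->|/h//] := eqVneq s t; exact: nbhs_singleton.
Qed.

Lemma hasderiv_cst (a : C) t : hasderiv (fun=> a) t 0.
Proof.
rewrite /hasderiv /diff_quotient; under eq_fun do rewrite subrr scaler0.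
exact: cvg_cst.
Qed.

Lemma hasderivD f g t (a b : C) : hasderiv f t a -> hasderiv g t b ->
  hasderiv (fun s => f s + g s) t (a + b).
Proof.
move=> fa gb; rewrite /hasderiv; have -> : diff_quotient (fun s => f s + g s) t =
    fun s => diff_quotient f t s + diff_quotient g t s.
  by apply/funext => s; rewrite /diff_quotient -scalerDr opprD addrACA.
exact: cvgD.
Qed.

Lemma hasderivM f g t (a b : C) : hasderiv f t a -> hasderiv g t b ->
  hasderiv (fun s => f s * g s) t (a * g t + f t * b).
Proof.
move=> fa gb; rewrite /hasderiv; have -> : diff_quotient (fun s => f s * g s) t =
    fun s => diff_quotient f t s * g s + f t * diff_quotient g t s.
  apply/funext => s; rewrite /diff_quotient -calkin_ZAl -calkin_ZAr -scalerDr.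
  by rewrite mulrBl mulrBr addrA subrK.
apply: cvgD; apply: cvg_calkinM => //; last exact: cvg_cst.
exact: diff_quotient_cont gb.
Qed.

Lemma hasderivMl f t (a b : C) : hasderiv f t b -> hasderiv (fun s => a * f s) t (a * b).
Proof. by move=> fb; have := hasderivM (hasderiv_cst a t) fb; rewrite mul0r add0r. Qed.

Lemma hasderivMr f t (a b : C) : hasderiv f t b -> hasderiv (fun s => f s * a) t (b * a).
Proof. by move=> fb; have := hasderivM fb (hasderiv_cst a t); rewrite mulr0 addr0. Qed.

Lemma hasderivN f t (a : C) : hasderiv f t a -> hasderiv (fun s => - f s) t (- a).
Proof.
move=> fa; have -> : (fun s => - f s) = (fun s => (- 1) * f s).
  by apply/funext => s; rewrite mulN1r.
by rewrite -[- a]mulN1r; exact: hasderivMl.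
Qed.

Lemma hasderivB f g t (a b : C) : hasderiv f t a -> hasderiv g t b ->
  hasderiv (fun s => f s - g s) t (a - b).
Proof. by move=> fa gb; apply: hasderivD => //; exact: hasderivN. Qed.

Lemma hasderiv_realZ (h : R -> R) t (l : R) (a : C) :
  (s - t)^-1 * (h s - h t) @[s --> t^'] --> l ->
  hasderiv (fun s => (h s)%:C *: a) t (l%:C *: a).
Proof.
move=> hl; rewrite /hasderiv; have -> : diff_quotient (fun s => (h s)%:C *: a) t =
    fun s => ((s - t)^-1 * (h s - h t))%:C *: a.
  by apply/funext => s; rewrite /diff_quotient -scalerBl -rmorphB scalerA -rmorphM.
exact: cvg_realZ.
Qed.

Lemma hasderiv_id t (a : C) : hasderiv (fun s => s%:C *: a) t a.
Proof.
rewrite -[a in X in hasderiv _ _ X]scale1r; apply: hasderiv_realZ.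
apply: (@cvg_trans _ ((fun=> (1 : R)) @ t^')); last exact: cvg_cst.
by apply: near_eq_cvg; apply: filterS (near_dnbhs_neq t) => s st; rewrite mulVf ?subr_eq0.
Qed.

Lemma hasderiv_sqr t (a : C) : hasderiv (fun s => (s ^+ 2)%:C *: a) t ((2 * t)%:C *: a).
Proof.
apply: hasderiv_realZ.
apply: (@cvg_trans _ ((fun s => s + t) @ t^')).
  apply: near_eq_cvg; apply: filterS (near_dnbhs_neq t) => s st.
  by rewrite subr_sqr mulKf ?subr_eq0.
have -> : 2 * t = t + t by ring.
by apply: cvgD; [exact: cvg_id_dnbhs|exact: cvg_cst].
Qed.

Lemma gns_is_derive (B : C -> C -> R) f t (g c : C) : gns_form B -> hasderiv f t g ->
  is_derive t 1 (fun s => B (f s) c) (B g c).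
Proof.
move=> BP fg; apply: is_derive_quotient.
have -> : (fun s => (s - t)^-1 * (B (f s) c - B (f t) c)) =
    (fun s => B (diff_quotient f t s) c).
  by apply/funext => s; rewrite (gnsZ BP) (gnsB BP).
apply/cvgrPdist_le => e e0.
have c1 : 0 < rnorm c + 1 by rewrite ltr_wpDl// rnorm_ge0.
have ec : 0 < e / (rnorm c + 1) by rewrite divr_gt0.
have nh : \forall s \near t^', rnorm (diff_quotient f t s - g) <= e / (rnorm c + 1).
  exact: (iffLR (cvg_rnormP _ _) fg _ ec).
apply: filterS nh => s h.
rewrite -(gnsB BP) (le_trans (gns_norm_le BP _ _))// rnormB.
rewrite (le_trans (ler_wpM2r (rnorm_ge0 _) h))// mulrAC ler_pdivrMr//.
by rewrite ler_pM2l// lerDl.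
Qed.

(** For [B] norming c = f b - f a, the real function B (f s) c has zero derivative, so the mean
    value theorem gives |c|^2 = B c c = 0. *)
Lemma hasderiv0_const f (a b : R) : a <= b ->
  (forall t, t \in `[a, b] -> hasderiv f t 0) -> f a = f b.
Proof.
move=> ab f0; apply/eqP; rewrite eq_sym -subr_eq0; apply: contraT => c0.
set c := f b - f a in c0.
have cp : 0 < rnorm c.
  by rewrite lt_def rnorm_ge0 andbT; apply: contra c0 => /eqP/rnorm_eq0->.
have [B BP Bc] := gns_exists cp.
have d t : t \in `[a, b] -> is_derive t 1 (fun s => B (f s) c) 0.
  by move=> /f0 ft; rewrite -(gns0 BP c); exact: gns_is_derive.
have dc : {within `[a, b], continuous (fun s => B (f s) c)}.
  by apply: derivable_within_continuous => x xab; have dx := d x xab; exact: ex_derive.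
have d' x : x \in `]a, b[ -> is_derive x 1 (fun s => B (f s) c) ((fun=> 0) x).
  by move=> xab; apply: d; exact: subset_itv_oo_cc xab.
have [t _] := MVT_segment ab d' dc.
rewrite mul0r -(gnsB BP) Bc => /eqP; rewrite sqrf_eq0.
by rewrite (gt_eqF cp).
Qed.

End CalkinDerivative.

(** * Power series and their termwise differentiation *)

Section Series.
Variables (R : realType) (H : hilbertType R).
Local Notation C := (calkin H).
Implicit Types (u v : nat -> C) (l a b : C) (s t : R).

Definition sums u l := series u @ \oo --> l.

Lemma sums_unique u l l' : sums u l -> sums u l' -> l = l'.
Proof. exact: (cvg_unique (@norm_hausdorff _ C)). Qed.

Lemma eq_sums u v l : sums u l -> u =1 v -> sums v l.
Proof. by move=> ul /funext <-. Qed.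

Lemma sumsD u v l l' : sums u l -> sums v l' -> sums (fun k => u k + v k) (l + l').
Proof.
move=> ul vl; rewrite /sums.
have -> : series (fun k => u k + v k) = (fun n => series u n + series v n).
  by apply/funext => n; rewrite /series /= big_split.
exact: cvgD.
Qed.

Lemma sumsMl a u l : sums u l -> sums (fun k => a * u k) (a * l).
Proof.
move=> ul; rewrite /sums; have -> : series (fun k => a * u k) = (fun n => a * series u n).
  by apply/funext => n; rewrite /series /= mulr_sumr.
by apply: cvg_calkinM => //; exact: cvg_cst.
Qed.

Lemma sumsMr a u l : sums u l -> sums (fun k => u k * a) (l * a).
Proof.
move=> ul; rewrite /sums; have -> : series (fun k => u k * a) = (fun n => series u n * a).
  by apply/funext => n; rewrite /series /= mulr_suml.
by apply: cvg_calkinM => //; exact: cvg_cst.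
Qed.

Lemma sumsZ (c : R[i]) u l : sums u l -> sums (fun k => c *: u k) (c *: l).
Proof.
move=> ul; rewrite /sums; have -> : series (fun k => c *: u k) = (fun n => c *: series u n).
  by apply/funext => n; rewrite /series /= scaler_sumr.
exact: cvgZr.
Qed.

Lemma sumsN u l : sums u l -> sums (fun k => - u k) (- l).
Proof.
move=> ul; rewrite -mulN1r; apply: (eq_sums (@sumsMl (-1) _ _ ul)) => k.
by rewrite mulN1r.
Qed.

Lemma sums_star u l : sums u l -> sums (fun k => star (u k)) (star l).
Proof.
move=> ul; rewrite /sums; have -> : series (fun k => star (u k)) = (fun n => star (series u n)).
  apply/funext; rewrite /series /=; elim=> [|n IH]; first by rewrite !big_nil star0.
  by rewrite !big_nat_recr//= IH starD.
exact: cvg_star.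
Qed.

Lemma sums_shift u l : sums (fun k => u k.+1) l -> sums u (u 0%N + l).
Proof.
move=> ul; rewrite /sums -(cvg_shiftS (series u)) /=.
have -> : (fun n => series u n.+1) = (fun n => u 0%N + series (fun k => u k.+1) n).
  by apply/funext => n; rewrite /series /= big_nat_recl.
by apply: cvgD => //; exact: cvg_cst.
Qed.

Lemma sums0 : sums (fun=> 0) 0.
Proof.
rewrite /sums; have -> : series (fun=> 0 : C) = fun=> 0.
  by apply/funext => n; rewrite /series /= big1.
exact: cvg_cst.
Qed.

Lemma sums_norm u l (M : R) : (forall n, \sum_(0 <= k < n) rnorm (u k) <= M) ->
  sums u l -> rnorm l <= M.
Proof.
move=> uM ul; apply: (cvg_rnorm_le ul); apply: nearW => n.
by rewrite (le_trans (rnorm_sum _ _ _)).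
Qed.

Lemma sums_comm u l b : (forall k, b * u k = u k * b) -> sums u l -> b * l = l * b.
Proof.
move=> bu ul; apply: (sums_unique (@sumsMl b _ _ ul)).
by apply: (eq_sums (@sumsMr b _ _ ul)) => k; rewrite bu.
Qed.

(** The weight k^2 r^k dominates at once the terms, their derivatives and the second-order
    remainders of [pow_remainder]. *)
Definition pow_bounded (c : nat -> C) (r : R) := 1 <= r /\
  exists M : R, forall n, \sum_(0 <= k < n) k%:R ^+ 2 * r ^+ k * rnorm (c k) <= M.

Definition pterm (c : nat -> C) t k : C := (t ^+ k)%:C *: c k.
Definition dterm (c : nat -> C) t k : C := (k%:R * t ^+ k.-1)%:C *: c k.

(** The weight vanishes at k = 0, so the term of index 0 is bounded apart. *)
Lemma pow_bounded_dominated (c : nat -> C) (a : nat -> R) r : pow_bounded c r ->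
  (forall k, (0 < k)%N -> `|a k| <= k%:R ^+ 2 * r ^+ k) ->
  exists l, sums (fun k => (a k)%:C *: c k) l.
Proof.
move=> [r1 [M cM]] ac; apply: (@calkin_summable _ _ _ (`|a 0%N| * rnorm (c 0%N) + M)).
case=> [|n].
  rewrite big_nil addr_ge0 ?mulr_ge0 ?rnorm_ge0//.
  by have := cM 0%N; rewrite big_nil.
rewrite big_nat_recl// rnormZr lerD2l; apply: le_trans (cM n.+1).
rewrite big_nat_recl//= expr0n/= !mul0r add0r; apply: ler_sum => k _.
by rewrite rnormZr ler_wpM2r ?rnorm_ge0// ac.
Qed.

Lemma natr_sqr_ge1 k : (0 < k)%N -> 1 <= k%:R ^+ 2 :> R.
Proof. by move=> k0; rewrite exprn_ege1// ler1n. Qed.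

Lemma pterm_sums c r t : pow_bounded c r -> `|t| <= r -> exists l, sums (pterm c t) l.
Proof.
move=> cr tr; apply: (pow_bounded_dominated cr) => k k0; rewrite normrX.
have r0 : 0 <= r by apply: le_trans tr.
rewrite -[leLHS]mul1r ler_pM ?exprn_ge0 ?natr_sqr_ge1//.
by rewrite lerXn2r ?nnegrE.
Qed.

Lemma dterm_sums c r t : pow_bounded c r -> `|t| <= r -> exists l, sums (dterm c t) l.
Proof.
move=> cr tr; apply: (pow_bounded_dominated cr) => -[//|k] _ /=.
have r0 : 0 <= r by apply: le_trans tr.
have [r1 _] := cr; rewrite normrM normrX normr_nat.
have k1 : 1 <= k.+1%:R :> R by rewrite ler1n.
rewrite ler_pM ?exprn_ge0//; first by rewrite expr2 ler_peMl// (le_trans ler01).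
rewrite exprS -[leLHS]mul1r ler_pM ?exprn_ge0//.
by rewrite lerXn2r ?nnegrE.
Qed.

(** Second-order Taylor estimate. The remainder for k + 1 is s times the one for k, plus k t^(k-1)
    (s - t)^2, and k^2 + k <= (k + 1)^2 closes the induction. *)
Lemma pow_remainder (r s t : R) k : 1 <= r -> `|s| <= r -> `|t| <= r ->
  `|s ^+ k - t ^+ k - k%:R * t ^+ k.-1 * (s - t)| <= k%:R ^+ 2 * r ^+ k * (s - t) ^+ 2.
Proof.
move=> r1 sr tr; have r0 : 0 <= r by lra.
elim: k => [|k IH]; first by rewrite !expr0 !mul0r subr0 subrr normr0 expr0n ?mul0r.
have -> : s ^+ k.+1 - t ^+ k.+1 - k.+1%:R * t ^+ k.+1.-1 * (s - t) =
    s * (s ^+ k - t ^+ k - k%:R * t ^+ k.-1 * (s - t)) + k%:R * t ^+ k.-1 * (s - t) ^+ 2.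
  by case: k {IH} => [|k]; rewrite /= !exprS -?natr1; ring.
rewrite (le_trans (ler_normD _ _))// !normrM !normrX normr_nat -expr2 real_normK ?num_real//.
have e2 : 0 <= (s - t) ^+ 2 by exact: sqr_ge0.
have h : `|t| ^+ k.-1 <= r ^+ k.
  case: k {IH} => [|k] /=; first by rewrite !expr0.
  by rewrite exprS -[leLHS]mul1r ler_pM ?exprn_ge0// lerXn2r ?nnegrE.
set E := `|_| in IH *.
have E0 : 0 <= E by exact: normr_ge0.
have rk : 0 <= r ^+ k by exact: exprn_ge0.
have rk1 : r ^+ k <= r ^+ k.+1 by rewrite exprS ler_peMl.
have h1 : `|s| * E <= k%:R ^+ 2 * r ^+ k.+1 * (s - t) ^+ 2.
  apply: (le_trans (ler_pM (normr_ge0 s) E0 sr IH)).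
  by rewrite le_eqVlt (exprS r k); apply/orP; left; apply/eqP; ring.
have h2 : k%:R * `|t| ^+ k.-1 * (s - t) ^+ 2 <= k%:R * r ^+ k.+1 * (s - t) ^+ 2.
  by rewrite ler_wpM2r// ler_wpM2l// (le_trans h).
apply: le_trans (lerD h1 h2) _; rewrite -!mulrDl ler_wpM2r// ler_wpM2r//.
  exact: exprn_ge0.
by rewrite -natr1; have : 0 <= k%:R :> R by []; nra.
Qed.

(** Summing [pow_remainder] against the coefficients bounds the first-order error of [f] by M (s -
    t)^2. *)
Lemma powser_hasderiv c r (f : R -> C) t (g : C) : pow_bounded c r -> `|t| < r ->
  (forall s, `|s| < r -> sums (pterm c s) (f s)) -> sums (dterm c t) g ->
  hasderiv f t g.
Proof.
move=> [r1 [M cM]] tr fs dg.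
have M0 : 0 <= M by have := cM 0%N; rewrite big_nil.
have key s : `|s| < r -> rnorm (f s - f t - (s - t)%:C *: g) <= M * (s - t) ^+ 2.
  move=> sr; have := sumsD (sumsD (fs _ sr) (sumsN (fs _ tr))) (sumsN (@sumsZ (s - t)%:C _ _ dg)).
  apply: sums_norm => n; apply: le_trans (ler_wpM2r (sqr_ge0 (s - t)) (cM n)).
  rewrite mulr_suml; apply: ler_sum => k _.
  rewrite /pterm /dterm scalerA -rmorphM -!scalerBl -!rmorphB rnormZr.
  rewrite mulrAC ler_wpM2r ?rnorm_ge0// [(s - t) * _]mulrC.
  by apply: pow_remainder => //; exact: ltW.
apply/cvg_rnormP => e e0.
have d0 : 0 < Order.min (r - `|t|) (e / (M + 1)).
  by rewrite lt_min subr_gt0 tr divr_gt0// ltr_wpDl.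
rewrite near_withinE; apply/nbhs_ballP; exists (Order.min (r - `|t|) (e / (M + 1))) => //= s.
rewrite /ball /= lt_min => /andP[sr se] st.
have st0 : s - t != 0 by rewrite subr_eq0.
have -> : diff_quotient f t s - g = (s - t)^-1%:C *: (f s - f t - (s - t)%:C *: g).
  by rewrite scalerBr scalerA -rmorphM mulVf// scale1r.
have sp : 0 < `|s - t| by rewrite normr_gt0.
rewrite rnormZr normfV mulrC ler_pdivrMr//.
have sr' : `|s| < r.
  have := ler_normD (s - t) t; rewrite subrK; rewrite distrC in sr; lra.
apply: le_trans (key _ sr') _; rewrite -[(s - t) ^+ 2]real_normK ?num_real// expr2 mulrA.
rewrite ler_wpM2r ?normr_ge0//; rewrite distrC in se.
apply: le_trans (ler_wpM2l M0 (ltW se)) _; rewrite mulrCA ler_piMr ?(ltW e0)//.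
by rewrite ler_pdivrMr ?mul1r ?lerDl// ltr_wpDl.
Qed.

End Series.

(** * Exponential and inverse hyperbolic sine *)

Section Exponential.
Variables (R : realType) (H : hilbertType R).
Local Notation C := (calkin H).
Implicit Types (x y z a b : C) (s t : R).

Lemma calkin_exprZ (c : R[i]) z n : (c *: z) ^+ n = c ^+ n *: z ^+ n.
Proof.
elim: n => [|n IH]; first by rewrite !expr0 scale1r.
by rewrite !exprS IH -calkin_ZAl -calkin_ZAr scalerA.
Qed.

Definition exp_coef z k : C := (k`!%:R^-1)%:C *: z ^+ k.

Lemma exp_partial_le (x : R) n : 0 <= x -> \sum_(0 <= k < n) x ^+ k / k`!%:R <= expR x.
Proof.
move=> x0; rewrite /expR.
have h : nondecreasing_seq (series (exp_coeff x)).
  apply/nondecreasing_seqP => m; rewrite /series /= big_nat_recr//= lerDl//.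
  by rewrite /exp_coeff /= divr_ge0// exprn_ge0.
exact: (nondecreasing_cvgn_le h (is_cvg_series_exp_coeff x) n).
Qed.

Lemma natr_le_exp2 k : k%:R <= 2 ^+ k :> R.
Proof. by rewrite -natrX ler_nat ltnW// ltn_expl. Qed.

Lemma exp_pow_bounded z r : 1 <= r -> pow_bounded (exp_coef z) r.
Proof.
(* The factor 4 comes from k^2 <= 4^k. *)
move=> r1; split => //; exists (expR (4 * r * rnorm z)) => n.
have z0 := rnorm_ge0 z; have r0 : 0 <= r by lra.
apply: le_trans (exp_partial_le n _); last by rewrite !mulr_ge0.
apply: ler_sum => k _; rewrite rnormZr ger0_norm ?invr_ge0//.
have -> : (4 * r * rnorm z) ^+ k / k`!%:R = 2 ^+ k ^+ 2 * r ^+ k * (k`!%:R^-1 * rnorm z ^+ k).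
  rewrite !exprMn -exprM mulnC exprM.
  have -> : 2 ^+ 2 = 4 :> R by rewrite -natrX.
  by ring.
rewrite ler_pM ?mulr_ge0 ?exprn_ge0 ?sqr_ge0 ?invr_ge0 ?rnorm_ge0//.
  by rewrite ler_wpM2r ?exprn_ge0// lerXn2r ?nnegrE ?exprn_ge0// natr_le_exp2.
by rewrite ler_wpM2l ?invr_ge0// calkin_rnormX.
Qed.

Lemma exp_sums t z : sums (pterm (exp_coef z) t) (calkin_exp (t%:C *: z)).
Proof.
have r1 : 1 <= 1 + `|t| by rewrite lerDl.
have [|l tl] := @pterm_sums _ _ (exp_coef z) (1 + `|t|) t (exp_pow_bounded z r1).
  by rewrite lerDr.
have fE : (fun n => n`!%:R^-1 *: (t%:C *: z) ^+ n) = pterm (exp_coef z) t.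
  apply/funext => n; rewrite /pterm /exp_coef calkin_exprZ !scalerA; congr (_ *: _).
  by rewrite rmorphXn fmorphV rmorph_nat mulrC.
by rewrite /calkin_exp fE (_ : lim _ = l)//; exact: (cvg_lim (@norm_hausdorff _ _)).
Qed.

Lemma exp_sums1 z : sums (exp_coef z) (calkin_exp z).
Proof.
have := @exp_sums 1 z; rewrite scale1r => h; apply: (eq_sums h) => k.
by rewrite /pterm expr1n scale1r.
Qed.

Lemma exp_comm a z : a * z = z * a -> a * calkin_exp z = calkin_exp z * a.
Proof.
move=> az; apply: (sums_comm _ (@exp_sums1 z)) => k.
by rewrite /exp_coef -calkin_ZAr -calkin_ZAl; congr (_ *: _); exact: commrX.
Qed.

Lemma hasderiv_exp z t :
  hasderiv (fun s => calkin_exp (s%:C *: z)) t (z * calkin_exp (t%:C *: z)).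
Proof.
have r1 : 1 <= 1 + (1 + `|t|) by rewrite lerDl addr_ge0.
apply: (powser_hasderiv (exp_pow_bounded z r1)).
- by rewrite addrA ltrDr.
- by move=> s _; exact: exp_sums.
have := @sumsMl _ _ z _ _ (@exp_sums t z).
set u := fun k => _; move=> h.
have := @sums_shift _ _ (dterm (exp_coef z) t) (z * calkin_exp (t%:C *: z)).
have -> : dterm (exp_coef z) t 0 = 0 by rewrite /dterm mul0r scale0r.
rewrite add0r; apply; apply: (eq_sums h) => k.
rewrite /u /dterm /pterm /exp_coef /= -!calkin_ZAr -exprS !scalerA; congr (_ *: _).
rewrite -!rmorphM/= factS natrM invfM; congr (_%:C).
by rewrite mulrACA [_%:R * _]mulrC mulVf ?pnatr_eq0// mul1r mulrC.
Qed.

Lemma exp0 : calkin_exp (0 : C) = 1.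
Proof.
apply: (sums_unique (@exp_sums1 0)).
have -> : (1 : C) = exp_coef 0 0%N + 0 by rewrite /exp_coef fact0 invr1 scale1r expr0 addr0.
apply: sums_shift; apply: (eq_sums (@sums0 R H)) => k.
by rewrite /exp_coef exprS mul0r scaler0.
Qed.

Lemma exp_at0 z : calkin_exp ((0 : R)%:C *: z) = 1.
Proof. by rewrite scale0r exp0. Qed.

Lemma expN z : calkin_exp z * calkin_exp (- z) = 1.
Proof.
pose f t := calkin_exp (t%:C *: z) * calkin_exp (t%:C *: (- z)).
have f0 : f 0 = 1 by rewrite /f !exp_at0 mulr1.
have f1 : f 1 = calkin_exp z * calkin_exp (- z) by rewrite /f !scale1r.
rewrite -f1 -f0; apply/esym/(@hasderiv0_const _ _ _ 0 1) => // t _.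
have := hasderivM (@hasderiv_exp z t) (@hasderiv_exp (- z) t); congr hasderiv.
rewrite !mulNr mulrN (exp_comm (a := z)); last by rewrite -calkin_ZAl -calkin_ZAr.
by rewrite mulrA addrN.
Qed.

Lemma expNl z : calkin_exp (- z) * calkin_exp z = 1.
Proof. by rewrite -{2}(opprK z) expN. Qed.

Lemma expD x y : x * y = y * x -> calkin_exp (x + y) = calkin_exp x * calkin_exp y.
Proof.
move=> xy.
pose f t := calkin_exp (t%:C *: (x + y)) * calkin_exp (t%:C *: (- y)) * calkin_exp (t%:C *: (- x)).
have f0 : f 0 = 1 by rewrite /f !exp_at0 !mulr1.
have f1 : f 1 = calkin_exp (x + y) * calkin_exp (- y) * calkin_exp (- x).
  by rewrite /f !scale1r.
suff h : f 0 = f 1.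
  have : f 1 * (calkin_exp x * calkin_exp y) = calkin_exp x * calkin_exp y.
    by rewrite -h f0 mul1r.
  by rewrite f1 -!mulrA (mulrA _ (calkin_exp x)) expNl mul1r expNl mulr1.
apply: (@hasderiv0_const _ _ _ 0 1) => // t _.
have := hasderivM
  (hasderivM (@hasderiv_exp (x + y) t) (@hasderiv_exp (- y) t)) (@hasderiv_exp (- x) t).
congr hasderiv.
set E := calkin_exp _; set F := calkin_exp _; set G := calkin_exp _.
have xE : x * E = E * x.
  by apply: exp_comm; rewrite -calkin_ZAr -calkin_ZAl mulrDr mulrDl xy.
have yE : y * E = E * y.
  by apply: exp_comm; rewrite -calkin_ZAr -calkin_ZAl mulrDr mulrDl xy.
have xF : x * F = F * x.
  by apply: exp_comm; rewrite -calkin_ZAr -calkin_ZAl mulrN mulNr xy.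
rewrite [(x + y) * E]mulrDl xE yE mulrDl !mulNr !mulrN -!(mulrA E) addrK xF.
by rewrite -!mulrA subrr.
Qed.

Lemma exp_star z : star (calkin_exp z) = calkin_exp (star z).
Proof.
apply: (sums_unique (sums_star (@exp_sums1 z))); apply: (eq_sums (@exp_sums1 (star z))) => k.
by rewrite /exp_coef starZr starX.
Qed.

Lemma exp_skew_star z : star z = - z -> star (calkin_exp z) = calkin_exp (- z).
Proof. by move=> sz; rewrite exp_star sz. Qed.

Lemma rnorm_exp_skew z : star z = - z -> rnorm (calkin_exp z) <= 1.
Proof.
move=> sz; rewrite -(@ler_pXn2r _ 2) ?nnegrE ?rnorm_ge0// expr1n -rnorm_starM.
by rewrite exp_skew_star// expNl calkin_rnorm1.
Qed.

Lemma exp_anticomm a z : a * z = - (z * a) -> a * calkin_exp z = calkin_exp (- z) * a.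
Proof.
move=> az; apply: (sums_unique (@sumsMl _ _ a _ _ (@exp_sums1 z))).
apply: (eq_sums (@sumsMr _ _ a _ _ (@exp_sums1 (- z)))) => k.
rewrite /exp_coef -calkin_ZAr -calkin_ZAl; congr (_ *: _).
elim: k => [|k IH]; first by rewrite !expr0 mulr1 mul1r.
by rewrite !exprS -mulrA IH !mulrA az mulNr.
Qed.

Lemma exp_remainder x : rnorm x <= 1 -> rnorm (calkin_exp x - 1 - x) <= rnorm x ^+ 2.
Proof.
move=> x1; have x0 := rnorm_ge0 x.
have [l xl] : exists l, sums (fun k => exp_coef x k.+2) l.
  apply: (@calkin_summable _ _ _ (expR (rnorm x))) => n.
  apply: le_trans (exp_partial_le n.+2 x0).
  rewrite !big_nat_recl//= addrA ler_wpDl ?addr_ge0 ?divr_ge0 ?exprn_ge0//.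
  apply: ler_sum => k _; rewrite rnormZr ger0_norm ?invr_ge0// mulrC ler_wpM2r ?invr_ge0//.
  exact: calkin_rnormX.
have -> : calkin_exp x - 1 - x = l.
  have := sums_unique (@exp_sums1 x) (sums_shift (sums_shift xl)) => ->.
  rewrite /exp_coef fact0 factS fact0 muln1 invr1 !scale1r expr0 expr1.
  by rewrite [1 + _]addrC addrK addrAC subrr add0r.
apply: (sums_norm _ xl) => n.
(* Uses |x|^k <= 1 and (k + 2)! >= 2^(k + 1). *)
apply: (@le_trans _ _ (\sum_(0 <= k < n) rnorm x ^+ 2 * 2^-1 ^+ k.+1)).
  apply: ler_sum => k _; rewrite rnormZr ger0_norm ?invr_ge0// mulrC.
  rewrite ler_pM ?rnorm_ge0 ?invr_ge0//.
    apply: le_trans (calkin_rnormX _ _) _; rewrite -addn2 exprD ler_piMl ?exprn_ge0//.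
    by rewrite exprn_ile1.
  rewrite exprVn lef_pV2 ?posrE ?exprn_gt0 ?ltr0n ?fact_gt0// -natrX ler_nat.
  elim: k => // k IH; rewrite expnS factS leq_mul//.
rewrite -mulr_sumr ler_piMr ?exprn_ge0//.
have -> : \sum_(0 <= k < n) 2^-1 ^+ k.+1 = 1 - 2^-1 ^+ n :> R.
  elim: n => [|n IH]; first by rewrite big_nil expr0 subrr.
  by rewrite big_nat_recr//= IH exprS; field.
by rewrite lerBlDr lerDl exprn_ge0.
Qed.

(** By commutation e^(z s) = e^(z t) e^(z s - z t), and by [exp_remainder] the second factor is 1 +
    (z s - z t) up to second order. *)
Lemma hasderiv_exp_comp (z : R -> C) t (z' : C) : (forall s, z s * z t = z t * z s) ->
  hasderiv z t z' -> hasderiv (fun s => calkin_exp (z s)) t (calkin_exp (z t) * z').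
Proof.
move=> zC dz.
have hE s : calkin_exp (z s) = calkin_exp (z t) * calkin_exp (z s - z t).
  have cm : z t * (z s - z t) = (z s - z t) * z t by rewrite mulrBr mulrBl (zC s).
  by rewrite -(expD cm) addrC subrK.
rewrite /hasderiv; have -> : diff_quotient (fun s => calkin_exp (z s)) t =
    fun s => calkin_exp (z t) * (diff_quotient z t s +
      (s - t)^-1%:C *: (calkin_exp (z s - z t) - 1 - (z s - z t))).
  apply/funext => s; rewrite /diff_quotient -scalerDr.
  rewrite [z s - z t + _]addrC subrK -calkin_ZAr mulrBr mulr1 -hE.
  by [].
apply: cvg_calkinM; first exact: cvg_cst.
rewrite -[z' in X in _ --> X]addr0; apply: cvgD => //.
apply/cvg_rnormP => e e0.
have z'0 := rnorm_ge0 z'.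
pose M := rnorm z' + 1; have M0 : 0 < M by rewrite /M; lra.
have M2 : 0 < M ^+ 2 by rewrite exprn_gt0.
have n1 : \forall s \near t^', rnorm (diff_quotient z t s - z') <= 1.
  exact: (iffLR (cvg_rnormP _ _) dz).
have n2 : \forall s \near t^', rnorm (z s - z t) <= 1.
  exact: (iffLR (cvg_rnormP _ _) (diff_quotient_cont _ dz)).
have n3 : \forall s \near t^', `|t - s| <= e / M ^+ 2.
  by apply: (iffLR (cvgrPdist_le _ _) (@cvg_id_dnbhs _ t)); rewrite divr_gt0.
near=> s.
have st : s != t by near: s; exact: near_dnbhs_neq.
have sp : 0 < `|s - t| by rewrite normr_gt0 subr_eq0.
have h1 : rnorm (diff_quotient z t s - z') <= 1 by near: s.
have h2 : rnorm (z s - z t) <= 1 by near: s.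
have h3 : `|t - s| <= e / M ^+ 2 by near: s.
have dM : rnorm (diff_quotient z t s) <= M.
  by have := rnormD (diff_quotient z t s - z') z'; rewrite subrK /M; lra.
have zd : rnorm (z s - z t) <= M * `|s - t|.
  by move: dM; rewrite /diff_quotient rnormZr normfV mulrC ler_pdivrMr.
rewrite subr0 rnormZr normfV mulrC ler_pdivrMr//.
apply: le_trans (exp_remainder h2) _.
apply: (@le_trans _ _ ((M * `|s - t|) ^+ 2)).
  by rewrite lerXn2r ?nnegrE ?rnorm_ge0// mulr_ge0// ltW.
have -> : (M * `|s - t|) ^+ 2 = `|s - t| * M ^+ 2 * `|s - t| by ring.
by rewrite ler_wpM2r// -ler_pdivlMr// distrC.
Unshelve. all: by end_near.
Qed.

End Exponential.

(** * The power series of the inverse hyperbolic sine *)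

Section ArcsinhCoefficients.
Variable R : realType.

(* The coefficients of 1 / sqrt (1 + x^2). *)
Fixpoint rsqrt_coef (n : nat) : R :=
  match n with
  | 0 => 1
  | 1 => 0
  | (m.+1 as k).+1 => - (k%:R / k.+1%:R) * rsqrt_coef m
  end.

Definition asinh_coef (n : nat) : R :=
  if n is m.+1 then rsqrt_coef m / m.+1%:R else 0.

(** The equation (1 + x^2) y' = - x y read on coefficients. *)
Lemma rsqrt_coefSS n : n.+2%:R * rsqrt_coef n.+2 = - (n.+1%:R * rsqrt_coef n).
Proof. by rewrite /=; field; rewrite -natrD pnatr_eq0. Qed.

Lemma rsqrt_coef_le1 n : `|rsqrt_coef n| <= 1.
Proof.
elim/ltn_ind: n => -[|[|n]] IH; rewrite ?normr1 ?normr0//.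
rewrite [rsqrt_coef _]/(- (n.+1%:R / n.+2%:R) * rsqrt_coef n) normrM normrN.
rewrite mulr_ile1 ?normr_ge0 ?IH// ger0_norm ?divr_ge0// ler_pdivrMr// mul1r.
by rewrite ler_nat.
Qed.

Lemma asinh_coef_le1 n : `|asinh_coef n| <= 1.
Proof.
case: n => [|n]; rewrite /= ?normr0// normrM normfV normr_nat ler_pdivrMr// mul1r.
by rewrite (le_trans (rsqrt_coef_le1 n))// ler1n.
Qed.

Lemma asinh_coef_even n : ~~ odd n -> asinh_coef n = 0.
Proof.
case: n => //= n; rewrite negbK => on.
suff -> : rsqrt_coef n = 0 by rewrite mul0r.
elim/ltn_ind: n on => -[|[|n]] //= IH; rewrite negbK => on.
by rewrite (IH n)// mulr0.
Qed.

Lemma rsqrt_coef_odd n : odd n -> rsqrt_coef n = 0.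
Proof.
elim/ltn_ind: n => -[|[|n]] //= IH; rewrite negbK => on.
by rewrite (IH n)// mulr0.
Qed.

Lemma geometric_le (x : R) n : 0 <= x -> x < 1 -> \sum_(i < n) x ^+ i <= (1 - x)^-1.
Proof.
move=> x0 x1; have x1' : 0 < 1 - x by rewrite subr_gt0.
rewrite -(ler_pM2l x1') mulfV ?gt_eqF//.
have -> : (1 - x) * \sum_(i < n) x ^+ i = 1 - x ^+ n.
  by rewrite -[1 - x ^+ n]opprB subrX1 -mulNr opprB.
by rewrite lerBlDr lerDl exprn_ge0.
Qed.

(** Written as k copies of x^k, the left side is at most the sum of the x^i for i < k. *)
Lemma mulrn_exp_le (x : R) k : 0 <= x -> x < 1 -> k%:R * x ^+ k <= (1 - x)^-1.
Proof.
move=> x0 x1; apply: le_trans (geometric_le k x0 x1).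
have -> : k%:R * x ^+ k = \sum_(i < k) x ^+ k by rewrite sumr_const card_ord mulr_natl.
by apply: ler_sum => i _; apply: (ler_wiXn2l x0 (ltW x1)); exact: ltnW.
Qed.

Lemma sqr_geometric_le (x : R) : 0 <= x -> x < 1 -> exists r M : R, 1 < r /\
  forall n, \sum_(0 <= k < n) k%:R ^+ 2 * r ^+ k * x ^+ k <= M.
Proof.
(* These values satisfy r x <= y^3: two of the factors y^k absorb k^2, and the third is summed. *)
move=> x0 x1; pose y := 1 - (1 - x) / 4; pose r := 1 + (1 - x) / 4.
have y0 : 0 <= y by rewrite /y; lra.
have y1 : y < 1 by rewrite /y; lra.
have r1 : 1 < r by rewrite /r; lra.
have rxy : r * x <= y ^+ 3.
  rewrite /r /y; have : 0 <= (1 - x) ^+ 2 by exact: sqr_ge0.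
  have : 0 <= (1 - x) by lra.
  nra.
exists r, ((1 - y)^-1 ^+ 3); split => // n.
have L0 : 0 <= (1 - y)^-1 by rewrite invr_ge0; lra.
apply: (@le_trans _ _ (\sum_(0 <= k < n) (1 - y)^-1 ^+ 2 * y ^+ k)).
  apply: ler_sum => k _; rewrite -mulrA -exprMn.
  have h : (r * x) ^+ k <= (y ^+ 3) ^+ k.
    by rewrite lerXn2r ?nnegrE ?exprn_ge0// mulr_ge0//; lra.
  apply: le_trans (ler_wpM2l (sqr_ge0 _) h) _.
  have -> : k%:R ^+ 2 * y ^+ 3 ^+ k = (k%:R * y ^+ k) ^+ 2 * y ^+ k.
    by rewrite -exprM mulnC exprM; ring.
  rewrite ler_wpM2r ?exprn_ge0// lerXn2r ?nnegrE ?mulr_ge0 ?exprn_ge0//.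
  exact: mulrn_exp_le.
rewrite -mulr_sumr [leRHS]exprSr ler_wpM2l ?exprn_ge0// big_mkord.
exact: geometric_le.
Qed.

End ArcsinhCoefficients.

Section Arcsinh.
Variables (R : realType) (H : hilbertType R).
Local Notation C := (calkin H).
Local Notation rc := (@rsqrt_coef R).
Local Notation ac := (@asinh_coef R).
Implicit Types (x y z a b : C) (s t : R).

Lemma geometric_pow_bounded (y : C) : rnorm y < 1 -> exists2 r, 1 < r &
  forall c : nat -> R, (forall k, `|c k| <= 1) ->
    pow_bounded (fun k => (c k)%:C *: y ^+ k) r.
Proof.
move=> y1; have [r [M [r1 rM]]] := sqr_geometric_le (rnorm_ge0 y) y1.
exists r => // c c1; split; first exact: ltW.
exists M => n; apply: le_trans (rM n); apply: ler_sum => k _.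
have r0 : 0 <= r by lra.
rewrite ler_wpM2l ?mulr_ge0 ?sqr_ge0 ?exprn_ge0// rnormZr.
rewrite -[leRHS]mul1r ler_pM ?rnorm_ge0//; exact: calkin_rnormX.
Qed.

Lemma pow_sums_comm (c : nat -> R) y l b : b * y = y * b ->
  sums (fun k => (c k)%:C *: y ^+ k) l -> b * l = l * b.
Proof.
move=> bY; apply: sums_comm => k; rewrite -calkin_ZAr -calkin_ZAl.
by congr (_ *: _); exact: commrX.
Qed.

Lemma pow_fun_exists (c : nat -> R) y r : pow_bounded (fun k => (c k)%:C *: y ^+ k) r ->
  exists f : R -> C, (forall s, `|s| < r -> sums (pterm (fun k => (c k)%:C *: y ^+ k) s) (f s)) /\
    (forall s b, b * y = y * b -> b * f s = f s * b).
Proof.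
move=> cr.
have /choice[f fP] : forall s : R, exists l : C,
    (`|s| < r -> sums (pterm (fun k => (c k)%:C *: y ^+ k) s) l) /\
    (forall b, b * y = y * b -> b * l = l * b).
  (* Outside the radius the value 0 is chosen, which commutes with everything. *)
  move=> s; have [sr|sr] := ltP (`|s|) r; last by exists 0; split => // b _; rewrite mulr0 mul0r.
  have [l lP] := pterm_sums cr (ltW sr); exists l; split => // b bY.
  apply: (sums_comm _ lP) => k; rewrite /pterm -!calkin_ZAr -!calkin_ZAl.
  by do 2 congr (_ *: _); exact: commrX.
by exists f; split => s; case: (fP s).
Qed.

(* With R(t) = (1 + t^2 y^2)^(-1/2) and A(t) = arcsinh (t y) given by their
   power series, exp (- A(t)) ((1 + t^2 y^2) R(t) + t y) has derivative 0. *)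
Lemma exp_arcsinh y : rnorm y < 1 -> exists Q z : C,
  [/\ sums (fun k => (rc k)%:C *: y ^+ k) Q,
      sums (fun k => (ac k)%:C *: y ^+ k) z,
      Q * (Q * (1 + y * y)) = 1 &
      calkin_exp z = (1 + y * y) * Q + y].
Proof.
move=> y1; have [r r1 cr] := geometric_pow_bounded y1.
have rcB := cr _ (@rsqrt_coef_le1 R); have acB := cr _ (@asinh_coef_le1 R).
have [Q [Qs Qc]] := pow_fun_exists rcB; have [A [As Ac]] := pow_fun_exists acB.
have /choice[Q' Q'P] t : exists l, `|t| <= r -> sums (dterm (fun k => (rc k)%:C *: y ^+ k) t) l.
  have [tr|tr] := leP (`|t|) r; last by exists 0.
  by have [l lP] := dterm_sums rcB tr; exists l.
have ir t : t \in `[0 : R, 1] -> `|t| < r.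
  by rewrite in_itv /= => /andP[t0 t1]; rewrite ger0_norm//; lra.
have yQ t : y * Q t = Q t * y by exact: Qc.
pose Y := y * y.
have YQ t : Y * Q t = Q t * Y by apply: Qc; rewrite /Y mulrA.
have dQ t : `|t| < r -> hasderiv Q t (Q' t).
  by move=> tr; apply: (powser_hasderiv rcB tr Qs); apply: Q'P; exact: ltW.
(* A' = y Q holds coefficientwise, since [asinh_coef] is the termwise primitive of [rsqrt_coef]. *)
have dA t : `|t| < r -> hasderiv A t (y * Q t).
  move=> tr; apply: (powser_hasderiv acB tr As).
  have h := @sumsMl _ _ y _ _ (Qs _ tr).
  have := @sums_shift _ _ (dterm (fun k => (ac k)%:C *: y ^+ k) t) (y * Q t).
  have -> : dterm (fun k => (ac k)%:C *: y ^+ k) t 0 = 0 by rewrite /dterm mul0r scale0r.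
  rewrite add0r; apply; apply: (eq_sums h) => k.
  rewrite /dterm /pterm -!calkin_ZAr -exprS !scalerA -!rmorphM /=; congr (_%:C *: _).
  have : k.+1%:R != 0 :> R by rewrite pnatr_eq0.
  by move: (k.+1%:R : R) => K K0; field.
have QQ' t : `|t| < r -> Q t * Q' t = Q' t * Q t.
  move=> tr; apply: (sums_comm _ (Q'P _ (ltW tr))) => k.
  rewrite /dterm -!calkin_ZAr -!calkin_ZAl.
  by do 2 congr (_ *: _); apply/esym/esym/commrX; rewrite /GRing.comm -yQ.
(* This is [rsqrt_coefSS] summed up. The terms of Q' of index 0 and 1 vanish, so the index shift by
   2 leaves no boundary term. *)
have ode t : `|t| < r -> (1 + (t ^+ 2)%:C *: Y) * Q' t = - (t%:C *: Y * Q t).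
  move=> tr; have us := Q'P _ (ltW tr); set u := dterm _ _ in us.
  have vs := @sumsMl _ _ ((t ^+ 2)%:C *: Y) _ _ us.
  have ws := @sumsMl _ _ (t%:C *: Y) _ _ (Qs _ tr).
  have h : sums (fun k => u k.+2)
      (- ((t ^+ 2)%:C *: Y * Q' t + t%:C *: Y * Q t)).
    apply: (eq_sums (sumsN (sumsD vs ws))) => k.
    rewrite /u /dterm /pterm -!calkin_ZAl -!calkin_ZAr /Y -!mulrA -!exprS !scalerA.
    rewrite -!rmorphM /= -scalerDl -scaleNr -rmorphD -rmorphN /=; congr (_%:C *: _).
    rewrite -[- (k.+1%:R / k.+2%:R) * rc k]/(rc k.+2) [RHS]mulrAC rsqrt_coefSS -natr1.
    by case: k => [|k] /=; rewrite ?expr0 ?expr1 ?exprS; ring.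
  have := sums_unique us (sums_shift (u := u) (sums_shift (u := fun k => u k.+1) h)).
  have -> : u 0%N = 0 by rewrite /u /dterm mul0r scale0r.
  have -> : u 1%N = 0 by rewrite /u /dterm /= scale0r scaler0.
  rewrite !add0r => Q'E; rewrite mulrDl mul1r {1}Q'E opprD addrAC addNr add0r.
  by [].
have dP t : hasderiv (fun s => 1 + (s ^+ 2)%:C *: Y) t (t%:C *: Y + t%:C *: Y).
  have := hasderivD (@hasderiv_cst _ _ 1 t) (@hasderiv_sqr _ _ t Y).
  by rewrite add0r mulrC mulr_natr mulr2n rmorphD scalerDl.
pose P t : C := 1 + (t ^+ 2)%:C *: Y.
have PQ t s : P s * Q t = Q t * P s.
  by rewrite /P mulrDl mulrDr mul1r mulr1 -calkin_ZAl -calkin_ZAr YQ.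
have PQ' t : `|t| < r -> P t * Q' t = Q' t * P t.
  move=> tr; apply: (sums_comm _ (Q'P _ (ltW tr))) => k.
  have yP : y * P t = P t * y.
    by rewrite /P mulrDl mulrDr mul1r mulr1 -calkin_ZAl -calkin_ZAr /Y mulrA.
  rewrite /dterm -!calkin_ZAr -!calkin_ZAl.
  by do 2 congr (_ *: _); apply: commrX; rewrite /GRing.comm yP.
have TQ t : t%:C *: Y * Q t = Q t * (t%:C *: Y).
  by rewrite -calkin_ZAl -calkin_ZAr YQ.
have Q0 : Q 0 = 1.
  have r0 : `|0 : R| < r by rewrite normr0; lra.
  apply: (sums_unique (Qs _ r0)).
  have -> : (1 : C) = pterm (fun k => (rc k)%:C *: y ^+ k) 0 0%N + 0.
    by rewrite /pterm !expr0 !scale1r addr0.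
  apply: sums_shift; apply: (eq_sums (@sums0 R H)) => k.
  by rewrite /pterm exprS mul0r scale0r.
(* The derivative of Q^2 P is 2 Q (P Q' + t Y Q), which is 0 by [ode]. *)
have V t : 0 <= t -> t <= 1 -> Q t * (Q t * P t) = 1.
  move=> t0 t1.
  have -> : (1 : C) = Q 0 * (Q 0 * P 0).
    by rewrite Q0 !mul1r /P expr0n scale0r addr0.
  apply/esym/(@hasderiv0_const _ _ (fun s => Q s * (Q s * P s)) 0 t t0) => s.
  rewrite in_itv /= => /andP[s0 st].
  have sr : `|s| < r by rewrite ger0_norm//; lra.
  have := hasderivM (dQ _ sr) (hasderivM (dQ _ sr) (dP s)); congr hasderiv.
  rewrite -/(P s).
  have e1 : Q' s * (Q s * P s) = Q s * (Q' s * P s) by rewrite mulrA -QQ' // mulrA.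
  have e2 : Q s * (s%:C *: Y + s%:C *: Y) = s%:C *: Y * Q s + s%:C *: Y * Q s.
    by rewrite mulrDr TQ.
  by rewrite e1 -PQ' // ode // -mulrDr e2 addrA -opprD addNr mulr0.
exists (Q 1), (A 1).
have i1 : `|1 : R| < r by rewrite normr1.
have p1 (c : nat -> C) : pterm c 1 =1 c by move=> k; rewrite /pterm expr1n scale1r.
have P1 : P 1 = 1 + y * y by rewrite /P expr1n scale1r.
split.
- exact: (eq_sums (Qs _ i1) (p1 _)).
- exact: (eq_sums (As _ i1) (p1 _)).
- by rewrite -P1 V.
pose E t := P t * Q t + t%:C *: y.
pose f t := calkin_exp (- A t) * E t.
have A0 : A 0 = 0.
  have r0 : `|0 : R| < r by rewrite normr0; lra.
  apply: (sums_unique (As _ r0)).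
  have -> : (0 : C) = pterm (fun k => (ac k)%:C *: y ^+ k) 0 0%N + 0.
    by rewrite /pterm !expr0 /= scale0r scaler0 addr0.
  apply: sums_shift; apply: (eq_sums (@sums0 R H)) => k.
  by rewrite /pterm exprS mul0r scale0r.
have f01 : f 0 = f 1.
  apply: (@hasderiv0_const _ _ _ 0 1) => // t t01.
  have tr := ir _ t01.
  have [t0 t1] : 0 <= t /\ t <= 1 by move: t01; rewrite in_itv /= => /andP.
  have AA s : - A s * - A t = - A t * - A s.
    by rewrite !mulrNN; apply: (Ac); rewrite -(Ac s y).
  have := hasderivM (hasderiv_exp_comp AA (hasderivN (dA _ tr)))
    (hasderivD (hasderivM (dP t) (dQ _ tr)) (@hasderiv_id _ _ t y)).
  congr hasderiv; rewrite -/(P t) -/(E t) -mulrA -mulrDr.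
  rewrite ode // mulrDl -addrA [_ + (- _ + y)]addrA addrK.
  (* That is, A' E = E', because Q P Q = 1; hence e^(- A) E is constant. *)
  have e1 : y * Q t * E t = t%:C *: Y * Q t + y.
    rewrite /E mulrDr -mulrA PQ V // mulr1 addrC; congr (_ + _).
    by rewrite -mulrA -calkin_ZAr -yQ -calkin_ZAr mulrA calkin_ZAl.
  by rewrite mulNr e1 addNr mulr0.
have f0 : f 0 = 1.
  by rewrite /f /E A0 oppr0 exp0 Q0 /P expr0n !scale0r !addr0 !mulr1.
have E1 : E 1 = (1 + y * y) * Q 1 + y by rewrite /E P1 scale1r.
by rewrite -E1 -[E 1]mul1r -(expN (A 1)) -mulrA -/(f 1) -f01 f0 mulr1.
Qed.

End Arcsinh.

(** * Bounding the arcsinh series by the arcsine *)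

Lemma asin0 (R : realType) : asin (0 : R) = 0.
Proof.
have h : (0 : R) \in `[- (pi / 2), pi / 2].
  by rewrite in_itv /= oppr_le0 andbb divr_ge0// pi_ge0.
by have := sinK h; rewrite sin0.
Qed.

Section ArcsineBound.
Variable R : realType.
Local Notation ac := (@asinh_coef R).
Local Notation rc := (@rsqrt_coef R).

Lemma is_derive_poly (c : nat -> R) n (t : R) :
  is_derive t 1 (fun s => \sum_(0 <= k < n) c k * s ^+ k)
    (\sum_(0 <= k < n) c k * (k%:R * t ^+ k.-1)).
Proof.
elim: n => [|n IH].
  rewrite big_nil (_ : (fun s => _) = cst 0); first exact: is_derive_cst.
  by apply/funext => s; rewrite big_nil.
rewrite (_ : (fun s => _) =
    (fun s => \sum_(0 <= k < n) c k * s ^+ k) + (c n \*: (id ^+ n : R -> R))).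
  rewrite big_nat_recr//=; apply: is_deriveD; apply: is_deriveZ.
  by rewrite -[n%:R * _]mulr1; exact: (is_deriveX n (is_derive_id t 1)).
apply/funext => s; rewrite big_nat_recr//= !fctE; reflexivity.
Qed.

Lemma MVT_mono (f f' : R -> R) (s : R) : 0 <= s ->
  (forall t, 0 <= t -> t <= s -> is_derive t 1 f (f' t)) ->
  (forall t, 0 <= t -> t <= s -> 0 <= f' t) -> f 0 <= f s.
Proof.
move=> s0 df f0.
have dfc : {within `[0, s], continuous f}.
  apply: derivable_within_continuous => t; rewrite in_itv /= => /andP[t0 ts].
  by have dt := df t t0 ts; exact: ex_derive.
have df' t : t \in `]0, s[ -> is_derive t 1 f (f' t).
  by rewrite in_itv /= => /andP[t0 ts]; apply: df; exact: ltW.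
have [t] := MVT_segment s0 df' dfc; rewrite in_itv /= => /andP[t0 ts] e.
by rewrite -subr_ge0 e subr0 mulr_ge0// f0.
Qed.

(** The coefficients of (1 - t^2)^(-1/2): those of (1 + t^2)^(-1/2) without their signs. *)
Let a k : R := `|rc k|.

Let aSS k : k.+2%:R * a k.+2 = k.+1%:R * a k.
Proof.
have : `|k.+2%:R * rc k.+2| = `|- (k.+1%:R * rc k)| by rewrite rsqrt_coefSS.
by rewrite normrN (normrM k.+2%:R) (normrM k.+1%:R) !normr_nat.
Qed.

Let Q n (t : R) := \sum_(0 <= k < n) a k * t ^+ k.
Let dQ n (t : R) := \sum_(0 <= k < n) a k * (k%:R * t ^+ k.-1).

Let Q_ge0 n t : 0 <= t -> 0 <= Q n t.
Proof. by move=> t0; apply: sumr_ge0 => k _; rewrite mulr_ge0 ?normr_ge0 ?exprn_ge0. Qed.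

(* Q n is a partial sum of the series of (1 - t^2)^(-1/2), which solves
   (1 - t^2) y' = t y; the truncation error is nonpositive. *)
Let Q_ode n t : (1 - t ^+ 2) * dQ n.+2 t - t * Q n.+2 t =
  - (n.+2%:R * a n.+1 * t ^+ n.+2) - (n.+1%:R * a n * t ^+ n.+1).
Proof.
elim: n => [|n IH].
  rewrite /dQ /Q !big_nat_recr//= !big_nil /a /= normr1 normr0 !expr0 expr1; ring.
rewrite [dQ _ _]big_nat_recr// [Q _ _]big_nat_recr//=.
rewrite -/(dQ n.+2 t) -/(Q n.+2 t).
have -> : (1 - t ^+ 2) * (dQ n.+2 t + a n.+2 * (n.+2%:R * t ^+ n.+1)) -
    t * (Q n.+2 t + a n.+2 * t ^+ n.+2) =
    ((1 - t ^+ 2) * dQ n.+2 t - t * Q n.+2 t) + (n.+2%:R * a n.+2) * t ^+ n.+1 -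
    (n.+3%:R * a n.+2) * t ^+ n.+3.
  by rewrite -[n.+3%:R]natr1 !exprS; ring.
rewrite IH [n.+2%:R * a n.+2]aSS; ring.
Qed.

Let Q_ode_le0 n t : 0 <= t -> (1 - t ^+ 2) * dQ n t - t * Q n t <= 0.
Proof.
move=> t0; case: n => [|[|n]].
- by rewrite /dQ /Q !big_nil !mulr0 subrr.
- rewrite /dQ /Q !big_nat1 /a /= normr1 mul0r !mulr0 expr0 mulr1; lra.
- have a_ge0 k : 0 <= a k by exact: normr_ge0.
  rewrite Q_ode -opprD oppr_le0.
  by apply: addr_ge0; apply: mulr_ge0; try exact: exprn_ge0; apply: mulr_ge0; try exact: a_ge0.
Qed.

(** The derivative of Q^2 (1 - t^2) is 2 Q ((1 - t^2) Q' - t Q) <= 0, and the value at 0 is at most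
    1. *)
Let Q_sqr_le n t : 0 <= t -> t < 1 -> Q n t ^+ 2 * (1 - t ^+ 2) <= 1.
Proof.
move=> t0 t1.
have Q0 : Q n 0 ^+ 2 <= 1.
  case: n => [|n]; first by rewrite /Q big_nil expr0n.
  rewrite /Q big_nat_recl// big1 ?addr0 /a /= ?normr1 ?expr0 ?mulr1 ?expr1n// => k _.
  by rewrite exprS mul0r mulr0.
pose f s := - (Q n s ^+ 2 * (1 - s ^+ 2)).
have f0 : - 1 <= f 0 by rewrite /f [X in 1 - X]expr0n subr0 mulr1 lerN2.
suff : f 0 <= f t by rewrite /f; move: f0; rewrite /f; lra.
apply: (@MVT_mono f (fun s => - (2 * Q n s * ((1 - s ^+ 2) * dQ n s - s * Q n s)))) => //.
  move=> s _ _; pose g1 := (fun s => Q n s); have d1 := @is_derive_poly a n s.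
  have -> : f = - ((Q n ^+ 2) * (cst 1 - (id ^+ 2 : R -> R))).
    by apply/funext => x; rewrite /f !fctE.
  have := is_deriveN (is_deriveM (is_deriveX 2 d1)
    (is_deriveB (is_derive_cst (1 : R) s 1) (is_deriveX 2 (is_derive_id s 1)))).
  move=> /is_derive_eq; apply; rewrite /= !fctE /GRing.scale /= -/(dQ n s) -/(Q n s).
  by rewrite !expr1; ring.
move=> s s0 st; have := Q_ode_le0 n s0; have := Q_ge0 n s0; nra.
Qed.

(** Partial sums are compared with asin through their derivatives: the one of order m + 1 has
    derivative [Q m], which [Q_sqr_le] keeps below (1 - t^2)^(-1/2). *)
Lemma asinh_partial_le n (s : R) : 0 <= s -> s < 1 ->
  \sum_(0 <= k < n) `|ac k| * s ^+ k <= asin s.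
Proof.
move=> s0 s1.
suff h m : \sum_(0 <= k < m.+1) `|ac k| * s ^+ k <= asin s.
  case: n => [|n]; last exact: h.
  by rewrite big_nil; apply: le_trans (h 0%N); rewrite big_nat1 /= normr0 mul0r.
pose f t := asin t - \sum_(0 <= k < m.+1) `|ac k| * t ^+ k.
have f0 : f 0 = 0.
  rewrite /f asin0 sub0r big_nat_recl//= normr0 mul0r add0r big1 ?oppr0// => k _.
  by rewrite exprS mul0r mulr0.
suff : f 0 <= f s by rewrite f0 /f subr_ge0.
have lt1 t : t <= s -> t < 1 by move=> ts; exact: le_lt_trans s1.
apply: (@MVT_mono f (fun t => (Num.sqrt (1 - t ^+ 2))^-1 - Q m t)) => //.
  move=> t t0 /lt1 t1.
  have d1 := @is_derive_poly (fun k => `|ac k|) m.+1 t.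
  have ti : -1 < t < 1 by rewrite t1 andbT (lt_le_trans _ t0)// ltrN10.
  have := is_deriveB (is_derive1_asin ti) d1.
  move=> /is_derive_eq; apply; congr (_ - _).
  rewrite big_nat_recl//= !mul0r mulr0 add0r; apply: eq_bigr => k _.
  rewrite normrM normfV normr_nat mulrA divfK// pnatr_eq0//.
move=> t t0 /lt1 t1; rewrite subr_ge0.
have t2 : 0 < 1 - t ^+ 2 by rewrite subr_gt0 expr_lt1.
have sq : 0 < Num.sqrt (1 - t ^+ 2) by rewrite sqrtr_gt0.
rewrite -[leRHS]mul1r ler_pdivlMr//.
rewrite -(@ler_pXn2r _ 2) ?nnegrE ?mulr_ge0 ?Q_ge0 ?sqrtr_ge0//.
by rewrite exprMn sqr_sqrtr ?expr1n ?Q_sqr_le// ltW.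
Qed.

End ArcsineBound.

Section ArcsinhNorm.
Variables (R : realType) (H : hilbertType R).
Local Notation C := (calkin H).

Lemma rnorm_arcsinh (y z : C) : rnorm y < 1 ->
  sums (fun k => (@asinh_coef R k)%:C *: y ^+ k) z -> rnorm z <= asin (rnorm y).
Proof.
move=> y1; apply: sums_norm => n.
apply: le_trans (asinh_partial_le n (rnorm_ge0 y) y1).
by apply: ler_sum => k _; rewrite rnormZr ler_wpM2l ?normr_ge0// calkin_rnormX.
Qed.

End ArcsinhNorm.

(** * Lengths of curves of projections *)

Section IntegralPieces.
Variable R : realType.
Local Notation mu := (@lebesgue_measure R).

(** The pieces are open because the velocity is controlled only away from the breakpoints; these
    form a null set and are put back in the conclusion. *)
Lemma integral_pieces (v F : R -> R) (s : nat -> R) n :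
  (forall t, 0 <= v t) ->
  (forall i, (i < n)%N -> [/\ s i < s i.+1, measurable_fun `]s i, s i.+1[ v &
    ((F (s i.+1) - F (s i))%:E <= \int[mu]_(t in `]s i, s i.+1[) (v t)%:E)%E]) ->
  [/\ s 0%N <= s n, measurable_fun `[s 0%N, s n] v &
    ((F (s n) - F (s 0%N))%:E <= \int[mu]_(t in `[s 0%N, s n]) (v t)%:E)%E].
Proof.
move=> v0; elim: n => [|n IH] sP.
  split => //; first by rewrite set_itv1; exact: measurable_fun_set1.
  by rewrite subrr; apply: integral_ge0 => t _; rewrite lee_fin.
have [s0n mn Fn] := IH (fun i ni => sP i (ltnW ni)).
have [sn mn1 Fn1] := sP n (ltnSn n).
have mn2 : measurable_fun `]s n, s n.+1] v by exact: measurable_fun_itv_oc mn1.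
have UE : `[s 0%N, s n.+1]%classic = `[s 0%N, s n] `|` `]s n, s n.+1].
  by apply: itv_bndbnd_setU; rewrite bnd_simp// ltW.
have mU : measurable_fun `[s 0%N, s n.+1] v by rewrite UE; apply/measurable_funU.
split => //; first exact: le_trans s0n (ltW sn).
rewrite UE ge0_integral_setU//=.
- rewrite -(integral_itv_bndo_bndc (r := s n.+1)); last exact/measurable_EFinP.
  apply: le_trans (leeD Fn Fn1); rewrite -EFinD lee_fin; lra.
- by rewrite -UE; exact/measurable_EFinP.
- by move=> t _; rewrite lee_fin.
- apply/disj_setPS => t [/=]; rewrite !in_itv /= => /andP[_ h1] /andP[h2 _].
  by have := lt_le_trans h2 h1; rewrite ltxx.
Qed.

End IntegralPieces.

Section ArcLength.
Variables (R : realType) (H : hilbertType R).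
Local Notation C := (calkin H).
Local Notation mu := (@lebesgue_measure R).

Lemma cvg_gns (B : C -> C -> R) (T : Type) (F : set_system T) {FF : Filter F}
    (f g : T -> C) (a b : C) :
  gns_form B -> f @ F --> a -> g @ F --> b -> B (f x) (g x) @[x --> F] --> B a b.
Proof.
move=> BP /cvg_rnormP fa /cvg_rnormP gb; apply/cvgrPdist_le => e e0.
have a0 := rnorm_ge0 a; have b0 := rnorm_ge0 b.
have s0 : 0 < rnorm a + rnorm b + 1 by lra.
pose d := Order.min 1 (e / (rnorm a + rnorm b + 1)).
have d0 : 0 < d by rewrite lt_min ltr01 divr_gt0.
have d1 : d <= 1 by rewrite ge_min lexx.
have de : d * (rnorm a + rnorm b + 1) <= e by rewrite -ler_pdivlMr// ge_min lexx orbT.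
apply: filterS2 (fa d d0) (gb d d0) => x fx gx; rewrite distrC.
have -> : B (f x) (g x) - B a b = B (f x - a) (g x - b) + B (f x - a) b + B a (g x - b).
  by rewrite !(gnsB BP) !(gnsBr BP); ring.
have h1 := gns_norm_le BP (f x - a) (g x - b).
have h2 := gns_norm_le BP (f x - a) b; have h3 := gns_norm_le BP a (g x - b).
apply: le_trans (ler_normD _ _) _; apply: le_trans (lerD (ler_normD _ _) (lexx _)) _.
have := rnorm_ge0 (f x - a); have := rnorm_ge0 (g x - b); nra.
Qed.

Lemma gns_unit (B : C -> C -> R) (u : C) : gns_form B -> star u = u -> u * u = 1 -> B u u = 1.
Proof. by move=> BP us uu; rewrite -{1}[u]mulr1 (gns_star BP) us uu gns1. Qed.

Lemma within_dnbhs_cont (s s' : R) (f : R -> C) t (g : C) :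
  diff_quotient f t @ within `[s, s'] t^' --> g -> f @ within `[s, s'] (nbhs t) --> f t.
Proof.
move=> fg.
have fc : f @ within `[s, s'] t^' --> f t.
  by apply: diff_quotient_cont fg => A; exact: cvg_within.
move=> A At; have h : within `[s, s'] t^' (f @^-1` A) := fc A At.
change (nbhs t (fun x => `[s, s']%classic x -> A (f x))).
have h' : nbhs t (fun x => x != t -> `[s, s']%classic x -> A (f x)) := h.
apply: filterS h' => x /= hx; have [->|xt] := eqVneq x t; last exact: hx.
by move=> _; exact: nbhs_singleton.
Qed.

Lemma within_dnbhs_interior (s s' t : R) (f : R -> C) (l : C) : t \in `]s, s'[ ->
  f @ within `[s, s'] t^' --> l -> f @ t^' --> l.
Proof.
move=> tss fl A /fl h.
have h' : nbhs t (fun x => x != t -> `[s, s']%classic x -> A (f x)) := h.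
have ti : nbhs t `]s, s'[%classic by exact: near_in_itvoo.
apply: filterS2 h' ti => x /= hx xs xt; apply: hx => //=.
exact: subset_itv_oo_cc xs.
Qed.

(* The factor k < 1 keeps k * B (u t) e away from the points -1 and 1, where acos
   is not differentiable; k tends to 1 in acos_arc. *)
Section Piece.
Variables (B : C -> C -> R) (e : C) (k s s' : R) (u u' : R -> C).
Hypotheses (BP : gns_form B) (Be : B e e = 1) (k0 : 0 <= k) (k1 : k < 1) (ss' : s < s').
Hypothesis u_unit : forall t, t \in `[s, s'] -> B (u t) (u t) = 1.
Hypothesis u_cont : forall t, t \in `[s, s'] -> u @ within `[s, s'] (nbhs t) --> u t.
Hypothesis u'_cont : forall t, t \in `[s, s'] -> u' @ within `[s, s'] (nbhs t) --> u' t.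
Hypothesis u_deriv : forall t, t \in `]s, s'[ -> hasderiv u t (u' t).

Let h t := B (u t) e.

Let h_le1 t : t \in `[s, s'] -> h t ^+ 2 <= 1.
Proof. by move=> ts; have := gns_CS BP (u t) e; rewrite u_unit// Be mulr1. Qed.

(** Between unit vectors B (u x - u t) (u x + u t) = 0; divide by x - t and let x tend to t. *)
Let u_orth t : t \in `]s, s'[ -> B (u' t) (u t) = 0.
Proof.
move=> ts; have ts' : t \in `[s, s'] by exact: subset_itv_oo_cc ts.
have du := u_deriv ts.
have c1 : B (diff_quotient u t x) (u x + u t) @[x --> t^'] --> B (u' t) (u t + u t).
  apply: cvg_gns => //; apply: cvgD; last exact: cvg_cst.
  exact: diff_quotient_cont du.
have c2 : B (diff_quotient u t x) (u x + u t) @[x --> t^'] --> (0 : R).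
  apply: (@cvg_trans _ ((fun=> (0 : R)) @ t^')); last exact: cvg_cst.
  have ti : nbhs t `]s, s'[%classic by exact: near_in_itvoo.
  apply: near_eq_cvg; apply: cvg_within; apply: filterS ti => x xs.
  have xs' : x \in `[s, s'] by exact: subset_itv_oo_cc xs.
  rewrite /diff_quotient; move: (u_unit xs') (u_unit ts'); move: (u x) (u t) => X T eX eT.
  rewrite (gnsZ BP) (gnsB BP) !(gnsDr BP) eX eT (gnsC BP T).
  by rewrite [1 + _]addrC subrr mulr0.
have : B (u' t) (u t + u t) = 0 by exact: (cvg_unique (@norm_hausdorff _ R^o) c1 c2).
by rewrite (gnsDr BP); lra.
Qed.

Let F t := acos (k * h t).
Let f t := - (k * B (u' t) e) / Num.sqrt (1 - (k * h t) ^+ 2).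

Let kh_lt1 t : t \in `[s, s'] -> -1 < k * h t < 1.
Proof.
move=> /h_le1 h1; rewrite -ltr_norml -(@ltr_pXn2r _ 2) ?nnegrE// expr1n.
rewrite real_normK ?num_real// exprMn; have : k ^+ 2 < 1 by rewrite expr_lt1.
have := sqr_ge0 (h t); have := sqr_ge0 k; nra.
Qed.

Let sqrt_pos t : t \in `[s, s'] -> 0 < Num.sqrt (1 - (k * h t) ^+ 2).
Proof.
move=> /kh_lt1; rewrite -ltr_norml => kh; rewrite sqrtr_gt0 subr_gt0.
by rewrite -real_normK ?num_real// expr_lt1.
Qed.

Let F_deriv t : t \in `]s, s'[ -> is_derive t 1 F (f t).
Proof.
move=> ts; have ts' : t \in `[s, s'] by exact: subset_itv_oo_cc ts.
have dh := gns_is_derive e BP (u_deriv ts).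
have dkh : is_derive t 1 (k \*: h) (k *: B (u' t) e) by exact: is_deriveZ.
have da := is_derive1_acos (kh_lt1 ts').
have := @is_derive1_comp _ acos (k \*: h) t _ _ da dkh.
move=> /is_derive_eq; apply; rewrite /f /GRing.scale /=.
by rewrite mulrC mulrN mulNr.
Qed.

(** As u' is orthogonal to u, B u' e = B u' (e - h u), where e - h u has square norm 1 - h^2;
    Cauchy-Schwarz and k^2 (1 - h^2) <= 1 - k^2 h^2 conclude. *)
Let f_le t : t \in `]s, s'[ -> f t <= rnorm (u' t).
Proof.
move=> ts; have ts' : t \in `[s, s'] by exact: subset_itv_oo_cc ts.
rewrite /f ler_pdivrMr ?sqrt_pos//; apply: le_trans (ler_norm _) _.
rewrite -(@ler_pXn2r _ 2) ?nnegrE ?mulr_ge0 ?rnorm_ge0 ?sqrtr_ge0//.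
rewrite real_normK ?num_real// sqrrN exprMn [leRHS]exprMn.
have khs : 0 <= 1 - (k * h t) ^+ 2 by have := sqrt_pos ts'; rewrite sqrtr_gt0 => /ltW.
rewrite sqr_sqrtr//.
have orth := u_orth ts; have uu := u_unit ts'.
have h2 : h t ^+ 2 <= 1 := h_le1 ts'.
have CS : B (u' t) e ^+ 2 <= rnorm (u' t) ^+ 2 * (1 - h t ^+ 2).
  have -> : B (u' t) e = B (u' t) (e - (h t)%:C *: u t).
    by rewrite (gnsBr BP) (gnsZr BP) orth mulr0 subr0.
  apply: le_trans (gns_CS BP _ _) _.
  have -> : B (e - (h t)%:C *: u t) (e - (h t)%:C *: u t) = 1 - h t ^+ 2.
    rewrite (gnsB BP) !(gnsBr BP) !(gnsZ BP) !(gnsZr BP) Be uu (gnsC BP e) -/(h t); ring.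
  by rewrite ler_wpM2r ?subr_ge0// (gns_le BP).
have kk : 0 <= k ^+ 2 by exact: sqr_ge0.
have k2 : k ^+ 2 <= 1 by rewrite expr_le1// ltW.
apply: le_trans (ler_wpM2l kk CS) _; rewrite mulrCA ler_wpM2l ?sqr_ge0// exprMn.
nra.
Qed.

Let nu'_cont : {within `[s, s'], continuous (fun t => rnorm (u' t))}.
Proof.
apply/subspace_continuousP => t /= ts; apply: rnorm_cvg; exact: u'_cont.
Qed.

Let kh_cont t : t \in `[s, s'] -> k * h x @[x --> within `[s, s'] (nbhs t)] --> k * h t.
Proof.
move=> ts; apply: cvgM; first exact: cvg_cst.
by apply: cvg_gns => //; [exact: u_cont|exact: cvg_cst].
Qed.

Let F_cont : {within `[s, s'], continuous F}.
Proof.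
apply/subspace_continuousP => t /= ts.
exact: (cvg_comp _ _ (kh_cont ts) (continuous_acos (kh_lt1 ts))).
Qed.

Let f_cont : {within `[s, s'], continuous f}.
Proof.
apply/subspace_continuousP => t /= ts; apply: cvgM.
  apply: cvgN; apply: cvgM; first exact: cvg_cst.
  by apply: cvg_gns => //; [exact: u'_cont|exact: cvg_cst].
apply: cvgV; first by rewrite gt_eqF// sqrt_pos.
have c : 1 - (k * h x) ^+ 2 @[x --> within `[s, s'] (nbhs t)] --> 1 - (k * h t) ^+ 2.
  apply: cvgB; [exact: cvg_cst|exact: (cvgM (kh_cont ts) (kh_cont ts))].
exact: (cvg_comp _ _ c (@sqrt_continuous R (1 - (k * h t) ^+ 2))).
Qed.

Lemma arc_piece : measurable_fun `]s, s'[ (fun t => rnorm (u' t)) /\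
  ((F s' - F s)%:E <= \int[mu]_(t in `]s, s'[) (rnorm (u' t))%:E)%E.
Proof.
have sub : `]s, s'[%classic `<=` `[s, s']%classic by exact: subset_itv_oo_cc.
have mg : measurable_fun `]s, s'[ (fun t => rnorm (u' t)).
  apply: (measurable_funS _ sub) => //.
  by apply: subspace_continuous_measurable_fun => //; exact: nu'_cont.
have mf : measurable_fun `]s, s'[ f.
  apply: (measurable_funS _ sub) => //.
  by apply: subspace_continuous_measurable_fun => //; exact: f_cont.
split => //.
have cc (w : R -> R) : measurable_fun `]s, s'[ w ->
    (\int[mu]_(t in `]s, s'[) (w t)%:E = \int[mu]_(t in `[s, s']) (w t)%:E)%E.
  move=> mw; rewrite integral_itv_bndo_bndc; last exact/measurable_EFinP.
  rewrite integral_itv_obnd_cbnd//; apply/measurable_EFinP.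
  exact: measurable_fun_itv_oc mw.
have ftc : (\int[mu]_(t in `[s, s']) (f t)%:E = (F s')%:E - (F s)%:E)%E.
  apply: (@continuous_FTC2 R f F s s' ss' f_cont).
    split.
    - by move=> t ts; have dt := F_deriv ts; exact: ex_derive.
    - by have /(continuous_within_itvP _ ss')[] := F_cont.
    - by have /(continuous_within_itvP _ ss')[] := F_cont.
  move=> t ts; have dt := F_deriv ts; rewrite derive1E; exact: derive_val.
rewrite EFinB -ftc -cc//; apply: le_integral => //.
- apply: (@integrableS _ _ _ mu `[s, s']) => //.
  by apply: continuous_compact_integrable; [exact: segment_compact|exact: f_cont].
- apply: (@integrableS _ _ _ mu `[s, s']) => //.
  by apply: continuous_compact_integrable; [exact: segment_compact|exact: nu'_cont].
- by move=> t; rewrite inE /= => ts; rewrite lee_fin f_le.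
Qed.

End Piece.
End ArcLength.

(** The passage k -> 1 is made with one value: if L < phi = acos h, take k = cos a with a a third of
    the gap. Then k h <= cos (phi - a) < cos (L + a), so acos (k h) > L + a = L + acos k. *)
Lemma acos_arc (R : realType) (h L : R) : -1 <= h <= 1 -> 0 <= L ->
  (forall k, 0 <= k -> k < 1 -> acos (k * h) - acos k <= L) -> L < pi -> cos L <= h.
Proof.
move=> h1 L0 hk Lpi; rewrite leNgt; apply/negP => hL.
pose phi := acos h; have ph : cos phi = h by rewrite acosK// in_itv.
have phi0 : 0 <= phi by exact: acos_ge0.
have phipi : phi <= pi by exact: acos_lepi.
have Lphi : L < phi.
  by rewrite -[_ < _]ltr_cos ?in_itv /= ?L0 ?phi0 ?ph// ltW.
have pi0 := pi_gt0 R.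
pose a := (phi - L) / 3.
have a0 : 0 < a by rewrite /a; lra.
have aph : cos (L + a) > cos (phi - a).
  by rewrite ltr_cos ?in_itv /= /a; lra.
have kc : 0 <= cos a by apply: cos_ge0_pihalf; rewrite /a; lra.
have k1 : cos a < 1.
  by rewrite -(cos0 R) ltr_cos ?in_itv /= /a; lra.
have := hk _ kc k1; rewrite cosK; last by rewrite in_itv /= /a; lra.
have kh1 : -1 <= cos a * h <= 1.
  rewrite -ler_norml normrM mulr_ile1 ?normr_ge0 ?ler_norml//.
  by rewrite cos_geN1 cos_le1.
rewrite leNgt => /negP; apply; rewrite ltrBrDr.
rewrite -[_ < _]ltr_cos ?in_itv /= ?acos_ge0 ?acos_lepi//; last by rewrite /a; lra.
rewrite acosK ?in_itv//; apply: le_lt_trans aph.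
rewrite cosB ph mulrC lerDl mulr_ge0// sin_ge0_pi ?phi0//.
by rewrite /a; lra.
Qed.

Section Lengths.
Variables (R : realType) (H : hilbertType R).
Local Notation C := (calkin H).
Local Notation mu := (@lebesgue_measure R).

Lemma rnorm_mulr2n (x : C) : rnorm (x *+ 2) = 2 * rnorm x.
Proof.
have -> : x *+ 2 = (2 : R)%:C *: x by rewrite rmorph_nat scaler_nat.
by rewrite rnormZr ger0_norm.
Qed.

Lemma proj_symmetry (p : C) : p \in projections H ->
  star (p *+ 2 - 1) = p *+ 2 - 1 /\ (p *+ 2 - 1) * (p *+ 2 - 1) = 1.
Proof.
rewrite inE => -[ps pp]; split; first by rewrite starB mulr2n starD star1 ps.
by rewrite mulrBl mulrBr mulr1 mul1r mulrnAl mulrnAr pp [_ *+ 2 *+ 2]mulr2n addrK opprB addrC subrK.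
Qed.

Lemma gns_subxx (B : C -> C -> R) (x y : C) : gns_form B ->
  B (x - y) (x - y) = B x x + B y y - 2 * B x y.
Proof. by move=> BP; rewrite (gnsB BP) !(gnsBr BP) (gnsC BP y x); ring. Qed.

(** The factor 2 is the speed of 2 gamma - 1 relative to gamma. On each piece the smooth extension
    [g 0] replaces gamma, and [g 1] is the velocity in the interior. *)
Lemma piecewise_smooth_arc (B : C -> C -> R) (e : C) (k a b : R) (gamma : R -> C) :
  gns_form B -> B e e = 1 -> 0 <= k -> k < 1 ->
  piecewise_smooth a b gamma -> (forall t, t \in `[a, b] -> gamma t \in projections H) ->
  ((acos (k * B (gamma b *+ 2 - 1) e) - acos (k * B (gamma a *+ 2 - 1) e))%:E <=
   2%:E * curve_length a b gamma)%E.
Proof.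
move=> BP Be k0 k1 [n [s [s0 sn sP]]] gP.
have smono i j : (i <= j)%N -> (j <= n)%N -> s i <= s j.
  elim: j => [|j IH]; first by rewrite leqn0 => /eqP ->.
  rewrite leq_eqVlt => /orP[/eqP -> //|ij jn].
  by rewrite (le_trans (IH ij (ltnW jn)))// ltW//; case: (sP j jn).
pose v t := 2 * rnorm (velocity gamma t).
pose F t := acos (k * B (gamma t *+ 2 - 1) e).
have v0 t : 0 <= v t by rewrite mulr_ge0 ?rnorm_ge0.
have piece i : (i < n)%N -> [/\ s i < s i.+1, measurable_fun `]s i, s i.+1[ v &
    ((F (s i.+1) - F (s i))%:E <= \int[mu]_(t in `]s i, s i.+1[) (v t)%:E)%E].
  move=> ni; have [si [g [g0 gS]]] := sP i ni.
  have sub t : t \in `[s i, s i.+1] -> t \in `[a, b].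
    rewrite !in_itv /= -s0 -sn => /andP[h1 h2].
    rewrite (le_trans (smono 0%N i (leq0n i) (ltnW ni)) h1).
    exact: le_trans h2 (smono _ _ ni (leqnn n)).
  have oc t : t \in `]s i, s i.+1[ -> t \in `[s i, s i.+1] by exact: subset_itv_oo_cc.
  have gc m t : t \in `[s i, s i.+1] -> g m @ within `[s i, s i.+1] (nbhs t) --> g m t.
    by move=> ts; apply: within_dnbhs_cont (gS m t ts).
  have gd t : t \in `]s i, s i.+1[ -> hasderiv (g 0%N) t (g 1%N t).
    by move=> ts; apply: (within_dnbhs_interior ts); apply: gS; exact: oc.
  have vE t : t \in `]s i, s i.+1[ -> velocity gamma t = g 1%N t.
    move=> ts; apply: (cvg_lim (@norm_hausdorff _ _)).
    have gt := gd t ts; apply: cvg_trans gt.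
    have ti : nbhs t `]s i, s i.+1[%classic by exact: near_in_itvoo.
    apply: near_eq_cvg; apply: cvg_within; apply: filterS ti => x xs.
    by rewrite /diff_quotient !g0//; exact: oc.
  have [||||mg Fg] := @arc_piece R H B e k (s i) (s i.+1) (fun t => g 0%N t *+ 2 - 1)
      (fun t => g 1%N t *+ 2) BP Be k0 k1 si.
  - move=> t ts; rewrite g0//.
    by have [us uu] := proj_symmetry (gP t (sub t ts)); exact: gns_unit.
  - move=> t ts; apply: cvgB; last exact: cvg_cst.
    by apply: cvgMn; exact: gc.
  - by move=> t ts; apply: cvgMn; exact: gc.
  - move=> t ts; have := hasderivB (hasderivD (gd t ts) (gd t ts)) (@hasderiv_cst _ _ 1 t).
    by rewrite subr0.
  split => //.
    by apply: eq_measurable_fun mg => t; rewrite inE /= => ts; rewrite rnorm_mulr2n /v vE.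
  have ends : s i \in `[s i, s i.+1] /\ s i.+1 \in `[s i, s i.+1].
    by rewrite !in_itv /= !lexx (ltW si).
  case: ends => e1 e2; rewrite /F -!g0//; apply: le_trans Fg _.
  rewrite le_eqVlt; apply/orP; left; apply/eqP; apply: eq_integral => t.
  by rewrite inE /= => ts; rewrite rnorm_mulr2n /v vE.
have [_ mv Fv] := @integral_pieces R v F s n v0 piece.
rewrite s0 sn in mv Fv; apply: le_trans Fv _.
rewrite /curve_length -ge0_integralZl_EFin//.
- by move=> t _; rewrite lee_fin rnorm_ge0.
- apply/measurable_realfun.measurable_EFinP.
  have -> : (fun t => rnorm (velocity gamma t)) = (fun t => 2^-1 * v t).
    by apply/funext => t; rewrite /v mulKf.
  by apply: measurable_realfun.measurable_funM => //; exact: measurable_cst.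
Qed.

(** For [B] norming the difference of the endpoints, the end symmetries are unit vectors with B (f -
    e) (f - e) = 4 d^2, so B f e = 1 - 2 d^2 = cos (2 asin d). *)
Lemma curve_length_ge (a b : R) (gamma : R -> C) : a < b ->
  piecewise_smooth a b gamma -> (forall t, t \in `[a, b] -> gamma t \in projections H) ->
  rnorm (gamma b - gamma a) < 1 ->
  ((asin (rnorm (gamma b - gamma a)))%:E <= curve_length a b gamma)%E.
Proof.
move=> ab gs gP; set c := gamma b - gamma a; set d := rnorm c => d1.
have d0 : 0 <= d := rnorm_ge0 c.
have L0 : (0 <= curve_length a b gamma)%E.
  by apply: integral_ge0 => t _; rewrite lee_fin rnorm_ge0.
have d11 : -1 <= d <= 1 by lra.
have dsin : sin (asin d) = d by rewrite asinK// in_itv.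
have pi0 := pi_gt0 R.
have th1 : asin d < pi / 2 by apply: asin_ltpi2; lra.
have [dz|dz] := eqVneq d 0.
  by rewrite dz asin0.
have dp : 0 < d by rewrite lt_def dz.
have th0 : 0 < asin d.
  rewrite ltNge; apply/negP => th.
  have : 0 <= sin (- asin d).
    by apply: sin_ge0_pi; have := @asin_geNpi2 R d d11; lra.
  by rewrite sinN dsin; lra.
case EL : (curve_length a b gamma) L0 => [L| |] // L0; last by rewrite leey.
rewrite lee_fin in L0; rewrite lee_fin.
(* In the remaining case 2 L < 2 asin d < pi, the range in which [acos_arc] applies and cos is
   decreasing. *)
have [//|Ld] := leP (asin d) L.
have ga : gamma a \in projections H by apply: gP; rewrite in_itv /= lexx ltW.
have gb : gamma b \in projections H by apply: gP; rewrite in_itv /= lexx ltW.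
have [as1 aa] := proj_symmetry ga; have [bs1 bb] := proj_symmetry gb.
have [B BP Bc] := gns_exists dp.
set e := gamma a *+ 2 - 1 in as1 aa; set f := gamma b *+ 2 - 1 in bs1 bb.
have Be := gns_unit BP as1 aa; have Bf := gns_unit BP bs1 bb.
have fe : f - e = (2 : R)%:C *: c.
  by rewrite /f /e /c opprB addrA subrK -mulrnBl rmorph_nat scaler_nat.
have e1 : B (f - e) (f - e) = 4 * d ^+ 2.
  by rewrite fe (gnsZ BP) (gnsZr BP) Bc mulrA; congr (_ * _); ring.
have e2 := gns_subxx f e BP; rewrite Be Bf e1 in e2.
have hk k : 0 <= k -> k < 1 -> acos (k * B f e) - acos k <= 2 * L.
  move=> k0 k1; have := piecewise_smooth_arc BP Be k0 k1 gs gP.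
  by rewrite -/e -/f Be mulr1 EL -EFinM lee_fin.
move: (B f e) hk e2 => X hk e2.
clear - d0 d1 d11 dsin pi0 th1 th0 L0 Ld hk e2; clearbody d.
have hE : X = 1 - 2 * d ^+ 2 by lra.
have h1 : -1 <= X <= 1.
  have d2 : d ^+ 2 <= 1 by rewrite expr_le1// ltW.
  by have := sqr_ge0 d; rewrite hE; lra.
have : cos (2 * L) <= X.
  by apply: acos_arc => //; [rewrite mulr_ge0|lra].
have -> : X = cos (2 * asin d).
  rewrite mulrC mulr_natr mulr2n cosD -!expr2 cos2sin2 dsin hE; ring.
rewrite leNgt => /negP; case; rewrite ltr_cos ?in_itv /=; lra.
Qed.

(** The curve e^(tx) of unit vectors has length at most |x| < pi, so it cannot reach the antipode of
    1: for the norming form, |e^x - 1|^2 = 2 - 2 B (e^x) 1 <= 2 - 2 cos |x| < 4. *)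
Lemma rnorm_exp_sub1 (x : C) : star x = - x -> rnorm x < pi ->
  rnorm (calkin_exp x - 1) < 2.
Proof.
move=> xs xpi; have [c0|c0] := eqVneq (rnorm (calkin_exp x - 1)) 0; first by rewrite c0.
have cp : 0 < rnorm (calkin_exp x - 1) by rewrite lt_def c0 rnorm_ge0.
have [B BP Bc] := gns_exists cp.
pose u t := calkin_exp (t%:C *: x).
pose u' t := x * calkin_exp (t%:C *: x).
have skew t : star (t%:C *: x) = - (t%:C *: x) by rewrite starZr xs scalerN.
have uu t : B (u t) (u t) = 1.
  rewrite -{1}[u t]mulr1 (gns_star BP) /u exp_skew_star// expNl.
  exact: gns1.
have ud t : hasderiv u t (u' t) by exact: hasderiv_exp.
have uc t : u @ t --> u t by exact: hasderiv_cont (ud t).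
have u'c t : u' @ t --> u' t by apply: cvg_calkinM; [exact: cvg_cst|exact: uc].
have u'x t : rnorm (u' t) <= rnorm x.
  rewrite (le_trans (calkin_rnormM _ _))// ler_piMr ?rnorm_ge0//.
  exact: rnorm_exp_skew.
have h1 : -1 <= B (u 1) 1 <= 1.
  rewrite -ler_norml -(@ler_pXn2r _ 2) ?nnegrE// real_normK ?num_real//.
  by have := gns_CS BP (u 1) 1; rewrite uu gns1// mulr1 expr1n.
have : cos (rnorm x) <= B (u 1) 1.
  apply: acos_arc => //; first exact: rnorm_ge0.
  move=> k k0 k1.
  have [||||mu' Fu] := @arc_piece R H B 1 k 0 1 u u' BP (gns1 BP) k0 k1 ltr01.
  - by [].
  - by move=> t _; apply: cvg_within_filter; exact: uc.
  - by move=> t _; apply: cvg_within_filter; exact: u'c.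
  - by [].
  have u0 : u 0 = 1 by exact: exp_at0.
  rewrite u0 gns1// mulr1 in Fu.
  rewrite -lee_fin; apply: le_trans Fu _.
  apply: (@le_trans _ _ (\int[mu]_(t in `]0%R, 1%R[) (cst (rnorm x)%:E t))%E).
    apply: ge0_le_integral => //=.
    - by move=> t _; rewrite lee_fin rnorm_ge0.
    - exact/measurable_realfun.measurable_EFinP.
    - by move=> t _; rewrite lee_fin.
  rewrite integral_cst//= lebesgue_measure_itv /= lte_fin ltr01 oppr0 adde0 mule1.
  by [].
have cpi : -1 < cos (rnorm x).
  by rewrite -(cospi R) ltr_cos ?in_itv /= ?rnorm_ge0 ?pi_ge0 ?lexx ?ltW.
move=> hc; have : rnorm (calkin_exp x - 1) ^+ 2 < 2 ^+ 2.
  have u1 : u 1 = calkin_exp x by rewrite /u scale1r.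
  rewrite -Bc -u1 gns_subxx// uu gns1//; lra.
by rewrite ltr_pXn2r ?nnegrE ?rnorm_ge0.
Qed.

End Lengths.

(** * Geodesics between projections *)

Section EvenOddSeries.
Variables (R : realType) (H : hilbertType R).
Local Notation C := (calkin H).
Local Notation rc := (@rsqrt_coef R).
Local Notation ac := (@asinh_coef R).

Lemma exprn_even (x : C) k : ~~ odd k -> x ^+ k = (x * x) ^+ k./2.
Proof. by move=> ke; rewrite -expr2 -exprM mul2n even_halfK. Qed.

(** The odd coefficients vanish, so the sum depends on the square only. Hence i d and y, which both
    have square - d^2, give the same element. *)
Lemma rsqrt_series_even (x y : C) k : x * x = y * y ->
  (rc k)%:C *: x ^+ k = (rc k)%:C *: y ^+ k.
Proof.
move=> xy; have [ko|ke] := boolP (odd k); first by rewrite rsqrt_coef_odd// !scale0r.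
by rewrite (exprn_even x ke) (exprn_even y ke) xy.
Qed.

(** Commuting with the square is enough, by evenness; c and e commute with d^2 although c
    anticommutes with d. *)
Lemma rsqrt_series_comm (x l b : C) : sums (fun k => (rc k)%:C *: x ^+ k) l ->
  b * (x * x) = x * x * b -> b * l = l * b.
Proof.
move=> xl bx; apply: (sums_comm _ xl) => k; rewrite -calkin_ZAr -calkin_ZAl.
have [ko|ke] := boolP (odd k); first by rewrite rsqrt_coef_odd// !scale0r.
by congr (_ *: _); rewrite (exprn_even x ke); exact: commrX.
Qed.

Lemma rsqrt_series_star (x l : C) : star x = - x ->
  sums (fun k => (rc k)%:C *: x ^+ k) l -> star l = l.
Proof.
move=> xs xl; apply: (sums_unique (sums_star xl)); apply: (eq_sums xl) => k.
by rewrite starZr starX xs; apply: rsqrt_series_even; rewrite mulrNN.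
Qed.

Lemma asinh_series_star (x l : C) : star x = - x ->
  sums (fun k => (ac k)%:C *: x ^+ k) l -> star l = - l.
Proof.
move=> xs xl; apply: (sums_unique (sums_star xl)); apply: (eq_sums (sumsN xl)) => k.
rewrite starZr starX xs; have [ko|ke] := boolP (odd k).
  by rewrite -scalerN exprNn -signr_odd ko expr1 mulN1r.
by rewrite asinh_coef_even// !scale0r oppr0.
Qed.

Lemma asinh_series_anticomm (x l b : C) : b * x = - (x * b) ->
  sums (fun k => (ac k)%:C *: x ^+ k) l -> b * l = - (l * b).
Proof.
move=> bx xl; apply: (sums_unique (@sumsMl _ _ b _ _ xl)).
apply: (eq_sums (sumsN (@sumsMr _ _ b _ _ xl))) => k.
rewrite -calkin_ZAr -calkin_ZAl; have [ko|ke] := boolP (odd k); last first.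
  by rewrite asinh_coef_even// !scale0r oppr0.
rewrite -scalerN; congr (_ *: _); case: k ko => // k /= ke.
rewrite exprS mulrA bx mulNr -!mulrA; congr (- (_ * _)).
rewrite (exprn_even x ke); apply/esym/commrX.
by rewrite /GRing.comm mulrA bx mulNr -mulrA bx mulrN opprK mulrA.
Qed.

End EvenOddSeries.

(** * Skew elements with exponential 1 *)

Section ExpUniqueness.
Variables (R : realType) (H : hilbertType R).
Local Notation C := (calkin H).

(* s = exp (x / 2) is a symmetry, so s - 1 has norm 0 or 2, and the arc bound
   excludes 2. *)
Lemma exp_half_eq1 (x : C) : star x = - x -> rnorm x < pi ->
  calkin_exp (x + x) = 1 -> calkin_exp x = 1.
Proof.
move=> xs xpi; rewrite expD// => ss; set s := calkin_exp x in ss *.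
have sN : calkin_exp (- x) = s by rewrite -[LHS]mul1r -ss -mulrA expN mulr1.
have sa : star s = s by rewrite /s exp_skew_star.
pose a := s - 1.
have aa : star a * a = - (a *+ 2).
  rewrite /a starB star1 sa mulrBl mulrBr ss mulr1 mul1r mulr2n opprD.
  by rewrite [RHS]opprD opprB opprK [- s + 1]addrC.
have := rnorm_starM a; rewrite aa rnormN rnorm_mulr2n.
have := rnorm_exp_sub1 xs xpi; rewrite -/s -/a => a2 e.
have a0 : rnorm a = 0.
  have : rnorm a * (2 - rnorm a) = 0 by rewrite mulrBr -expr2 -e; ring.
  move/eqP; rewrite mulf_eq0 => /orP[/eqP//|]; rewrite subr_eq0 => /eqP a22.
  by move: a2; rewrite -a22 ltxx.
by apply/eqP; rewrite -subr_eq0; apply/eqP/rnorm_eq0.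
Qed.

(** Repeated halving keeps the exponential equal to 1: the bound 2 pi becomes pi at the first
    halving, where [exp_half_eq1] applies. Once y = x / 2^n has norm below 1, [exp_remainder] reads
    |y| <= |y|^2 and forces y = 0. *)
Lemma exp_eq1 (x : C) : star x = - x -> rnorm x < 2 * pi -> calkin_exp x = 1 -> x = 0.
Proof.
move=> xs xpi x1.
pose y n := ((2^-1 : R) ^+ n)%:C *: x.
have yn n : rnorm (y n) = 2^-1 ^+ n * rnorm x.
  by rewrite /y rnormZr ger0_norm// exprn_ge0.
have yS n : y n = y n.+1 + y n.+1.
  rewrite /y -scalerDl -rmorphD /=; congr (_%:C *: _).
  by rewrite exprS; move: (2^-1 ^+ n) => r; lra.
have key n : calkin_exp (y n) = 1.
  elim: n => [|n IH]; first by rewrite /y expr0 scale1r.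
  apply: exp_half_eq1; last by rewrite -yS.
    by rewrite /y starZr xs scalerN.
  rewrite yn exprS -mulrA.
  have : 2^-1 ^+ n * rnorm x <= rnorm x.
    by rewrite ler_piMl ?rnorm_ge0// exprn_ile1// invf_le1// ler1n.
  lra.
have [n hn] : exists n, rnorm x < 2 ^+ n.
  exists (Num.bound (rnorm x)); apply: lt_le_trans (natr_le_exp2 _ _).
  exact: (archi_boundP (rnorm_ge0 x)).
have n0 : 0 < (2^-1 : R) ^+ n by rewrite exprn_gt0.
have y1 : rnorm (y n) < 1 by rewrite yn exprVn mulrC ltr_pdivrMr ?mul1r// exprn_gt0.
have := exp_remainder (ltW y1); rewrite key subrr sub0r rnormN => h.
have y0 : rnorm (y n) = 0 by have := rnorm_ge0 (y n); nra.
move: y0; rewrite yn => /eqP; rewrite mulf_eq0 (gt_eqF n0) /= => /eqP.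
exact: rnorm_eq0.
Qed.

End ExpUniqueness.

(** * The logarithm attached to two symmetries *)

Section Geodesics.
Variables (R : realType) (H : hilbertType R).
Local Notation C := (calkin H).
Implicit Types (p q e f z w : C).

(** Identities between products of the halves [c] and [d] are checked after multiplication by 4, in
    terms of [e] and [f]. *)
Lemma mulr4n_inj (x y : C) : x *+ 4 = y *+ 4 -> x = y.
Proof.
move=> xy; have n4 : (4%:R : R[i]) != 0 by rewrite pnatr_eq0.
by apply: (scalerI n4); rewrite !scaler_nat.
Qed.

Lemma symm_sub_sqr (e f : C) : e * e = 1 -> f * f = 1 ->
  (e - f) * (e - f) = 2 - (f * e + e * f).
Proof.
move=> ee ff; rewrite mulrBl !mulrBr ee ff [- (f * e - 1)]opprB addrACA -opprD.
by rewrite [e * f + _]addrC.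
Qed.

Lemma symm_add_sqr (e f : C) : e * e = 1 -> f * f = 1 ->
  (f + e) * (f + e) = 2 + (f * e + e * f).
Proof.
by move=> ee ff; rewrite mulrDl !mulrDr ee ff [e * f + _]addrC addrACA.
Qed.

Lemma symm_add_sub (e f : C) : e * e = 1 -> f * f = 1 ->
  (f + e) * (e - f) = f * e - e * f.
Proof. by move=> ee ff; rewrite mulrDl !mulrBr ee ff addrA subrK. Qed.

Lemma symm_sub_add (e f : C) : e * e = 1 -> f * f = 1 ->
  (e - f) * (f + e) = - (f * e - e * f).
Proof. by move=> ee ff; rewrite mulrBl !mulrDr ee ff opprD addrA addrK opprB. Qed.

Lemma mulr22 (x y : C) : (x * y) *+ 4 = (x *+ 2) * (y *+ 2).
Proof. by rewrite mulrnAl mulrnAr -mulrnA. Qed.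

Section TwoSymmetries.
Variables e f c d : C.
Hypotheses (es : star e = e) (fs : star f = f) (ee : e * e = 1) (ff : f * f = 1).
Hypotheses (c2 : c *+ 2 = f + e) (d2 : d *+ 2 = e - f).

Let mulr2n_inj (x y : C) : x *+ 2 = y *+ 2 -> x = y.
Proof. by move=> xy; apply: mulr4n_inj; rewrite (mulrnA x 2 2) xy -mulrnA. Qed.

Let dd4 : (d * d) *+ 4 = 2 - (f * e + e * f).
Proof. by rewrite mulr22 d2 symm_sub_sqr. Qed.

Let cd4 : (c * d) *+ 4 = f * e - e * f.
Proof. by rewrite mulr22 c2 d2 symm_add_sub. Qed.

Let dc : d * c = - (c * d).
Proof. by apply: mulr4n_inj; rewrite mulr22 d2 c2 symm_sub_add// mulNrn cd4. Qed.

Lemma symm_cos_sin : c * c + d * d = 1.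
Proof.
by apply: mulr4n_inj; rewrite mulrnDl dd4 mulr22 c2 symm_add_sqr// addrACA subrr addr0 -natrD.
Qed.

Lemma symm_sin_star : star d = d.
Proof.
apply: mulr2n_inj; rewrite d2 [LHS]mulr2n -starD -mulr2n d2.
by rewrite starB es fs.
Qed.

Lemma symm_cos_star : star c = c.
Proof.
apply: mulr2n_inj; rewrite c2 [LHS]mulr2n -starD -mulr2n c2.
by rewrite starD es fs.
Qed.

(** From f (f + e) = 1 + f e = (f + e) e: [c] intertwines the two symmetries, and it remains to
    normalize it. *)
Let fc : f * c = c * e.
Proof.
apply: mulr2n_inj; rewrite -(mulrnAr f c) -(mulrnAl c e) c2 mulrDl mulrDr ff ee.
by rewrite addrC.
Qed.

Let ce : c + d = e.
Proof. by apply: mulr2n_inj; rewrite mulrnDl c2 d2 addrC subrKA -mulr2n. Qed.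

Let ed : e * (c * d) = - (c * d * e).
Proof.
have h : e * (f * e - e * f) = - ((f * e - e * f) * e).
  by rewrite mulrBr mulrBl !mulrA ee mul1r -[f * e * e]mulrA ee mulr1 opprB.
by apply: mulr4n_inj; rewrite mulNrn -(mulrnAr e (c * d)) -(mulrnAl (c * d) e) cd4 h.
Qed.

(** [d * d] and [c * d] are linear combinations of 1, [f * e] and [e * f]. This is the source of the
    commutation clause of [symm_log], on which uniqueness rests. *)
Let commD (b : C) : b * (f * e) = f * e * b -> b * (e * f) = e * f * b ->
  b * (d * d) = d * d * b /\ b * (c * d) = c * d * b.
Proof.
move=> h1 h2; split; apply: mulr4n_inj.
  rewrite -(mulrnAr b (d * d)) -(mulrnAl (d * d) b) dd4.
  by rewrite mulrBr mulrBl (mulrDr b (f * e)) (mulrDl (f * e)) h1 h2 mulr_natr mulr_natl.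
by rewrite -(mulrnAr b (c * d)) -(mulrnAl (c * d) b) cd4 mulrBr mulrBl h1 h2.
Qed.

(* x = i d only serves to obtain Q = (1 - d^2)^(-1/2); the logarithm z is the
   arcsinh of y = c d Q. *)
Lemma symm_log : rnorm d < 1 -> exists z : C,
  [/\ star z = - z, e * z = - (z * e), calkin_exp z * e = f * calkin_exp z,
      rnorm z <= asin (rnorm d) &
      forall b, b * (f * e) = f * e * b -> b * (e * f) = e * f * b -> b * z = z * b].
Proof.
move=> d1; pose x : C := (0 +i* 1) *: d.
have xx : x * x = - (d * d).
  rewrite /x -calkin_ZAl -calkin_ZAr scalerA.
  have -> : (0 +i* 1) * (0 +i* 1) = -1 :> R[i] by simpc.
  by rewrite scaleN1r.
have xn : rnorm x = rnorm d by rewrite /x rnormZi.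
have xs : star x = - x.
  rewrite /x starZ symm_sin_star -scaleNr; congr (_ *: _).
  by rewrite /=; simpc.
have x1 : rnorm x < 1 by rewrite xn.
have [Q [_ [Qs _ QQ _]]] := exp_arcsinh x1.
have Qc b : b * (d * d) = d * d * b -> b * Q = Q * b.
  by move=> bd; apply: (rsqrt_series_comm Qs); rewrite xx mulrN mulNr bd.
have Qstar := rsqrt_series_star xs Qs.
have cdd : c * (d * d) = d * d * c.
  by rewrite -(mulrA d d c) dc mulrN (mulrA d c) dc mulNr opprK mulrA.
have cQ := Qc c cdd.
have dQ : d * Q = Q * d by apply: Qc; rewrite mulrA.
have edd : e * (d * d) = d * d * e.
  apply: mulr4n_inj; rewrite -(mulrnAr e (d * d)) -(mulrnAl (d * d) e) dd4.
  rewrite mulrBr mulrBl (mulrDr e (f * e)) (mulrDl (f * e)).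
  by rewrite !mulrA ee mul1r -[f * e * e]mulrA ee mulr1 mulr_natr mulr_natl [f + _]addrC -!mulrA.
have eQ := Qc e edd.
have ccE : 1 - d * d = c * c by rewrite -symm_cos_sin addrK.
have QQ1 : Q * Q * (c * c) = 1 by rewrite -mulrA -ccE -xx QQ.
pose y := c * d * Q.
(* [Q] commutes with c and d, so y^2 = c d c d Q^2 = - d^2 c^2 Q^2, and Q^2 c^2 = 1. *)
have yy : y * y = - (d * d).
  rewrite /y -!mulrA (mulrA Q c) -cQ -!mulrA (mulrA Q d) -dQ -!mulrA.
  rewrite (mulrA d c) dc mulNr mulrN -!mulrA; congr (- _).
  rewrite (mulrA d d) (mulrA (d * d) Q) (Qc (d * d) erefl) -!mulrA (mulrA d d).
  rewrite (mulrA c Q) cQ -!mulrA.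
  rewrite (mulrA d d Q) (Qc (d * d) erefl) !(mulrA c Q) cQ -!(mulrA Q c).
  rewrite (mulrA c Q) cQ -(mulrA Q c).
  by rewrite (mulrA c c) (mulrA Q Q) (mulrA (Q * Q)) QQ1 mul1r.
have ys : star y = - y.
  by rewrite /y !starM Qstar symm_sin_star symm_cos_star dc mulrN (mulrA Q c) -cQ -!mulrA dQ.
(* The C*-identity applied to y^* y = - y^2 = d^* d. *)
have yn : rnorm y = rnorm d.
  apply/eqP; rewrite -(@eqrXn2 _ 2) ?rnorm_ge0//; apply/eqP.
  by rewrite -!rnorm_starM ys symm_sin_star mulNr yy opprK.
have y1 : rnorm y < 1 by rewrite yn.
have [Q2 [z [Q2s zs _ ez]]] := exp_arcsinh y1.
have QQ2 : Q2 = Q.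
  apply: (sums_unique Q2s); apply: (eq_sums Qs) => k.
  by apply: rsqrt_series_even; rewrite xx yy.
(* (1 + y^2) Q + y = c c Q + c d Q = c (c + d) Q, and c + d = e. *)
have ezE : calkin_exp z = c * e * Q.
  by rewrite ez QQ2 yy ccE /y -mulrDl -mulrDr ce.
have ey : e * y = - (y * e).
  by rewrite /y mulrA ed mulNr -!mulrA eQ.
exists z; split.
- exact: asinh_series_star ys zs.
- exact: asinh_series_anticomm ey zs.
- rewrite ezE -!mulrA -eQ (mulrA e e) ee mul1r (mulrA f) fc -!mulrA (mulrA e e) ee.
  by rewrite mul1r.
- by rewrite -yn; exact: rnorm_arcsinh.
move=> b h1 h2; have [bD bcd] := commD h1 h2.
have by1 : b * y = y * b by rewrite /y mulrA bcd -!mulrA (Qc b bD).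
exact: pow_sums_comm by1 zs.
Qed.

End TwoSymmetries.
End Geodesics.

(** * Geodesic curves and their lengths *)

Section GeodesicCurves.
Variables (R : realType) (H : hilbertType R).
Local Notation C := (calkin H).
Local Notation mu := (@lebesgue_measure R).

Definition geodesic (z p : C) (t : R) : C :=
  calkin_exp (t%:C *: z) * p * calkin_exp (- (t%:C *: z)).

Lemma symm_rnorm_le1 (e : C) : star e = e -> e * e = 1 -> rnorm e <= 1.
Proof.
move=> es ee; rewrite -(@ler_pXn2r _ 2) ?nnegrE ?rnorm_ge0// expr1n -rnorm_starM es ee.
exact: calkin_rnorm1.
Qed.

Lemma anticomm_symm (p z : C) :
  (p *+ 2 - 1) * z = - (z * (p *+ 2 - 1)) -> p * z + z * p = z.
Proof.
rewrite mulrBl mulrBr mul1r mulr1 mulrnAl mulrnAr opprB => /eqP.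
rewrite subr_eq addrAC -mulr2n eq_sym subr_eq -mulrnDl => /eqP h.
by apply: mulr4n_inj; rewrite !(mulrnA _ 2 2) h.
Qed.

Section OneGeodesic.
Variables z p : C.
Hypotheses (zs : star z = - z) (hp : p \in projections H).
Let e := p *+ 2 - 1.

Let E t : C := calkin_exp (t%:C *: z).
Let F t : C := calkin_exp (- (t%:C *: z)).

Let skew t : star (t%:C *: z) = - (t%:C *: z).
Proof. by rewrite starZr zs scalerN. Qed.

Let E_le1 t : rnorm (E t) <= 1.
Proof. exact: rnorm_exp_skew. Qed.

Let F_le1 t : rnorm (F t) <= 1.
Proof. by apply: rnorm_exp_skew; rewrite starN skew. Qed.

Let conj_le t x : rnorm (E t * x * F t) <= rnorm x.
Proof.
apply: le_trans (calkin_rnormM _ _) _; rewrite -[leRHS]mulr1.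
rewrite ler_pM ?rnorm_ge0//; apply: le_trans (calkin_rnormM _ _) _.
by rewrite ler_piMl ?rnorm_ge0.
Qed.

Let conj_rnorm t x : rnorm (E t * x * F t) = rnorm x.
Proof.
apply/eqP; rewrite eq_le conj_le /=.
have {1}-> : x = F t * (E t * x * F t) * E t.
  by rewrite !mulrA /E /F expNl mul1r -mulrA expNl mulr1.
apply: le_trans (calkin_rnormM _ _) _; rewrite -[leRHS]mulr1.
rewrite ler_pM ?rnorm_ge0//; apply: le_trans (calkin_rnormM _ _) _.
by rewrite ler_piMl ?rnorm_ge0.
Qed.

Lemma geodesic_projections t : geodesic z p t \in projections H.
Proof.
move: hp; rewrite !inE => -[ps pp]; rewrite /geodesic -/(E t) -/(F t); split.
  rewrite !starM ps mulrA; congr (_ * _ * _).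
    by rewrite /F exp_skew_star ?opprK// starN skew opprK.
  exact: (exp_skew_star (skew t)).
have FE : F t * E t = 1 by exact: expNl.
by rewrite !mulrA -(mulrA (E t * p) (F t)) FE mulr1 -(mulrA (E t) p) pp.
Qed.

Lemma geodesic0 : geodesic z p 0 = p.
Proof. by rewrite /geodesic !scale0r oppr0 exp0 mul1r mulr1. Qed.

Lemma conj_deriv x t : hasderiv (fun s => E s * x * F s) t (E t * (z * x - x * z) * F t).
Proof.
have dE : hasderiv E t (E t * z).
  have -> : E t * z = z * E t.
    by apply/esym/exp_comm; rewrite -calkin_ZAl -calkin_ZAr.
  exact: hasderiv_exp.
have dF : hasderiv F t (- (z * F t)).
  rewrite -mulNr; have -> : F = fun s => calkin_exp (s%:C *: (- z)).
    by apply/funext => s; rewrite scalerN.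
  exact: hasderiv_exp.
have := hasderivM (hasderivMr (a := x) dE) dF; congr hasderiv.
by rewrite mulrN mulrBr mulrBl !mulrA.
Qed.

(** The velocity is the commutator z p - p z conjugated by a unitary, and this commutator equals z e
    with e a symmetry, so both operations preserve the norm. *)
Lemma geodesic_velocity t : e * z = - (z * e) ->
  rnorm (velocity (geodesic z p) t) = rnorm z.
Proof.
move=> ez; have -> : velocity (geodesic z p) t = E t * (z * p - p * z) * F t.
  by apply: (cvg_lim (@norm_hausdorff _ _)); exact: conj_deriv.
have [es ee] := proj_symmetry hp; rewrite -/e in es ee.
have zpE : z * p - p * z = z * e.
  rewrite /e mulrBr mulr1 mulrnAr.
  have pz : p * z = z - z * p by rewrite -{2}(anticomm_symm ez) addrK.
  by rewrite pz opprB addrCA addrA -mulr2n.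
rewrite conj_rnorm zpE; apply/eqP; rewrite eq_le; apply/andP; split.
  by rewrite (le_trans (calkin_rnormM _ _))// ler_piMr ?rnorm_ge0// symm_rnorm_le1.
rewrite -{1}[z]mulr1 -ee mulrA (le_trans (calkin_rnormM _ _))// ler_piMr ?rnorm_ge0//.
exact: symm_rnorm_le1.
Qed.

Lemma geodesic_length : e * z = - (z * e) ->
  curve_length 0 1 (geodesic z p) = (rnorm z)%:E.
Proof.
move=> ez; rewrite /curve_length.
under eq_integral do rewrite geodesic_velocity//.
rewrite integral_cst//= lebesgue_measure_itv /= lte_fin ltr01 oppr0 adde0 mule1.
by [].
Qed.

Lemma geodesic_smooth : piecewise_smooth 0 1 (geodesic z p).
Proof.
exists 1%N, (fun i => i%:R); split => // -[|//] _; split; first exact: ltr01.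
(* The n-th derivative is the conjugate of the n-fold commutator of z with p. *)
pose ad := fun x => z * x - x * z.
exists (fun n t => E t * iter n ad p * F t); split => // n t _.
by apply: cvg_within_filter; exact: conj_deriv.
Qed.

End OneGeodesic.

(** Both diagonal corners vanish exactly when z = p z + z p. Anticommutation with 2p - 1 is the form
    in which this passes through power series. *)
Lemma codiagonal_symm (p z : C) :
  p * z * p = 0 -> (1 - p) * z * (1 - p) = 0 -> (p *+ 2 - 1) * z = - (z * (p *+ 2 - 1)).
Proof.
move=> h1 h2; rewrite mulrBl mulrBr mul1r mulr1 mulrnAl mulrnAr opprB.
have h : z = p * z + z * p.
  move: h2; rewrite mulrBr mulr1 mulrBl mul1r mulrBl h1 subr0.
  by move/eqP; rewrite -addrA -opprD subr_eq0 => /eqP.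
apply/eqP; rewrite subr_eq addrAC -mulr2n eq_sym subr_eq -mulrnDl.
by rewrite -h.
Qed.

Lemma symm_codiagonal (p z : C) : p * p = p ->
  (p *+ 2 - 1) * z = - (z * (p *+ 2 - 1)) -> p * z * p = 0 /\ (1 - p) * z * (1 - p) = 0.
Proof.
move=> pp /anticomm_symm h.
have h1 : p * z * p = 0.
  by apply: (addrI (p * z)); rewrite addr0 -{3}h mulrDr !mulrA pp.
split => //; rewrite mulrBr mulr1 mulrBl mul1r mulrBl h1 subr0.
by rewrite -addrA -opprD h subrr.
Qed.

Lemma exp_intertwine (p q x : C) :
  x * (p *+ 2 - 1) = (q *+ 2 - 1) * x <-> x * p = q * x.
Proof.
rewrite mulrBl mulrBr mul1r mulr1 mulrnAl mulrnAr; split => [/addIr h|-> //].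
by apply: mulr4n_inj; rewrite !(mulrnA _ 2 2) h.
Qed.

(** Anticommutation gives f = e^v e e^(-v) = e^(2v) e. Thus e^(2v) is the same for every [v] whose
    geodesic joins the two projections. *)
Lemma exp_double (e f v : C) : e * e = 1 -> e * v = - (v * e) ->
  calkin_exp v * e = f * calkin_exp v -> calkin_exp (v + v) = f * e.
Proof.
move=> ee ev fv; have eE : e * calkin_exp (- v) = calkin_exp v * e.
  by rewrite -{2}(opprK v); apply: exp_anticomm; rewrite mulrN ev mulNr.
rewrite expD//; have -> : f = calkin_exp v * calkin_exp v * e.
  by rewrite -mulrA -eE mulrA fv -mulrA expN mulr1.
by rewrite -mulrA ee mulr1.
Qed.

End GeodesicCurves.

(** * Existence and uniqueness of the minimal geodesic *)

Theorem theorem3p7 (R : realType) (H : hilbertType R) (p q : calkin H)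
  (hp : p \in projections H) (hq : q \in projections H)
  (hb : let b := p + q in trivial_annihilator (b - 1)) :
  exists! delta : R -> calkin H, minimal_geodesic p q delta.
Proof.
have [es ee] := proj_symmetry hp; have [fs ff] := proj_symmetry hq.
set e := p *+ 2 - 1 in es ee; set f := q *+ 2 - 1 in fs ff.
pose c := p + q - 1; pose d := p - q.
have c2 : c *+ 2 = f + e.
  by rewrite /c /e /f mulrnBl mulrnDl mulr2n opprD addrACA addrC.
have d2 : d *+ 2 = e - f by rewrite /d mulrnBl /e /f opprB addrA subrK.
have d1 : rnorm d < 1.
  apply: (trivial_annihilator_lt1 _ _ _ hb).
  - exact: symm_cos_star c2.
  - exact: symm_sin_star d2.
  - exact: symm_cos_sin c2 d2.
have [z [zs ez qz zd zcomm]] := symm_log es fs ee ff c2 d2 d1.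
have pp : p * p = p by move: hp; rewrite inE => -[].
have lenz : curve_length 0 1 (geodesic z p) = (rnorm z)%:E by exact: geodesic_length.
have dpi : asin (rnorm d) < pi / 2.
  by apply: asin_ltpi2; rewrite d1 andbT (le_trans _ (rnorm_ge0 d))// lerN10.
have joins : geodesic_joining p q (geodesic z p).
  split; last 2 first.
  - exact: geodesic0.
  - rewrite /geodesic scale1r; move/exp_intertwine: qz => ->.
    by rewrite -mulrA expN mulr1.
  have [z1 z2] := symm_codiagonal pp ez.
  by exists z.
exists (geodesic z p); split.
  split=> [|a b gamma ab gs gP ga gb]; first exact: joins.
  rewrite lenz.
  have gd : rnorm (gamma b - gamma a) = rnorm d by rewrite ga gb rnormB.
  apply: le_trans (curve_length_ge ab gs gP _); last by rewrite gd.
  by rewrite gd lee_fin.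
move=> delta [[[w [ws w1 w2 wE]] _ delta1] minw].
have {wE} deltaE : delta = geodesic w p by apply/funext => t; rewrite wE.
rewrite {delta}deltaE in delta1 minw *.
have ew := codiagonal_symm w1 w2; rewrite -/e in ew.
(* The lengths of the two geodesics are |w| and |z|, and [geodesic z p] is an admissible
   competitor. *)
have wz : rnorm w <= rnorm z.
  have := minw 0 1 (geodesic z p) ltr01 (geodesic_smooth z p).
  rewrite lenz geodesic_length// lee_fin; apply.
  - by move=> t _; exact: geodesic_projections.
  - exact: geodesic0.
  - by case: joins.
have qw : calkin_exp w * e = f * calkin_exp w.
  apply/exp_intertwine; rewrite -delta1 /geodesic scale1r.
  by rewrite -!mulrA expNl mulr1.
have ww := exp_double ee ew qw; have zz := exp_double ee ez qz.
(* [w] commutes with e^(2w) = f e and with its adjoint e f, hence with [z] by the last clause of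
   [symm_log]. *)
have wfe : w * (f * e) = f * e * w by rewrite -ww; apply: exp_comm; rewrite mulrDr mulrDl.
have skew2 : star (w + w) = - (w + w) by rewrite starD ws opprD.
have ef : e * f = calkin_exp (- (w + w)).
  by rewrite -(exp_skew_star skew2) ww starM es fs.
have wef : w * (e * f) = e * f * w.
  by rewrite ef; apply: exp_comm; rewrite mulrN mulNr mulrDr mulrDl.
have wzC := zcomm w wfe wef.
pose h := w + w - (z + z).
(* |h| <= 2 |w| + 2 |z| <= 4 |z| <= 4 asin |d| < 2 pi, within the range of [exp_eq1]. *)
have h0 : h = 0.
  apply: exp_eq1.
  - by rewrite /h starB !starD ws zs -!opprD.
  - have := rnormD (w + w) (- (z + z)); rewrite rnormN.
    have := rnormD w w; have := rnormD z z; rewrite -/h.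
    move: dpi zd wz; move: (rnorm h) (rnorm (w + w)) (rnorm (z + z)) (rnorm w) (rnorm z) (asin _).
    by move: (pi : R) => P r1 r2 r3 r4 r5 r6; clear; lra.
  - rewrite /h expD; last first.
      by rewrite mulrN mulNr !mulrDr !mulrDl wzC.
    by rewrite ww -zz expN.
suff -> : w = z by [].
apply: mulr4n_inj; rewrite !(mulrnA _ 2 2); congr (_ *+ 2).
by apply/eqP; rewrite -subr_eq0 !mulr2n -/h h0.
Qed.
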